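(* Let $X$ and $Y$ be metric spaces with bounded geometry, and let $p\in[1,\infty)$. (1) $X$ and $Y$ are bijectively coarsely equivalent if and only if $\mathbb{C}^p_u[X]$ and $\mathbb{C}^p_u[Y]$ are isometrically isomorphic. (2) If $A^p[X]$ and $A^p[Y]$ are algebraic $\ell^p$ Roe-type algebras associated to $X$ and $Y$ respectively, and there is an isometric isomorphism between $A^p[X]$ and $A^p[Y]$, then $X$ and $Y$ are coarsely equivalent. The same conclusion holds if $\mathbb{C}^p_s[X]$ and $\mathbb{C}^p_s[Y]$ are isometrically isomorphic. Conversely, if $X$ and $Y$ are coarsely equivalent, then $U\mathbb{C}^p[X]$ and $U\mathbb{C}^p[Y]$ are isometrically isomorphic, $\mathbb{C}^p[X]$ and $\mathbb{C}^p[Y]$ are isometrically isomorphic, and $\mathbb{C}^p_s[X]$ and $\mathbb{C}^p_s[Y]$ are isometrically isomorphic.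
   Context: A metric space $X$ has bounded geometry if for all $R\ge 0$ there is $N_R\in\mathbb{N}$ such that every ball of radius $R$ in $X$ has at most $N_R$ elements (so $X$ is countable and discrete). A map $f:X\to Y$ is uniformly expansive if for all $R>0$ there is $S>0$ such that $d(x_1,x_2)\le R$ implies $d(f(x_1),f(x_2))\le S$. Two maps $f,g:X\to Y$ are close if there is $C>0$ with $d(f(x),g(x))\le C$ for all $x\in X$. $X$ and $Y$ are coarsely equivalent if there are uniformly expansive maps $f:X\to Y$, $g:Y\to X$ such that $f\circ g$ and $g\circ f$ are close to the identity maps; then $f$ and $g$ are called coarse equivalences. A bijective coarse equivalence is a coarse equivalence that is a bijection; $X$ and $Y$ are bijectively coarsely equivalent if one exists. All algebras below carry the operator norm. Isometric isomorphism means an isometric (complex-linear, multiplicative, bijective) algebra isomorphism. An operator $T\in B(\ell^p(X))$ has matrix entries $T_{xy}=(T\delta_y)(x)$; more generally for a set $S$ an operator $T\in B(\ell^p(X,\ell^p(S)))$ has entries $T_{xy}\in B(\ell^p(S))$, $x,y\in X$. Its propagation is $\sup\{d(x,y):T_{xy}\ne 0\}$. $\mathbb{C}^p_u[X]$ is the algebra of all bounded operators on $\ell^p(X)$ of finite propagation. Algebraic $\ell^p$ Roe-type algebras: let $S$ be $\mathbb{N}$ or $\{1,\dots,n\}$ for some $n\in\mathbb{N}$. An operator $T=(T_{xy})\in B(\ell^p(X,\ell^p(S)))$ is locally compact if every $T_{xy}$ is a compact operator on $\ell^p(S)$. A subalgebra $A^p[X]\subseteq B(\ell^p(X,\ell^p(S)))$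 is an algebraic $\ell^p$ Roe-type algebra if it consists only of locally compact, finite propagation operators and contains all finite propagation operators $T$ for which there is $N\in\mathbb{N}$ with $\operatorname{rank}T_{xy}\le N$ for all $x,y$. With $\ell^p=\ell^p(\mathbb{N})$ and $\overline{M}^p_\infty=\overline{\bigcup_{n}M_n(\mathbb{C})}\subset B(\ell^p(\mathbb{N}))$ (norm closure): $U\mathbb{C}^p[X]$ is the algebra of all finite propagation bounded operators $T$ on $\ell^p(X,\ell^p)$ for which there is $N\in\mathbb{N}$ with $\operatorname{rank}T_{xy}\le N$ for all $x,y\in X$. $\mathbb{C}^p[X]$ is the algebra of all finite propagation bounded operators $T$ on $\ell^p(X,\ell^p)$ with $T_{xy}\in\overline{M}^p_\infty$ for all $x,y\in X$. $\mathbb{C}^p_s[X]$ is the algebra of all finite propagation bounded operators $T$ on $\ell^p(X,\ell^p)$ for which there is a finite-dimensional subspace $E_T\subset\ell^p$ such that $T_{xy}\in B(E_T)$ for all $x,y\in X$; here $T_{xy}\in B(E_T)$ means $T_{xy}=PT_{xy}P$ for a bounded idempotent $P=P_T$ on $\ell^p$ with range $E_T$, chosen independently of $x,y$. *)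

(* Defs.v *)
From HB Require Import structures.
From mathcomp Require Import all_boot all_order all_algebra complex.
From mathcomp Require Import all_classical all_reals all_analysis.
From mathcomp Require Import ring lra.

Set Implicit Arguments.
Unset Strict Implicit.
Unset Printing Implicit Defensive.

Import Order.TTheory GRing.Theory Num.Theory.
Import numFieldNormedType.Exports.

Local Open Scope classical_set_scope.
Local Open Scope ring_scope.

Section PowerSums.
Context {R : realType} (p : R) (p1 : 1 <= p) {I : choiceType}.
Implicit Types u v : I -> R.

Let p0 : 0 < p. Proof. exact: lt_le_trans p1. Qed.
Let pn0 : p != 0. Proof. by rewrite gt_eqF. Qed.

Definition psum u : \bar R := \esum_(i in [set: I]) (u i `^ p)%:E.

Lemma psum_ge0 u : (0 <= psum u)%E.
Proof. by apply: esum_ge0 => i _; rewrite lee_fin powR_ge0. Qed.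

Lemma esum_scale_le (c : R) (F : I -> R) : 0 <= c -> (forall i, 0 <= F i) ->
  (\esum_(i in [set: I]) (c * F i)%:E
     <= c%:E * \esum_(i in [set: I]) (F i)%:E)%E.
Proof.
move=> c0 F0; apply: ge_ereal_sup => _ [A [finA _] <-].
under eq_fsbigr do rewrite EFinM.
rewrite -ge0_mule_fsumr; last by move=> i; rewrite lee_fin.
apply: lee_wpmul2l; first by rewrite lee_fin.
by apply: ereal_sup_ubound; exists A.
Qed.

Lemma psum_minkowski u v (a b : R) : 0 < a -> 0 < b ->
  (forall i, 0 <= u i) -> (forall i, 0 <= v i) ->
  (psum u <= (a `^ p)%:E)%E -> (psum v <= (b `^ p)%:E)%E ->
  (psum (fun i => (u i + v i)%R) <= ((a + b) `^ p)%:E)%E.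
Proof.
move=> a0 b0 u0 v0 ua vb.
have ab0 : 0 < a + b by rewrite addr_gt0.
have t01 : (0 <= a / (a + b) <= 1)%R.
  apply/andP; split; first by rewrite divr_ge0// ltW.
  by rewrite ler_pdivrMr// mul1r lerDl ltW.
have /andP[t0 t1] := t01; pose t := Itv01 t0 t1.
pose cu := (a + b) `^ p * (a / (a + b)) / a `^ p.
pose cv := (a + b) `^ p * (b / (a + b)) / b `^ p.
have cu0 : 0 <= cu.
  by rewrite !mulr_ge0 ?invr_ge0 ?powR_ge0 ?(ltW a0) ?(ltW b0) ?(ltW ab0).
have cv0 : 0 <= cv.
  by rewrite !mulr_ge0 ?invr_ge0 ?powR_ge0 ?(ltW a0) ?(ltW b0) ?(ltW ab0).
have pwdiv (x c : R) : 0 <= x -> 0 < c -> (x / c) `^ p = x `^ p / c `^ p.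
  move=> x0 c0; rewrite powRM ?invr_ge0 ?(ltW c0)//; congr (_ * _).
  by rewrite -powR_inv1 ?(ltW c0)// -powRrM mulN1r powRN.
have pw i : (u i + v i) `^ p <= cu * u i `^ p + cv * v i `^ p.
  have := @convex_powR R p p1 t (u i / a) (v i / b).
  rewrite !inE /= !in_itv /= !andbT !divr_ge0 ?(ltW a0) ?(ltW b0)//.
  move=> /(_ isT isT) H; rewrite convRE [X in X `^ _ <= _]convRE /= /unstable.onem in H; move: H.
  have -> : 1 - (a / (a + b)) = b / (a + b).
    by field; rewrite gt_eqF.
    have -> : a / (a + b) * (u i / a) + b / (a + b) * (v i / b) =
     (u i + v i) / (a + b).
    by field; rewrite !gt_eqF.
  rewrite !pwdiv ?addr_ge0// => H.
  have abp : 0 < (a + b) `^ p by rewrite powR_gt0.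
  move: H; rewrite ler_pdivrMr// => H; apply: (le_trans H).
  by rewrite le_eqVlt; apply/orP; left; apply/eqP; rewrite /cu /cv; ring.
have sc c w d : 0 < d -> 0 <= c -> (psum w <= (d `^ p)%:E)%E ->
    (\esum_(i in [set: I]) (c * w i `^ p)%:E <= (c * d `^ p)%:E)%E.
  move=> d0 c0 wd; apply: (le_trans (esum_scale_le c0 _)).
    by move=> i; rewrite powR_ge0.
  by rewrite EFinM lee_wpmul2l// lee_fin.
apply: (@le_trans _ _ (\esum_(i in [set: I])
    ((cu * u i `^ p)%:E + (cv * v i `^ p)%:E)%E)).
  by apply: le_esum => i _; rewrite -EFinD lee_fin.
rewrite esumD; last 2 first.
- by move=> i _; rewrite lee_fin mulr_ge0// powR_ge0.
- by move=> i _; rewrite lee_fin mulr_ge0// powR_ge0.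
apply: (le_trans (leeD (sc _ _ _ a0 cu0 ua) (sc _ _ _ b0 cv0 vb))).
rewrite -EFinD lee_fin le_eqVlt; apply/orP; left; apply/eqP.
have ap : a `^ p != 0 by rewrite gt_eqF// powR_gt0.
have bp : b `^ p != 0 by rewrite gt_eqF// powR_gt0.
by rewrite /cu /cv; field; rewrite ap bp gt_eqF.
Qed.

Definition pnorm u : R := fine (psum u) `^ p^-1.

Lemma pnorm_ge0 u : 0 <= pnorm u. Proof. exact: powR_ge0. Qed.

Lemma psum_pnorm u : (psum u < +oo)%E -> psum u = (pnorm u `^ p)%:E.
Proof.
move=> uoo; have uf : psum u \is a fin_num by rewrite ge0_fin_numE// psum_ge0.
by rewrite /pnorm -powRrM mulVf// powRr1 ?fine_ge0 ?psum_ge0// fineK.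
Qed.

Lemma pnorm_le u (a : R) : 0 <= a -> (psum u <= (a `^ p)%:E)%E -> pnorm u <= a.
Proof.
move=> a0 ua.
have uoo : (psum u < +oo)%E by rewrite (le_lt_trans ua)// ltry.
have -> : a = (a `^ p) `^ p^-1 by rewrite -powRrM mulfV// powRr1.
have uf : psum u \is a fin_num by rewrite ge0_fin_numE// psum_ge0.
apply: ge0_ler_powR.
- by rewrite invr_ge0 ltW.
- by rewrite nnegrE fine_ge0// psum_ge0.
- by rewrite nnegrE powR_ge0.
- by rewrite -lee_fin fineK.
Qed.

Lemma psum_le u v : (forall i, 0 <= u i <= v i) -> (psum u <= psum v)%E.
Proof.
move=> uv; apply: le_esum => i _; have /andP[u0 le_uv] := uv i.
rewrite lee_fin; apply: ge0_ler_powR => //; rewrite ?nnegrE ?(ltW p0)//.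
exact: le_trans le_uv.
Qed.

Lemma pnorm_minkowski u v :
  (forall i, 0 <= u i) -> (forall i, 0 <= v i) ->
  (psum u < +oo)%E -> (psum v < +oo)%E ->
  (psum (fun i => (u i + v i)%R) < +oo)%E /\
  pnorm (fun i => (u i + v i)%R) <= pnorm u + pnorm v.
Proof.
move=> u0 v0 uoo voo.
have approx w e : (psum w < +oo)%E -> 0 < e ->
    (psum w <= ((pnorm w + e) `^ p)%:E)%E.
  move=> woo e0; rewrite psum_pnorm// lee_fin.
  apply: ge0_ler_powR; rewrite ?nnegrE ?(ltW p0) ?pnorm_ge0//.
    by rewrite addr_ge0 ?pnorm_ge0// ltW.
  by rewrite lerDl ltW.
have bd e : 0 < e -> (psum (fun i => (u i + v i)%R) <=
    ((pnorm u + e + (pnorm v + e)) `^ p)%:E)%E.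
  move=> e0; apply: psum_minkowski => //; last 2 first.
  - exact: approx.
  - exact: approx.
  - by rewrite ltr_wpDl ?pnorm_ge0.
  - by rewrite ltr_wpDl ?pnorm_ge0.
split; first by rewrite (le_lt_trans (bd _ ltr01))// ltry.
apply/ler_addgt0Pr => e e0.
have e20 : 0 < e / 2 by rewrite divr_gt0.
have -> : pnorm u + pnorm v + e = pnorm u + e / 2 + (pnorm v + e / 2).
  by rewrite addrACA -splitr.
by apply: pnorm_le (bd _ e20); rewrite !addr_ge0 ?pnorm_ge0// ltW.
Qed.

End PowerSums.

(* Norms in a [normedModType R[i]] take their values in [R[i]]; [rnorm] is the
   same norm read in [R] (see [rnormE]). *)
Definition rnorm {R : realType} {E : normedModType R[i]} (v : E) : R :=
  complex.Re `|v|.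

Section Rnorm.
Context {R : realType} {E : normedModType R[i]}.
Implicit Types v w : E.
Local Open Scope complex_scope.

Lemma rnormE v : (rnorm v)%:C = `|v|.
Proof. by rewrite /rnorm RRe_real// normr_real. Qed.

Lemma rnorm_ge0 v : 0 <= rnorm v.
Proof. by rewrite -ler0c rnormE. Qed.

Lemma rnormD v w : rnorm (v + w) <= rnorm v + rnorm w.
Proof. by rewrite -lecR rmorphD /= !rnormE ler_normD. Qed.

Lemma rnormZ (c : R[i]) v : rnorm (c *: v) = complex.Re `|c| * rnorm v.
Proof.
have -> : complex.Re `|c| * rnorm v = complex.Re ((complex.Re `|c|)%:C * `|v|).
  by rewrite -rnormE -(rmorphM (real_complex R)).
by rewrite RRe_real ?normr_real// -normrZ.
Qed.

Lemma rnorm0 : rnorm (0 : E) = 0.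
Proof. by rewrite /rnorm normr0. Qed.

Lemma rnorm0_eq0 v : rnorm v = 0 -> v = 0.
Proof. by move=> v0; apply/normr0_eq0; rewrite -rnormE v0. Qed.

End Rnorm.

Section EllpPred.
Context {R : realType} (p : R) {I : choiceType} {E : normedModType R[i]}.

Definition ellp_pred : {pred I -> E} :=
  mem [set f : I -> E | (psum p (fun i => rnorm (f i)) < +oo)%E].
Definition ellp_key : pred_key ellp_pred. Proof. exact. Qed.
Canonical ellp_keyed := KeyedPred ellp_key.

End EllpPred.

Record ellp {R : realType} (p : R) (p1 : 1 <= p) (I : choiceType)
  (E : normedModType R[i]) := Ellp {
  ellp_fun :> I -> E ;
  ellp_funP : ellp_fun \in @ellp_pred R p I E }.

Section EllpSpace.
Context {R : realType} (p : R) (p1 : 1 <= p) (I : choiceType).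
Context (E : normedModType R[i]).
Local Notation L := (ellp p1 I E).

HB.instance Definition _ := [isSub of L for @ellp_fun R p p1 I E].
HB.instance Definition _ := [Choice of L by <:].

Let p0 : p != 0. Proof. by rewrite gt_eqF// (lt_le_trans _ p1). Qed.

Lemma psum_scale (c : R) (u : I -> R) : 0 <= c -> (forall i, 0 <= u i) ->
  (psum p (fun i => (c * u i)%R) <= (c `^ p)%:E * psum p u)%E.
Proof.
move=> c0 u0; rewrite /psum; under eq_esum do rewrite powRM//.
by apply: esum_scale_le => [|i]; rewrite powR_ge0.
Qed.

Lemma ellp_submod_closed : submod_closed (@ellp_pred R p I E).
Proof.
split.
  rewrite inE /= /psum esum1 ?ltry// => i _.
  by rewrite rnorm0 powR0.
move=> a f g; rewrite !inE /= => fP gP.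
have afP : (psum p (fun i => rnorm (a *: f i)%R) < +oo)%E.
  under [X in psum _ X]funext do rewrite rnormZ.
  apply: le_lt_trans (psum_scale _ _) _.
  - by rewrite -ler0c RRe_real ?normr_real.
  - by move=> i; exact: rnorm_ge0.
  - by rewrite lte_mul_pinfty ?lee_fin ?powR_ge0.
have [+ _] := pnorm_minkowski p1 (fun i => rnorm_ge0 (a *: f i))
  (fun i => rnorm_ge0 (g i)) afP gP.
by apply: le_lt_trans; apply: psum_le => // i; rewrite rnorm_ge0 rnormD.
Qed.

HB.instance Definition _ := GRing.isSubmodClosed.Build _ _ (@ellp_pred R p I E)
  ellp_submod_closed.
HB.instance Definition _ := [SubChoice_isSubLmodule of L by <:].

Local Open Scope complex_scope.

Let nm (f : L) : R[i] := (pnorm p (fun i => rnorm (f i)))%:C.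

Lemma ellpP (f : L) : (psum p (fun i => rnorm (f i)) < +oo)%E.
Proof. by have := ellp_funP f; rewrite inE. Qed.

Let nmD f g : nm (f + g) <= nm f + nm g.
Proof.
rewrite -rmorphD /= lecR.
have [fgoo /(le_trans _)] := pnorm_minkowski p1 (fun i => rnorm_ge0 (f i))
  (fun i => rnorm_ge0 (g i)) (ellpP f) (ellpP g).
apply; apply: pnorm_le => //; first exact: pnorm_ge0.
rewrite -psum_pnorm//; apply: psum_le => // i.
by rewrite rnorm_ge0 rnormD.
Qed.

Let nmZ_le (c : R[i]) f : nm (c *: f) <= `|c| * nm f.
Proof.
have c0 : 0 <= complex.Re `|c| by rewrite -ler0c RRe_real ?normr_real.
rewrite /nm -[`|c|]RRe_real ?normr_real// -rmorphM lecR.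
apply: pnorm_le => //; first by rewrite mulr_ge0 ?pnorm_ge0.
under [X in psum _ X]funext do rewrite rnormZ.
apply: le_trans (psum_scale _ _) _ => //; first by move=> i; exact: rnorm_ge0.
by rewrite powRM ?pnorm_ge0// EFinM -psum_pnorm// ellpP.
Qed.

Let nmZ (c : R[i]) f : nm (c *: f) = `|c| * nm f.
Proof.
apply/eqP; rewrite eq_le nmZ_le /=.
have [->|c0] := eqVneq c 0.
  by rewrite normr0 mul0r /nm ler0c pnorm_ge0.
have := nmZ_le c^-1 (c *: f); rewrite scalerA mulVf// scale1r.
by rewrite normfV ler_pdivlMl ?normr_gt0.
Qed.

Let nm0_eq0 f : nm f = 0 -> f = 0.
Proof.
move=> /complexI f0; apply/val_inj/funext => i /=; apply/rnorm0_eq0/eqP.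
have := psum_pnorm p1 (ellpP f); rewrite f0 powR0// => s0.
have : (\esum_(j in [set i]) (rnorm (f j) `^ p)%:E <= 0)%E.
  rewrite -[leRHS]/(0%:E)%E -s0 /psum [leRHS](esumID [set i]); last first.
    by move=> j _; rewrite lee_fin powR_ge0.
  by rewrite setTI leeDl// esum_ge0// => j _; rewrite lee_fin powR_ge0.
rewrite esum_set1 ?lee_fin ?powR_ge0// => fi.
have : rnorm (f i) `^ p == 0 by rewrite eq_le fi powR_ge0.
by rewrite powR_eq0 => /andP[].
Qed.

HB.instance Definition _ :=
  Lmodule_isNormed.Build R[i] L nmD nmZ nm0_eq0.

Lemma ellp_rnormE (f : L) :
  rnorm f = fine (\esum_(i in [set: I]) (rnorm (f i) `^ p)%:E) `^ p^-1.
Proof. by []. Qed.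

End EllpSpace.

Section Delta.
Context {R : realType} {p : R} {p1 : 1 <= p} {I : choiceType}.
Context {E : normedModType R[i]}.

Let delta_subproof (y : I) (v : E) :
  (fun x => if x == y then v else 0) \in @ellp_pred R p I E.
Proof.
rewrite inE /= /psum (esumID [set y]); last first.
  by move=> j _; rewrite lee_fin powR_ge0.
rewrite setTI esum_set1 ?lee_fin ?powR_ge0// esum1 ?adde0 ?eqxx ?ltry//.
move=> x [_ /= /eqP xy]; rewrite ifN// rnorm0 powR0//.
by rewrite gt_eqF// (lt_le_trans _ p1).
Qed.

Definition delta (y : I) (v : E) : ellp p1 I E := Ellp p1 (delta_subproof y v).

End Delta.


Section Operators.
Context {R : realType} {E F : normedModType R[i]}.

Definition bounded_op (T : E -> F) : Prop :=
  linear T /\ exists M : R, forall v, rnorm (T v) <= M * rnorm v.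

(* Only meaningful when [bounded_op T]. *)
Definition opnorm (T : E -> F) : R :=
  sup [set rnorm (T v) | v in [set v | rnorm v <= 1]].

Definition compact_op (T : E -> F) : Prop :=
  bounded_op T /\ compact (closure (T @` [set v | rnorm v <= 1])).

End Operators.

Section Dimension.
Context {R : realType} {E : normedModType R[i]}.

Definition has_dim (V : set E) (n : nat) : Prop :=
  exists e : 'I_n -> E,
    (forall c : 'I_n -> R[i], \sum_(i < n) c i *: e i = 0 ->
       forall i, c i = 0) /\
    V = range (fun c : 'I_n -> R[i] => \sum_(i < n) c i *: e i).

Definition rank_le (T : E -> E) (N : nat) : Prop :=
  exists2 n : nat, (n <= N)%N & has_dim (range T) n.

End Dimension.

(* Algebras of operators on [E] are sets of maps [E -> E], with the pointwise
   vector space structure; they need not be unital. *)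
Definition is_subalgebra {R : realType} {E : normedModType R[i]}
    (A : set (E -> E)) : Prop :=
  [/\ A `<=` bounded_op,
      A 0,
      forall (a : R[i]) S T, A S -> A T -> A (a *: S + T)
    & forall S T, A S -> A T -> A (S \o T)].

Definition isometrically_isomorphic {R : realType} {E F : normedModType R[i]}
    (A : set (E -> E)) (B : set (F -> F)) : Prop :=
  exists Phi : (E -> E) -> (F -> F),
    [/\ set_bij A B Phi,
        forall (a : R[i]) S T, A S -> A T ->
          Phi (a *: S + T) = a *: Phi S + Phi T,
        forall S T, A S -> A T -> Phi (S \o T) = Phi S \o Phi T
      & forall T, A T -> opnorm (Phi T) = opnorm T].

Section Coarse.
Context {R : realType}.
Implicit Types X Y : metricType R.

Definition bounded_geometry X : Prop :=
  forall r : R, 0 <= r -> exists N : nat,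
    forall x : X, ([set y | mdist x y <= r] #<= `I_N)%card.

Definition uniformly_expansive X Y (f : X -> Y) : Prop :=
  forall r : R, 0 < r -> exists2 s : R, 0 < s &
    forall x1 x2, mdist x1 x2 <= r -> mdist (f x1) (f x2) <= s.

Definition close_maps X Y (f g : X -> Y) : Prop :=
  exists2 c : R, 0 < c & forall x, mdist (f x) (g x) <= c.

Definition coarse_equivalence X Y (f : X -> Y) : Prop :=
  uniformly_expansive f /\
  exists g : Y -> X, [/\ uniformly_expansive g,
    close_maps (f \o g) id & close_maps (g \o f) id].

Definition coarsely_equivalent X Y : Prop :=
  exists f : X -> Y, coarse_equivalence f.

Definition bijectively_coarsely_equivalent X Y : Prop :=
  exists f : X -> Y, bijective f /\ coarse_equivalence f.

End Coarse.

Section MatrixEntries.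
Context {R : realType} {p : R} {p1 : 1 <= p} {X : metricType R}.
Context {E : normedModType R[i]}.
Implicit Types T : ellp p1 X E -> ellp p1 X E.

(* For [E] the scalars, [entry T x y] is multiplication by [T (delta y 1) x]. *)
Definition entry T (x y : X) : E -> E := fun v => T (delta y v) x.

Definition propagation T : \bar R :=
  ereal_sup [set (mdist xy.1 xy.2)%:E | xy in
    [set xy : X * X | entry T xy.1 xy.2 <> 0]].

(* The propagation of [T = 0] is [-oo], so [0] is included here. *)
Definition finite_propagation T : Prop := (propagation T < +oo)%E.

Definition uniformly_finite_rank T : Prop :=
  exists N : nat, forall x y, rank_le (entry T x y) N.

Definition locally_compact_op T : Prop := forall x y, compact_op (entry T x y).

End MatrixEntries.

Section RoeAlgebras.
Context {R : realType} {p : R} (p1 : 1 <= p) (X : metricType R).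

Local Notation C := (R[i]^o).
Local Notation ellpN := (ellp p1 nat C).

Definition uniform_roe : set (ellp p1 X C -> ellp p1 X C) :=
  [set T | bounded_op T /\ finite_propagation T].

(* The index set S: [None] is the set of naturals, [Some n] is a set with
   [n + 1] elements. *)
Definition roe_index (s : option nat) : choiceType :=
  if s is Some n then 'I_n.+1 : choiceType else nat : choiceType.

Definition roe_type_algebra (s : option nat)
    (A : set (ellp p1 X (ellp p1 (roe_index s) C) ->
              ellp p1 X (ellp p1 (roe_index s) C))) : Prop :=
  [/\ is_subalgebra A,
      forall T, A T -> locally_compact_op T /\ finite_propagation T
    & forall T, bounded_op T -> finite_propagation T ->
        uniformly_finite_rank T -> A T].

Definition mx_op (n : nat) (A : 'M[R[i]]_n) (v : ellpN) : ellpN :=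
  \sum_(i < n) delta (i : nat) (\sum_(j < n) A i j * v j : C).

Definition M_infty : set (ellpN -> ellpN) :=
  [set T | bounded_op T /\ forall e : R, 0 < e ->
     exists (n : nat) (A : 'M[R[i]]_n), opnorm (T - mx_op A) < e].

Definition U_roe : set (ellp p1 X ellpN -> ellp p1 X ellpN) :=
  [set T | [/\ bounded_op T, finite_propagation T & uniformly_finite_rank T]].

Definition roe : set (ellp p1 X ellpN -> ellp p1 X ellpN) :=
  [set T | [/\ bounded_op T, finite_propagation T
    & forall x y, M_infty (entry T x y)]].

Definition stable_roe : set (ellp p1 X ellpN -> ellp p1 X ellpN) :=
  [set T | [/\ bounded_op T, finite_propagation T
    & exists P : ellpN -> ellpN,
        [/\ bounded_op P, P \o P = P, exists n, has_dim (range P) n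
          & forall x y, entry T x y = P \o entry T x y \o P]]].

End RoeAlgebras.

Arguments uniform_roe {R p} p1 X _.
Arguments U_roe {R p} p1 X _.
Arguments roe {R p} p1 X _.
Arguments stable_roe {R p} p1 X _.
Arguments roe_type_algebra {R p p1 X s} A.

(* Main.v *)
(** Everything is done in coordinates: a space framed by [I] is a normed space
    identified isometrically with l^p(I), and l^p(X, l^p(S)) is framed by
    [X * S].

    Rigidity. Let [Phi] be an isometric isomorphism from an algebra over [X] to
    one over [Y]. A gliding hump argument shows that the images of the matrix
    units between points at distance at most [r] have uniformly bounded
    propagation. The image of the diagonal unit [e_(z, z)] is a minimal
    idempotent, hence of rank one, and since its propagation is bounded it is
    supported in a ball of fixed radius around some point [f z]. The images of
    [e_(z, z')] show that [f] is uniformly expansive; the same construction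
    for the inverse of [Phi] gives a coarse inverse. No description of the
    isometries of l^p is needed, so that [p = 2] is not special. In the uniform
    case the vectors [Phi e_(z, z0) b] are linearly independent and supported
    around the points [f z], which is Hall's condition for an injection close to
    [f]; two such injections are combined as in the Cantor-Bernstein theorem.

    Conversely, for a coarse equivalence [f : X -> Y] both [X * nat] and
    [Y * nat] are in bijection with [range f * nat], by maps that move points a
    bounded distance and have only finitely many different restrictions
    [nat -> nat] to pairs of fibers. Conjugation by the induced isometry
    preserves the three algebras; for the stable one, the finiteness and a local
    unit for finitely many finite-rank operators are what is needed. *)
Require Import Defs.
From mathcomp Require Import all_boot all_order all_algebra complex finmap.
From mathcomp Require Import all_classical all_reals all_analysis.
From mathcomp Require Import ring lra.

Set Implicit Arguments.
Unset Strict Implicit.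
Unset Printing Implicit Defensive.

Import Order.TTheory GRing.Theory Num.Theory.
Import numFieldNormedType.Exports.

Local Open Scope classical_set_scope.
Local Open Scope ring_scope.

(** * Frames *)

(** Rigidity uses the norm only in the gliding hump, to bound the image of a tail; the rest is
    algebra. The obstacle there is that an infinite sum of matrix units need be neither bounded nor
    in the algebra. Hence one unit per row, coefficients in $\ell^p$, and always the same base
    vector in the columns, so that all entries have rank at most one. One unit per row is enough: a
    fixed row sees only finitely many points within distance [r], so an unbounded family visits
    infinitely many rows. In the stable algebra the rows must moreover lie in finitely many basis
    directions, so the uniform bound is obtained only for rows in a set [D]; this is why closeness
    of the two centre maps requires $\Psi(e_{ww})$ to be nonzero on a basis vector from [D].
    Finite-rank idempotents come from pseudoinverses of finite matrices, without Hahn-Banach or a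
    choice of independent vectors. *)

Section Rnorm.
Context {R : realType} {E : normedModType R[i]}.
Implicit Types v w : E.

Lemma rnormN v : rnorm (- v) = rnorm v.
Proof. by rewrite /rnorm normrN. Qed.

Lemma rnormB v w : rnorm (v - w) <= rnorm v + rnorm w.
Proof. by rewrite -(rnormN w) rnormD. Qed.

Lemma rnorm_eq0 v : (rnorm v == 0) = (v == 0).
Proof. by apply/eqP/eqP => [/rnorm0_eq0|->]//; rewrite rnorm0. Qed.

Lemma rnorm_gt0 v : (0 < rnorm v) = (v != 0).
Proof. by rewrite lt_neqAle rnorm_ge0 andbT eq_sym rnorm_eq0. Qed.

Lemma rnorm_sub_ge v w : rnorm v - rnorm w <= rnorm (v + w).
Proof. by rewrite lerBlDr -{1}[v](addrK w) rnormB. Qed.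

End Rnorm.

Section Scalars.
Context {R : realType}.
Implicit Types c d : R[i]^o.

Lemma rnormM c d : rnorm (c * d : R[i]^o) = rnorm c * rnorm d.
Proof. exact: (rnormZ c d). Qed.

Lemma rnormZE {E : normedModType R[i]} (c : R[i]) (v : E) :
  rnorm (c *: v) = rnorm (c : R[i]^o) * rnorm v.
Proof. exact: rnormZ. Qed.

Lemma rnorm1 : rnorm (1 : R[i]^o) = 1.
Proof. by rewrite /rnorm normr1. Qed.

Lemma rnorm_real (a : R) : rnorm (real_complex R a : R[i]^o) = `|a|.
Proof. by rewrite /rnorm normc_def /= expr0n addr0 sqrtr_sqr. Qed.

End Scalars.

Lemma bounded_op_bound {R : realType} {E F : normedModType R[i]} (T : E -> F) :
  bounded_op T ->
  exists2 M : R, 0 <= M & forall v, rnorm (T v) <= M * rnorm v.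
Proof.
move=> [_ [M TM]]; exists `|M| => // v.
by apply: le_trans (TM v) _; rewrite ler_wpM2r ?rnorm_ge0// ler_norm.
Qed.

Section BoundedOps.
Context {R : realType} {E F G : normedModType R[i]}.

Lemma lin0 (T : E -> F) : linear T -> T 0 = 0.
Proof. by move=> lT; have := lT (-1) 0 0; rewrite scaler0 addr0 scaleN1r addNr. Qed.

Lemma linD (T : E -> F) v w : linear T -> T (v + w) = T v + T w.
Proof. by move=> lT; have := lT 1 v w; rewrite !scale1r. Qed.

Lemma linZ (T : E -> F) c v : linear T -> T (c *: v) = c *: T v.
Proof. by move=> lT; rewrite -[c *: v]addr0 lT lin0// addr0. Qed.

Lemma linB (T : E -> F) v w : linear T -> T (v - w) = T v - T w.
Proof.
by move=> lT; rewrite addrC -scaleN1r lT scaleN1r addrC.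
Qed.

Lemma lin_sum (T : E -> F) (I : Type) (r : seq I) (P : pred I) (f : I -> E) :
  linear T -> T (\sum_(i <- r | P i) f i) = \sum_(i <- r | P i) T (f i).
Proof.
move=> lT; apply: (big_ind2 (fun v w => T v = w)) => //; first exact: lin0.
by move=> v1 w1 v2 w2 <- <-; rewrite linD.
Qed.

Lemma lin_comp (S : F -> G) (T : E -> F) : linear S -> linear T -> linear (S \o T).
Proof. by move=> lS lT a u v /=; rewrite lT lS. Qed.

Lemma bounded_op_comp (S : F -> G) (T : E -> F) :
  bounded_op S -> bounded_op T -> bounded_op (S \o T).
Proof.
move=> bS bT; split; first by apply: lin_comp; [exact: bS.1|exact: bT.1].
have [M M0 SM] := bounded_op_bound bS; have [N N0 TN] := bounded_op_bound bT.
exists (M * N) => v /=; apply: le_trans (SM _) _.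
by rewrite -mulrA ler_wpM2l.
Qed.

Lemma bounded_op_lincomb (a : R[i]) (S T : E -> F) :
  bounded_op S -> bounded_op T -> bounded_op (a *: S + T).
Proof.
move=> bS bT; split.
  move=> c u v; rewrite !fctE bS.1 bT.1 !scalerDr !scalerA mulrC.
  by rewrite addrACA.
have [M M0 SM] := bounded_op_bound bS; have [N N0 TN] := bounded_op_bound bT.
exists (rnorm (a : R[i]^o) * M + N) => v; rewrite !fctE.
apply: le_trans (rnormD _ _) _; rewrite mulrDl lerD// rnormZE -mulrA.
by rewrite ler_wpM2l// rnorm_ge0.
Qed.

Lemma bounded_op0 : bounded_op (0 : E -> F).
Proof.
split; first by move=> a u v; rewrite -[RHS]/(a *: 0 + 0 : F) scaler0 addr0.
by exists 0 => v; rewrite -[X in rnorm X]/(0 : F) rnorm0 mul0r.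
Qed.

Lemma bounded_op_id : bounded_op (@id E).
Proof. by split => //; exists 1 => v; rewrite mul1r. Qed.

Lemma opnorm_le (T : E -> F) (M : R) : 0 <= M ->
  (forall v, rnorm (T v) <= M * rnorm v) -> opnorm T <= M.
Proof.
move=> M0 TM; apply: ge_sup; first by exists (rnorm (T 0)), 0 => //=; rewrite rnorm0.
move=> _ [v /= v1 <-]; apply: le_trans (TM v) _.
by rewrite -[leRHS]mulr1 ler_wpM2l.
Qed.

Lemma opnorm_bound (T : E -> F) v : bounded_op T ->
  rnorm (T v) <= opnorm T * rnorm v.
Proof.
move=> bT; have [->|v0] := eqVneq v 0.
  by rewrite (lin0 bT.1) !rnorm0 mulr0.
have vp : 0 < rnorm v by rewrite rnorm_gt0.
pose c : R[i] := real_complex R (rnorm v)^-1.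
have rc : rnorm (c : R[i]^o) = (rnorm v)^-1.
  by rewrite rnorm_real ger0_norm// invr_ge0 rnorm_ge0.
have : rnorm (T (c *: v)) <= opnorm T.
  have [M M0 TM] := bounded_op_bound bT.
  apply: sup_upper_bound.
    split; first by exists (rnorm (T 0)), 0 => //=; rewrite rnorm0.
    exists M => _ [w /= w1 <-]; apply: le_trans (TM w) _.
    by rewrite -[leRHS]mulr1 ler_wpM2l.
  by exists (c *: v) => //=; rewrite rnormZE rc mulVf// gt_eqF.
by rewrite (linZ _ _ bT.1) rnormZE rc ler_pdivrMl// mulrC.
Qed.

Lemma opnorm_ge0 (T : E -> F) : bounded_op T -> 0 <= opnorm T.
Proof.
move=> bT; apply: sup_upper_bound.
  have [M M0 TM] := bounded_op_bound bT.
  split; first by exists (rnorm (T 0)), 0 => //=; rewrite rnorm0.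
  exists M => _ [w /= w1 <-]; apply: le_trans (TM w) _.
  by rewrite -[leRHS]mulr1 ler_wpM2l.
by exists 0 => /=; rewrite ?rnorm0// (lin0 bT.1) rnorm0.
Qed.

End BoundedOps.

Lemma bounded_op_scale {R : realType} {E F : normedModType R[i]}
  (phi : E -> R[i]^o) (w : F) :
  bounded_op phi -> bounded_op (fun v => phi v *: w).
Proof.
move=> bphi; split.
  by move=> a u v; rewrite bphi.1 scalerDl scalerA.
have [M M0 pM] := bounded_op_bound bphi; exists (M * rnorm w) => v.
by rewrite rnormZE mulrAC ler_wpM2r ?rnorm_ge0.
Qed.

Lemma bounded_op_sum {R : realType} {E F : normedModType R[i]} (I : Type)
  (r : seq I) (P : pred I) (T : I -> E -> F) :
  (forall i, P i -> bounded_op (T i)) ->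
  bounded_op (fun v => \sum_(i <- r | P i) T i v).
Proof.
move=> bT; have -> : (fun v => \sum_(i <- r | P i) T i v) =
    \sum_(i <- r | P i) T i by apply/funext => v; rewrite fct_sumE.
apply: big_ind => //; first exact: bounded_op0.
by move=> S U bS bU; rewrite -[S]scale1r; exact: bounded_op_lincomb.
Qed.

Section Frames.
Context {R : realType} (p : R) (p1 : 1 <= p).

(** The second clause gives isometry and injectivity, the third surjectivity onto $\ell^p(I)$. With
    coordinates in place of an explicit isomorphism, scalar and vector-valued spaces share one
    theory. *)
Definition frame (H : normedModType R[i]) (I : choiceType)
    (x : I -> H -> R[i]^o) : Prop :=
  [/\ forall i, linear (x i),
      forall h, psum p (fun i => rnorm (x i h)) = (rnorm h `^ p)%:E
    & forall c : I -> R[i]^o, (psum p (fun i => rnorm (c i)) < +oo)%E ->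
        exists h, forall i, x i h = c i].

Let p0 : 0 < p. Proof. exact: lt_le_trans p1. Qed.

Lemma powR_inj (a b : R) : 0 <= a -> 0 <= b -> a `^ p = b `^ p -> a = b.
Proof.
move=> a0 b0 ab; have := congr1 (fun t => t `^ p^-1) ab.
by rewrite -!powRrM mulfV ?gt_eqF// !powRr1.
Qed.

Lemma powR_le (a b : R) : 0 <= a -> 0 <= b -> (a `^ p <= b `^ p) = (a <= b).
Proof.
move=> a0 b0; apply/idP/idP => ab; last first.
  by apply: ge0_ler_powR => //; exact: ltW.
rewrite leNgt; apply/negP => ba; suff : b `^ p < a `^ p by rewrite ltNge ab.
by rewrite gt0_ltr_powR.
Qed.

Lemma psum_term {I : choiceType} (u : I -> R) i : ((u i `^ p)%:E <= psum p u)%E.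
Proof.
rewrite /psum (esumID [set i]); last by move=> j _; rewrite lee_fin powR_ge0.
rewrite setTI esum_set1 ?lee_fin ?powR_ge0// leeDl// esum_ge0// => j _.
by rewrite lee_fin powR_ge0.
Qed.

Lemma psum_supp1 {I : choiceType} (u : I -> R) i :
  (forall j, j != i -> u j = 0) -> psum p u = (u i `^ p)%:E.
Proof.
move=> u0; rewrite /psum (esumID [set i]); last first.
  by move=> j _; rewrite lee_fin powR_ge0.
rewrite setTI esum_set1 ?lee_fin ?powR_ge0// esum1 ?adde0//.
by move=> j [_ /eqP ji]; rewrite u0// powR0// gt_eqF.
Qed.

Lemma psum_bij {I J : choiceType} (e : I -> J) (e' : J -> I) (u : J -> R) :
  cancel e e' -> cancel e' e -> psum p (u \o e) = psum p u.
Proof.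
move=> ee' e'e; rewrite /psum [RHS](reindex_esum [set: I] _ e)//.
by rewrite setTT_bijective; exists e'.
Qed.

Lemma psum_pair {I J : choiceType} (u : I -> J -> R) :
  psum p (fun k : I * J => u k.1 k.2) =
  (\esum_(i in [set: I]) psum p (u i))%E.
Proof.
rewrite /psum esum_esum//; last by move=> i j _ _; rewrite lee_fin powR_ge0.
by congr esum; apply/seteqP; split => -[].
Qed.

Section FrameTheory.
Context {H : normedModType R[i]} {I : choiceType} {x : I -> H -> R[i]^o}.
Hypothesis fx : frame x.

Let xlin i : linear (x i). Proof. by have [+ _ _] := fx; apply. Qed.
Let xnorm h : psum p (fun i => rnorm (x i h)) = (rnorm h `^ p)%:E.
Proof. by have [_ + _] := fx; apply. Qed.

Lemma frame_coord_le i h : rnorm (x i h) <= rnorm h.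
Proof.
have := psum_term (fun i => rnorm (x i h)) i.
by rewrite xnorm lee_fin powR_le ?rnorm_ge0.
Qed.

Lemma frame_bounded i : bounded_op (x i).
Proof. by split => //; exists 1 => h; rewrite mul1r frame_coord_le. Qed.

Lemma frame_inj h h' : (forall i, x i h = x i h') -> h = h'.
Proof.
move=> hh'; apply/eqP; rewrite -subr_eq0 -rnorm_eq0; apply/eqP.
have := xnorm (h - h').
have -> : (fun i => rnorm (x i (h - h'))) = (fun=> 0).
  by apply/funext => i; rewrite linB// hh' subrr rnorm0.
rewrite /psum esum1 => [[/esym/eqP]|i _]; last by rewrite powR0// gt_eqF.
by rewrite powR_eq0 => /andP[/eqP].
Qed.

Lemma frame_eq0 h : (forall i, x i h = 0) -> h = 0.
Proof. by move=> h0; apply: frame_inj => i; rewrite h0 lin0. Qed.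

Lemma frame_neq0 h : h != 0 -> exists i, x i h != 0.
Proof.
move=> /eqP h0; apply: contrapT => xh; apply: h0; apply: frame_eq0 => i.
by apply/eqP/negPn/negP => xi; apply: xh; exists i.
Qed.

(* [synth c] is junk when [c] is not in l^p. *)
Definition synth (c : I -> R[i]^o) : H := xget 0 [set h | forall i, x i h = c i].

Lemma synthE c i : (psum p (fun i => rnorm (c i)) < +oo)%E -> x i (synth c) = c i.
Proof.
move=> cp; rewrite /synth; case: xgetP => [h _ /= -> //|nh].
by exfalso; have [_ _ /(_ c cp)[h hc]] := fx; exact: (nh h).
Qed.

Lemma synth_norm c (M : R) : 0 <= M ->
  (psum p (fun i => rnorm (c i)) <= (M `^ p)%:E)%E -> rnorm (synth c) <= M.
Proof.
move=> M0 cM; have cp : (psum p (fun i => rnorm (c i)) < +oo)%E.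
  by rewrite (le_lt_trans cM)// ltry.
rewrite -powR_le ?rnorm_ge0// -lee_fin -xnorm.
by under eq_fun do rewrite synthE//.
Qed.

Definition bvec (i : I) : H := synth (fun j => (j == i)%:R).

Lemma bvec_psum i :
  psum p (fun j : I => rnorm ((j == i)%:R : R[i]^o)) = 1%:E.
Proof.
rewrite (@psum_supp1 _ _ i) ?eqxx ?rnorm1 ?powR1// => j /negbTE ->.
by rewrite rnorm0.
Qed.

Lemma bvecE i j : x j (bvec i) = (j == i)%:R.
Proof. by rewrite synthE// bvec_psum ltry. Qed.

Lemma bvecii i : x i (bvec i) = 1. Proof. by rewrite bvecE eqxx. Qed.

Lemma bvec_norm i : rnorm (bvec i) <= 1.
Proof. by rewrite synth_norm// bvec_psum powR1. Qed.

(** Some finite set carries all but $e^p$ of the sum of $p$-th powers. This density of finite sums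
    rests on $p<\infty$. *)
Lemma frame_approx h (e : R) : 0 < e -> exists s : seq I,
  rnorm (h - \sum_(i <- s) x i h *: bvec i) <= e.
Proof.
move=> e0; pose u i := (rnorm (x i h) `^ p)%:E.
have u0 i : (0 <= u i)%E by rewrite lee_fin powR_ge0.
have ep : 0 < e `^ p by rewrite powR_gt0.
have sf : \esum_(i in [set: I]) u i \is a fin_num.
  by rewrite /u -/(psum p _) xnorm.
have [_ [A [finA _] <-]] := ub_ereal_sup_adherent ep sf.
rewrite -/(esum _ _) => sA; exists (fset_set A).
set h' := \sum_(i <- _) _.
have hx j : x j (h - h') = if j \in A then 0 else x j h.
  rewrite linB// /h' lin_sum//.
  under eq_bigr do rewrite linZ// bvecE.
  case: ifPn => jA.
    rewrite (bigD1_seq j) ?fset_uniq ?in_fset_set//= eqxx.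
    rewrite big1 ?addr0; first by rewrite /GRing.scale /= mulr1 subrr.
    by move=> i ij; rewrite eq_sym (negbTE ij) scaler0.
  rewrite big_seq big1 ?subr0// => i; rewrite in_fset_set// => iA.
  by rewrite (_ : j == i = false) ?scaler0//; apply: contraNF jA => /eqP ->.
rewrite -powR_le ?rnorm_ge0 ?(ltW e0)// -lee_fin -xnorm.
have -> : psum p (fun i => rnorm (x i (h - h'))) = (\esum_(i in ~` A) u i)%E.
  rewrite esum_mkcond; apply: eq_esum => i _; rewrite hx in_setC.
  by case: (i \in A) => //=; rewrite rnorm0 powR0// gt_eqF.
have := @esumID R I A [set: I] u (fun i _ => u0 i).
rewrite !setTI (@esum_fset _ _ A)// => uA; move: sA; rewrite {}uA.
set a := (\sum_(i \in A) u i)%E; set b := (\esum_(i in ~` A) u i)%E.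
have fa : a \is a fin_num.
  by rewrite /a fsbig_finite// sum_fin_num; apply/allP => ? /mapP[i _ ->].
have fb : b \is a fin_num.
  move: sf; rewrite (esumID A [set: I])// !setTI -/b.
  by rewrite fin_numD => /andP[].
by rewrite -(fineK fa) -(fineK fb) -!EFinD !lte_fin lee_fin; lra.
Qed.

Lemma frame_dense0 {F : normedModType R[i]} (T : H -> F) : bounded_op T ->
  (forall i, T (bvec i) = 0) -> forall h, T h = 0.
Proof.
move=> bT T0 h; apply/eqP; rewrite -rnorm_eq0 eq_le rnorm_ge0 andbT.
have [M M0 TM] := bounded_op_bound bT.
apply/ler_addgt0Pr => e e0; rewrite add0r.
have [s hs] := @frame_approx h (e / (M + 1)) ltac:(by rewrite divr_gt0// ltr_wpDl).
set h' := \sum_(i <- _) _ in hs.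
have Th' : T h' = 0.
  by rewrite /h' lin_sum ?big1// => [i _|]; [rewrite linZ ?T0 ?scaler0//|]; exact: bT.1.
rewrite -[T h]subr0 -Th' -linB; last exact: bT.1.
apply: le_trans (TM _) _; apply: le_trans (ler_wpM2l M0 hs) _.
rewrite mulrCA ler_piMr ?(ltW e0)// ler_pdivrMr ?mul1r; last by rewrite ltr_wpDl.
by rewrite lerDl.
Qed.

Lemma frame_op_neq0 {F : normedModType R[i]} (T : H -> F) : bounded_op T ->
  T <> 0 -> exists i, T (bvec i) != 0.
Proof.
move=> bT T0; apply: contrapT => nT; apply: T0; apply/funext.
apply: frame_dense0 => // i; apply/eqP/negPn/negP => Ti; apply: nT.
by exists i.
Qed.

End FrameTheory.

Lemma frame_scalar : frame (fun (_ : unit) (c : R[i]^o) => c).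
Proof.
split=> [//|c|c _]; last by exists (c tt) => -[].
by rewrite (@psum_supp1 _ _ tt)// => -[].
Qed.

Lemma frame_ellp_scalar (I : choiceType) :
  frame (fun i (f : ellp p1 I R[i]^o) => f i).
Proof.
split=> [//|f|c cp]; first by rewrite (psum_pnorm p1 (ellpP f)).
have cP : c \in @ellp_pred R p I R[i]^o by rewrite inE.
by exists (Ellp p1 cP).
Qed.

Lemma frame_ellp (I S : choiceType) (E : normedModType R[i])
    (x : S -> E -> R[i]^o) : frame x ->
  frame (fun (k : I * S) (f : ellp p1 I E) => x k.2 (f k.1)).
Proof.
move=> [xl xn xs]; split=> [k a f g /=|f|c cp]; first by rewrite xl.
  rewrite (psum_pair (fun i s => rnorm (x s (f i)))).
  under eq_esum do rewrite xn.
  by rewrite -/(psum p _) (psum_pnorm p1 (ellpP f)).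
pose c' i s := c (i, s).
have cE : (fun k => rnorm (c k)) = (fun k => rnorm (c' k.1 k.2)).
  by apply/funext => -[].
move: cp; rewrite cE (psum_pair (fun i s => rnorm (c' i s))) => cp.
(* Each slice is summable, so it is first synthesised in [E]; the norms of the slices then form a
   point of [ellp]. *)
have cpi i : (psum p (fun s => rnorm (c' i s)) < +oo)%E.
  apply: le_lt_trans cp; rewrite (esumID [set i]); last by move=> *; exact: psum_ge0.
  by rewrite setTI esum_set1 ?psum_ge0// leeDl// esum_ge0// => *; exact: psum_ge0.
have [f fE] : exists f : I -> E, forall i s, x s (f i) = c' i s.
  have /choice[f fE] : forall i, exists v, forall s, x s v = c' i s.
    by move=> i; exact: xs.
  by exists f.
have fP : f \in @ellp_pred R p I E.
  rewrite inE /=; apply: le_lt_trans cp; rewrite le_eqVlt; apply/orP; left.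
  apply/eqP; apply: eq_esum => i _; rewrite -xn.
  by under eq_fun do rewrite fE.
by exists (Ellp p1 fP) => -[i s] /=; rewrite fE.
Qed.

End Frames.

Arguments synth {R H I} x c.
Arguments bvec {R H I} x i.

(** * Matrix units *)

Lemma psum_seq {R : realType} (p : R) (p1 : 1 <= p) {I : choiceType}
    (u : I -> R) (e : nat -> I) : injective e ->
  (forall i, ~ range e i -> u i = 0) -> psum p u = psum p (u \o e).
Proof.
move=> ei u0; rewrite /psum; have := @esumID R I (range e) [set: I]
  (fun i => (u i `^ p)%:E) (fun i _ => powR_ge0 _ _).
rewrite !setTI => ->; rewrite [X in (_ + X)%E]esum1 ?adde0.
  by rewrite esum_image// => i j _ _; exact: ei.
move=> i /= ni; rewrite u0// powR0// gt_eqF//; exact: lt_le_trans p1.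
Qed.

(** As $p\ge 1$, $(4^{-n})^p\le 2^{-n}$; these bounds add up to $2\le 2^p$, which gives the factor
    [2]. *)
Lemma psum_geometric {R : realType} (p : R) (p1 : 1 <= p) (u : nat -> R) (c : R) :
  0 <= c -> (forall n, 0 <= u n <= c / 4 ^+ n) ->
  (psum p u <= ((2 * c) `^ p)%:E)%E.
Proof.
move=> c0 uc; have p0 : 0 < p by exact: lt_le_trans p1.
apply: (@le_trans _ _ (\esum_(n in [set: nat]) (2 * c `^ p / 2 ^+ n.+1)%:E)%E).
  apply: le_esum => n _; rewrite lee_fin.
  have /andP[u0 un] := uc n.
  apply: (@le_trans _ _ ((c / 4 ^+ n) `^ p)).
    by rewrite powR_le// divr_ge0// exprn_ge0.
  rewrite powRM ?invr_ge0 ?exprn_ge0//.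
  have -> : 2 * c `^ p / 2 ^+ n.+1 = c `^ p * (2 ^+ n)^-1.
    by rewrite exprS; field; rewrite expf_neq0.
  apply: ler_wpM2l; first exact: powR_ge0.
  apply: (@le_trans _ _ ((4 ^+ n)^-1 : R)).
    rewrite -[leRHS]powRr1 ?invr_ge0 ?exprn_ge0//.
    by rewrite ger_powR// invr_gt0 exprn_gt0//= invf_le1 ?exprn_gt0// exprn_ege1// ler1n.
  by rewrite lef_pV2 ?posrE ?exprn_gt0// lerXn2r ?nnegrE// ler_nat.
rewrite -nneseries_esumT; last first.
  by move=> n; rewrite lee_fin divr_ge0 ?exprn_ge0// mulr_ge0// powR_ge0.
under eq_eseriesr do rewrite -natrX.
apply: le_trans (epsilon_trick0 _ _) _; first by rewrite mulr_ge0 ?powR_ge0.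
rewrite lee_fin powRM//.
by rewrite ler_wpM2r ?powR_ge0// -{1}[2]powRr1// ler_powR// ler1n.
Qed.

Section MatrixUnits.
Context {R : realType} (p : R) (p1 : 1 <= p).
Context {H : normedModType R[i]} {I : choiceType} (x : I -> H -> R[i]^o).

Definition munit (a b : I) : H -> H := fun h => x b h *: bvec x a.

(** The operator $\sum_a c_a e_{a,s(a)}$, with at most one entry in each row. Since
    $|x_{s(a)}(h)|\le\|h\|$, its norm is at most the $\ell^p$ norm of [c], however often [s] repeats
    a column. *)
Definition weighted_rows (c : I -> R[i]^o) (s : I -> I) : H -> H :=
  fun h => synth x (fun a => c a * x (s a) h).

Hypothesis fx : frame p x.
Let xlin i : linear (x i). Proof. by have [+ _ _] := fx; apply. Qed.

Lemma munitE a b h i : x i (munit a b h) = (i == a)%:R * x b h.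
Proof. by rewrite linZ// (bvecE p1 fx)// mulrC. Qed.

Lemma munit_norm a b h : rnorm (munit a b h) <= rnorm h.
Proof.
rewrite /munit rnormZE -[leRHS]mulr1 ler_pM ?rnorm_ge0//; last exact: (bvec_norm p1 fx).
exact: (frame_coord_le p1 fx).
Qed.

Lemma munit_bounded a b : bounded_op (munit a b).
Proof. apply: bounded_op_scale; exact: (frame_bounded p1 fx). Qed.

Lemma munit_comp a b c : munit a b \o munit b c = munit a c.
Proof. by apply/funext => h /=; rewrite /munit linZ// (bvecii p1 fx)// [_ *: 1]mulr1. Qed.

(** For equal indices this is the minimality $eTe\in\mathbb{C}e$ of a diagonal unit, the algebraic
    property that passes to its image. *)
Lemma munit_sandwich a b c d T : linear T ->
  munit a b \o T \o munit c d = x b (T (bvec x c)) *: munit a d.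
Proof.
move=> lT; apply/funext => h /=; rewrite !fctE /munit (linZ _ _ lT) linZ//.
by rewrite scalerA mulrC.
Qed.

Lemma munit_neq0 a b : munit a b <> 0.
Proof.
move=> /(congr1 (fun T => x a (T (bvec x b)))) /=.
rewrite munitE eqxx mul1r (bvecii p1 fx)// [X in _ = X -> _](lin0 (xlin a)) => /eqP.
by rewrite oner_eq0.
Qed.

Lemma weighted_rows_psum (c : I -> R[i]^o) (s : I -> I) h (M : R) : 0 <= M ->
  (psum p (fun a => rnorm (c a)) <= (M `^ p)%:E)%E ->
  (psum p (fun a => rnorm (c a * x (s a) h)%R) <= ((M * rnorm h)%R `^ p)%:E)%E.
Proof.
move=> M0 cM; apply: (@le_trans _ _ (psum p (fun a => rnorm h * rnorm (c a))%R)).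
  apply: psum_le => // a; rewrite rnorm_ge0 rnormM mulrC ler_wpM2r ?rnorm_ge0//.
  exact: (frame_coord_le p1 fx).
apply: le_trans (psum_scale _ _ _) _ => //; first exact: rnorm_ge0.
  by move=> a; exact: rnorm_ge0.
rewrite mulrC powRM ?rnorm_ge0// EFinM.
by rewrite lee_wpmul2l// lee_fin powR_ge0.
Qed.

Lemma weighted_rowsE (c : I -> R[i]^o) s h a : (psum p (fun a => rnorm (c a)) < +oo)%E ->
  x a (weighted_rows c s h) = c a * x (s a) h.
Proof.
move=> coo; rewrite (synthE fx)//.
apply: le_lt_trans (weighted_rows_psum _ _ (pnorm_ge0 p _) _) _.
- by rewrite psum_pnorm.
- by rewrite ltry.
Qed.

Lemma weighted_rows_norm (c : I -> R[i]^o) s h (M : R) : 0 <= M ->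
  (psum p (fun a => rnorm (c a)) <= (M `^ p)%:E)%E ->
  rnorm (weighted_rows c s h) <= M * rnorm h.
Proof.
move=> M0 cM; apply: (synth_norm p1 fx) => //; first by rewrite mulr_ge0// rnorm_ge0.
exact: weighted_rows_psum.
Qed.

Lemma weighted_rows_bounded (c : I -> R[i]^o) s : (psum p (fun a => rnorm (c a)) < +oo)%E ->
  bounded_op (weighted_rows c s).
Proof.
move=> coo; split; last first.
  exists (pnorm p (fun a => rnorm (c a))) => h.
  by apply: weighted_rows_norm; [exact: pnorm_ge0|rewrite psum_pnorm].
move=> k u v; apply: (frame_inj p1 fx) => a.
by rewrite xlin !weighted_rowsE// xlin mulrDr -!scalerAr.
Qed.

End MatrixUnits.

(** * Propagation and the gliding hump *)

Lemma finite_ball {R : realType} (X : metricType R) : bounded_geometry X ->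
  forall (x : X) r, finite_set [set y | mdist x y <= r].
Proof.
move=> hX x r; have [r0|r0] := leP 0 r.
  by have [N /(_ x)/card_le_finite] := hX r r0; apply; exact: finite_II.
apply: (sub_finite_set _ (finite_set0 X)) => y /= xy.
by have := mdist_ge0 x y; rewrite leNgt (le_lt_trans xy).
Qed.

Lemma finite_nat_bound {T : choiceType} (D : set T) (P : T -> nat -> Prop) :
  finite_set D -> (forall t n m, (n <= m)%N -> P t n -> P t m) ->
  (forall t, D t -> exists n, P t n) -> exists n, forall t, D t -> P t n.
Proof.
move=> fD Pmono Pex.
have /choice[f fP] : forall t, exists n, D t -> P t n.
  by move=> t; have [/Pex[n Pn]|nD] := pselect (D t); [exists n|exists 0%N].
exists (\max_(t <- fset_set D) f t)%N => t Dt.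
by apply: Pmono (fP t Dt); apply: leq_bigmax_seq; rewrite ?in_fset_set ?inE.
Qed.

Section Propagation.
Context {R : realType} (p : R) {X : metricType R}.
Context {H : normedModType R[i]} {I : choiceType} (x : I -> H -> R[i]^o).
Context (pos : I -> X).

Definition propagates (N : R) (T : H -> H) : Prop :=
  forall a b, x a (T (bvec x b)) != 0 -> mdist (pos a) (pos b) <= N.

Lemma propagates_le N M T : N <= M -> propagates N T -> propagates M T.
Proof. by move=> NM TN a b /TN /le_trans; apply. Qed.

Lemma propagates_nat N T : propagates N T -> exists n : nat, propagates n%:R T.
Proof.
move=> TN; exists (Num.truncn `|N|).+1; apply: propagates_le TN.
by apply: le_trans (ler_norm _) _; rewrite ltW// truncnS_gt.
Qed.

Definition controlled_algebra (A : set (H -> H)) : Prop :=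
  [/\ is_subalgebra A, forall T, A T -> exists N, propagates N T
    & forall a b, A (munit x a b)].

(* [D] limits the rows that may occur in one operator: all of them for a
   Roe-type algebra, finitely many over each point for the stable one. *)
Definition row_closed (base : X -> I) (D : set I) (A : set (H -> H)) : Prop :=
  forall (c : I -> R[i]^o) (s : I -> X) r,
    (psum p (fun a => rnorm (c a)) < +oo)%E ->
    (forall a, c a != 0 -> D a /\ mdist (pos a) (s a) <= r) ->
    A (weighted_rows x c (base \o s)).

End Propagation.

(** Bijectivity is left out so that an isomorphism and its inverse are two instances, and each lemma
    below applies in both directions. *)
Definition isometric_morphism {R : realType} {H K : normedModType R[i]}
  (A : set (H -> H)) (B : set (K -> K)) (Phi : (H -> H) -> (K -> K)) : Prop :=
  [/\ forall T, A T -> B (Phi T),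
      forall (a : R[i]) S T, A S -> A T -> Phi (a *: S + T) = a *: Phi S + Phi T,
      forall S T, A S -> A T -> Phi (S \o T) = Phi S \o Phi T
    & forall T, A T -> opnorm (Phi T) = opnorm T].

Lemma isometric_inverse {R : realType} {H K : normedModType R[i]}
    (A : set (H -> H)) (B : set (K -> K)) :
  is_subalgebra A -> is_subalgebra B -> isometrically_isomorphic A B ->
  exists Phi Psi, [/\ isometric_morphism A B Phi, isometric_morphism B A Psi,
    forall T, A T -> Psi (Phi T) = T & forall S, B S -> Phi (Psi S) = S].
Proof.
move=> [_ _ Al Ac] [_ _ Bl Bc] [Phi [bij lPhi mPhi nPhi]].
have [PhiB Phi_inj Phi_surj] := bij.
have /choice[Psi PsiP] : forall S, exists T, B S -> A T /\ Phi T = S.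
  move=> S; have [BS|nBS] := pselect (B S); last by exists 0.
  by have [T AT TS] := Phi_surj S BS; exists T.
have PsiA S : B S -> A (Psi S) by move=> /PsiP[].
have PsiK S : B S -> Phi (Psi S) = S by move=> /PsiP[].
have inj S T : A S -> A T -> Phi S = Phi T -> S = T.
  by move=> AS AT; apply: Phi_inj; rewrite inE.
have PhiA T : A T -> B (Phi T) by exact: PhiB.
exists Phi, Psi; split => //.
- split=> //.
  + move=> a S T BS BT; apply: inj; [exact/PsiA/Bl|apply: Al; exact: PsiA|].
    by rewrite lPhi ?PsiK//; [exact: Bl|exact: PsiA|exact: PsiA].
  + move=> S T BS BT; apply: inj; [exact/PsiA/Bc|apply: Ac; exact: PsiA|].
    by rewrite mPhi ?PsiK//; [exact: Bc|exact: PsiA|exact: PsiA].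
  + by move=> S BS; rewrite -nPhi ?PsiK//; exact: PsiA.
- by move=> T AT; apply: inj => //; [exact/PsiA/PhiA|rewrite PsiK//; exact: PhiA].
Qed.

Section UniformPropagation.
Context {R : realType} (p : R) (p1 : 1 <= p) {X Y : metricType R}.
Context {H K : normedModType R[i]} {I J : choiceType}.
Context (x : I -> H -> R[i]^o) (y : J -> K -> R[i]^o).
Hypotheses (fx : frame p x) (fy : frame p y).
Context (posX : I -> X) (posY : J -> Y) (base : X -> I).
Context (A : set (H -> H)) (B : set (K -> K)) (D : set I).
Hypothesis hX : bounded_geometry X.
Hypothesis Acontrolled : controlled_algebra x posX A.
Hypothesis Bcontrolled : controlled_algebra y posY B.
Hypothesis Arows : row_closed p x posX base D A.
Context (Phi : (H -> H) -> (K -> K)).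
Hypothesis iPhi : isometric_morphism A B Phi.

(* A gliding hump: otherwise a rapidly decreasing sum of the offending matrix
   units lies in [A], and its image has entries arbitrarily far from the
   diagonal because the tail of the sum is too small to cancel the hump. *)
Lemma uniform_propagation (r : R) : exists N : R, forall a z,
  D a -> mdist (posX a) z <= r -> propagates y posY N (Phi (munit x a (base z))).
Proof.
have [[Abd A0 Al Ac] Aprop Amu] := Acontrolled.
have [[Bbd _ _ _] Bprop _] := Bcontrolled.
have [PhiB lPhi mPhi nPhi] := iPhi.
apply: contrapT => nobound.
have bad n : exists q : (I * X) * (J * J), [/\ D q.1.1,
    mdist (posX q.1.1) q.1.2 <= r, n%:R < mdist (posY q.2.1) (posY q.2.2)
    & y q.2.1 (Phi (munit x q.1.1 (base q.1.2)) (bvec y q.2.2)) != 0].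
  apply: contrapT => nbad; apply: nobound; exists n%:R => a z Da az j1 j2 yj.
  rewrite leNgt; apply/negP => nj; apply: nbad; by exists ((a, z), (j1, j2)).
have /choice[pick pickP] := bad.
(* Balls are finite, so each single row has a bound of its own: the offending units cannot stay in
   one row. *)
have rowbound a : exists m : nat, forall z, mdist (posX a) z <= r ->
    propagates y posY m%:R (Phi (munit x a (base z))).
  apply: (@finite_nat_bound _ [set z | mdist (posX a) z <= r]
    (fun z (m : nat) => propagates y posY m%:R (Phi (munit x a (base z))))).
  - exact: finite_ball.
  - by move=> z n m nm; apply: propagates_le; rewrite ler_nat.
  - move=> z _; have [N] := Bprop _ (PhiB _ (Amu a (base z))).
    exact: propagates_nat.
have /choice[rho rhoP] := rowbound.
(* [M n.+1] dominates [rho] of the row just picked. Later pairs [(j, k)] are farther apart than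
   that, hence invisible to every unit of this row; this is [early]. *)
pose fix M n := if n is n'.+1 then maxn (M n').+1 (rho (pick (M n')).1.1) else 0%N.
pose a n := (pick (M n)).1.1; pose z n := (pick (M n)).1.2.
pose j n := (pick (M n)).2.1; pose k n := (pick (M n)).2.2.
pose e n := munit x (a n) (base (z n)).
have MS n : (M n < M n.+1)%N by rewrite /= leq_max ltnSn.
have Mhom m n : (m <= n)%N -> (M m <= M n)%N.
  move=> /subnK <-; elim: (n - m)%N => // d IH.
  by rewrite addSn (leq_trans IH)// ltnW.
have Mge n : (n <= M n)%N by elim: n => // n IH; exact: leq_ltn_trans IH (MS n).
have zP n : mdist (posX (a n)) (z n) <= r by have [] := pickP (M n).
have far n : (M n)%:R < mdist (posY (j n)) (posY (k n)) by have [] := pickP (M n).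
have hump n : y (j n) (Phi (e n) (bvec y (k n))) != 0 by have [] := pickP (M n).
have early m n w : (m < n)%N -> mdist (posX (a m)) w <= r ->
    y (j n) (Phi (munit x (a m) (base w)) (bvec y (k n))) = 0.
  move=> mn amw; apply/eqP/negPn/negP => /(rhoP _ _ amw).
  rewrite leNgt => /negP; apply; apply: le_lt_trans (far n).
  rewrite ler_nat; apply: leq_trans (Mhom _ _ mn).
  by rewrite /= leq_max leqnn orbT.
(* A row picked twice would make the later hump vanish by [early]. *)
have a_inj : injective a.
  suff lt_neq m n : (m < n)%N -> a m <> a n.
    move=> m n amn; case: (ltngtP m n) => // mn; first by case: (lt_neq _ _ mn).
    by case: (lt_neq _ _ mn).
  move=> mn amn; have /eqP := hump n; apply; rewrite /e.
  by rewrite -amn; apply: early => //; rewrite amn.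
pose eps n := rnorm (y (j n) (Phi (e n) (bvec y (k n)))).
have eps_gt0 n : 0 < eps n by rewrite rnorm_gt0.
have ell_le T n : A T -> rnorm (y (j n) (Phi T (bvec y (k n)))) <= opnorm T.
  move=> AT; apply: le_trans (frame_coord_le p1 fy _ _) _.
  have bPT : bounded_op (Phi T) by exact/Bbd/PhiB.
  apply: le_trans (opnorm_bound _ bPT) _.
  rewrite nPhi// -[leRHS]mulr1 ler_wpM2l//; last exact: (bvec_norm p1 fy).
  by apply: opnorm_ge0; exact: Abd.
have eps_le1 n : eps n <= 1.
  apply: le_trans (ell_le _ _ (Amu _ _)) _; apply: opnorm_le => // h.
  by rewrite mul1r (munit_norm p1 fx).
(* The factor $\varepsilon_n/4$ makes the tail after [n], of norm at most
   $2c_{n+1}=c_n\varepsilon_n/2$, smaller than the hump $c_n\varepsilon_n$. As $\varepsilon_n\le 1$,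
   the [c n] also decrease geometrically. *)
pose fix c n : R := if n is n'.+1 then c n' * eps n' / 4 else 1.
have c_gt0 n : 0 < c n by elim: n => //= n IH; rewrite divr_gt0// mulr_gt0.
have cS n : c n.+1 <= c n / 4.
  by rewrite /= ler_wpM2r// ler_piMr// ltW.
have cD m n : c (m + n)%N <= c m / 4 ^+ n.
  elim: n => [|n IH]; first by rewrite addn0 expr0 divr1.
  rewrite addnS (le_trans (cS _))// exprSr invfM mulrA.
  by rewrite ler_wpM2r.
have /choice[idx idxP] : forall b, exists o : option nat,
    if o is Some n then a n = b else forall n, a n <> b.
  move=> b; have [[n <-]|nb] := pselect (exists n, a n = b); first by exists (Some n).
  by exists None => n ab; apply: nb; exists n.
have idxa n : idx (a n) = Some n.
  by have := idxP (a n); case: (idx _) => [m /a_inj ->//|/(_ n)].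
pose s b := if idx b is Some n then z n else posX b.
pose w m b : R[i]^o := if idx b is Some n then
  (if (m <= n)%N then real_complex R (c n) else 0) else 0.
have wE m n : w m (a (m + n)%N) = real_complex R (c (m + n)%N).
  by rewrite /w idxa leq_addr.
have w_psum m : (psum p (fun b => rnorm (w m b)) <= ((2 * c m) `^ p)%:E)%E.
  rewrite (@psum_seq _ _ p1 _ _ (fun n => a (m + n)%N)); last 2 first.
  - by move=> n n' /a_inj /addnI.
  - move=> b nb; rewrite /w; have := idxP b; case: (idx b) => [n anb|_].
      case: leqP => mn; last by rewrite rnorm0.
      by case: nb; exists (n - m)%N => //; rewrite subnKC.
    by rewrite rnorm0.
  apply: psum_geometric => // [|n /=]; first exact/ltW.
  rewrite wE rnorm_real ger0_norm; last exact/ltW.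
  by rewrite ltW//= cD.
have w_oo m : (psum p (fun b => rnorm (w m b)) < +oo)%E.
  by rewrite (le_lt_trans (w_psum m))// ltry.
(* The tail $\sum_{n\ge m}c_ne_n$. Rows that were never picked have weight [0], so the value of [s]
   there is arbitrary. *)
pose T m := weighted_rows x (w m) (base \o s).
have AT m : A (T m).
  apply: (Arows (r := r)) => // b; rewrite /w /s.
  have := idxP b; case: (idx b) => [n <-|]; last by rewrite eqxx.
  by split=> //; have [] := pickP (M n).
have T_le m : opnorm (T m) <= 2 * c m.
  apply: opnorm_le => [|h]; first by rewrite mulr_ge0// ltW.
  by apply: (weighted_rows_norm p1 fx) => //; rewrite mulr_ge0// ltW.
have TS m : T m = real_complex R (c m) *: e m + T m.+1.
  apply/funext => h; apply: (frame_inj p1 fx) => b.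
  have [xl _ _] := fx.
  rewrite fctE xl (weighted_rowsE p1 fx)// (weighted_rowsE p1 fx)//.
  rewrite fctE /e (munitE p1 fx) /w /= /s.
  have := idxP b; case: (idx b) => [n anb|nb]; last first.
    rewrite (_ : b == a m = false) ?mul0r ?scaler0 ?addr0//.
    by apply/eqP => bam; case: (nb m).
  have -> : (b == a m) = (n == m).
    by rewrite -anb; apply/eqP/eqP => [/a_inj|->].
  case: (ltngtP m n) => mn; rewrite ?mul0r ?scaler0 ?add0r//.
  by rewrite mul1r mn addr0.
have ellD m n : y (j n) (Phi (T m) (bvec y (k n))) =
    real_complex R (c m) *: y (j n) (Phi (e m) (bvec y (k n))) +
    y (j n) (Phi (T m.+1) (bvec y (k n))).
  by have [yl _ _] := fy; rewrite {1}TS lPhi; [exact: yl|exact: Amu|exact: AT].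
(* The terms before [n] vanish at the pair [(j n, k n)] by [early], so the full sum can be replaced
   there by its tail. *)
have ell0 n : y (j n) (Phi (T 0%N) (bvec y (k n))) =
    y (j n) (Phi (T n) (bvec y (k n))).
  suff : forall m, (m <= n)%N -> y (j n) (Phi (T 0%N) (bvec y (k n))) =
      y (j n) (Phi (T m) (bvec y (k n))) by apply.
  elim=> // m IH mn; rewrite IH; last exact: ltnW.
  by rewrite ellD /e early// scaler0 add0r.
have [N TN] := Bprop _ (PhiB _ (AT 0%N)).
have [n Nn] : exists n : nat, N < n%:R.
  by exists (Num.truncn `|N|).+1; apply: le_lt_trans (ler_norm _) (truncnS_gt _).
suff /TN : y (j n) (Phi (T 0%N) (bvec y (k n))) != 0.
  rewrite leNgt => /negP; apply; apply: lt_trans Nn _.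
  by apply: le_lt_trans (far n); rewrite ler_nat.
rewrite ell0 ellD -rnorm_gt0; apply: lt_le_trans (rnorm_sub_ge _ _).
rewrite subr_gt0 rnormZE rnorm_real ger0_norm; last exact: ltW.
apply: le_lt_trans (ell_le _ _ (AT _)) _; apply: le_lt_trans (T_le _) _.
rewrite /= -/(eps n); have := mulr_gt0 (c_gt0 n) (eps_gt0 n); lra.
Qed.

End UniformPropagation.

(** * Images of minimal idempotents *)

Section Morphism.
Context {R : realType} {H K : normedModType R[i]}.
Context (A : set (H -> H)) (B : set (K -> K)) (Phi : (H -> H) -> (K -> K)).
Hypothesis As : is_subalgebra A.
Hypothesis iPhi : isometric_morphism A B Phi.

Lemma morphism0 : Phi 0 = 0.
Proof.
have [_ A0 _ _] := As; have [_ lPhi _ _] := iPhi.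
by have := lPhi (-1) 0 0 A0 A0; rewrite scaler0 addr0 scaleN1r addNr.
Qed.

Lemma morphismZ c T : A T -> Phi (c *: T) = c *: Phi T.
Proof.
have [_ A0 _ _] := As; have [_ lPhi _ _] := iPhi => AT.
by rewrite -[c *: T]addr0 lPhi// morphism0 addr0.
Qed.

End Morphism.

Section Centers.
Context {R : realType} (p : R) (p1 : 1 <= p) {X Y : metricType R}.
Context {H K : normedModType R[i]} {I J : choiceType}.
Context (x : I -> H -> R[i]^o) (y : J -> K -> R[i]^o).
Hypotheses (fx : frame p x) (fy : frame p y).
Context (posX : I -> X) (posY : J -> Y) (base : X -> I).
Hypothesis posbase : cancel base posX.
Context (A : set (H -> H)) (B : set (K -> K)) (D : set I).
Hypothesis hX : bounded_geometry X.
Hypothesis Acontrolled : controlled_algebra x posX A.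
Hypothesis Bcontrolled : controlled_algebra y posY B.
Hypothesis Arows : row_closed p x posX base D A.
Hypothesis Dbase : forall z, D (base z).
Context (Phi : (H -> H) -> (K -> K)) (Psi : (K -> K) -> (H -> H)).
Hypothesis iPhi : isometric_morphism A B Phi.
Hypothesis iPsi : isometric_morphism B A Psi.
Hypothesis PhiK : forall T, A T -> Psi (Phi T) = T.
Hypothesis PsiK : forall S, B S -> Phi (Psi S) = S.

Let As : is_subalgebra A. Proof. by have [] := Acontrolled. Qed.
Let Bs : is_subalgebra B. Proof. by have [] := Bcontrolled. Qed.
Let Amu a b : A (munit x a b). Proof. by have [_ _] := Acontrolled. Qed.
Let Bmu a b : B (munit y a b). Proof. by have [_ _] := Bcontrolled. Qed.
Let PhiB T : A T -> B (Phi T). Proof. by have [+ _ _ _] := iPhi; apply. Qed.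
Let PsiA T : B T -> A (Psi T). Proof. by have [+ _ _ _] := iPsi; apply. Qed.
Let Abd T : A T -> bounded_op T. Proof. by have [+ _ _ _] := As; apply. Qed.
Let Bbd T : B T -> bounded_op T. Proof. by have [+ _ _ _] := Bs; apply. Qed.
Let Acomp S T : A S -> A T -> A (S \o T).
Proof. by have [_ _ _] := As; apply. Qed.
Let PhiM S T : A S -> A T -> Phi (S \o T) = Phi S \o Phi T.
Proof. by have [_ _ + _] := iPhi; apply. Qed.

Let q z := Phi (munit x (base z) (base z)).
Let Bq z : B (q z). Proof. exact: PhiB. Qed.

Lemma image_neq0 T : A T -> T <> 0 -> exists j k, y j (Phi T (bvec y k)) != 0.
Proof.
move=> AT T0; have PT0 : Phi T <> 0.
  by move=> PT0; apply: T0; rewrite -[T]PhiK// PT0 (morphism0 Bs iPsi).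
have [k /(frame_neq0 p1 fy)[j yj]] := frame_op_neq0 p1 fy (Bbd (PhiB AT)) PT0.
by exists j, k.
Qed.

(* [q z] is a minimal idempotent of [B], hence of rank one. *)
Lemma image_unit_rank1 z j1 j2 j h : y j1 (q z (bvec y j2)) != 0 ->
  y j1 (q z (bvec y j2)) * y j (q z h) = y j1 (q z h) * y j (q z (bvec y j2)).
Proof.
move=> q12; set e := munit x (base z) (base z).
have [yl _ _] := fy; have lq : linear (q z) by exact: (Bbd (Bq z)).1.
(* $e\,\Psi(e_{j_2j_1})\,e$ is a multiple of the minimal idempotent $e$; applying $\Phi$ gives the
   multiple of [q z]. *)
have [c qc] : exists c : R[i], q z \o munit y j2 j1 \o q z = c *: q z.
  have AT : A (Psi (munit y j2 j1)) by exact: PsiA.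
  exists (x (base z) (Psi (munit y j2 j1) (bvec x (base z)))).
  rewrite -{1}[munit y j2 j1]PsiK// -PhiM// -PhiM//; last exact: Acomp.
  by rewrite (munit_sandwich fx) ?(morphismZ As iPhi)//; exact: (Abd AT).1.
have qE g : y j1 (q z g) *: q z (bvec y j2) = c *: q z g.
  by have := congr1 (fun T => T g) qc; rewrite /= /munit (linZ _ _ lq).
have cE : c = y j1 (q z (bvec y j2)).
  have := congr1 (y j1) (qE (bvec y j2)); rewrite !linZ// => /(mulIf q12).
  by move=> ->.
by rewrite -cE; have := congr1 (y j) (qE h); rewrite !linZ// => <-.
Qed.

(** The matrix of the rank-one operator [q z] is a column times a row; the first clause locates the
    column, the second the row. *)
Definition center_map (f : X -> Y) (M : R) : Prop :=
  forall z, (forall h j, y j (q z h) != 0 -> mdist (f z) (posY j) <= M) /\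
    (forall j, q z (bvec y j) != 0 -> mdist (f z) (posY j) <= M).

Lemma center_map_exists : exists f M, center_map f M.
Proof.
have [N qN] := uniform_propagation p1 fx fy hX Acontrolled Bcontrolled Arows iPhi 0.
have {}qN z : propagates y posY N (q z) by apply: qN => //; rewrite posbase mdistxx.
have qneq0 z : exists jk : J * J, y jk.1 (q z (bvec y jk.2)) != 0.
  have [j [k ?]] := image_neq0 (Amu (base z) (base z))
    (@munit_neq0 _ _ p1 _ _ _ fx (base z) (base z)).
  by exists (j, k).
have /choice[jk jkP] := qneq0.
have N0 (z : X) : 0 <= N by apply: le_trans (qN z _ _ (jkP z)); exact: mdist_ge0.
(* The centre is the row index of a nonzero entry. The range of [q z] is reached from it through the
   column of that entry, in two steps of length at most [N]. *)
exists (fun z => posY (jk z).1), (N + N) => z; split.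
  move=> h j qj; have : y j (q z (bvec y (jk z).2)) != 0.
    apply: contra_neq qj => qj0; have := image_unit_rank1 j h (jkP z).
    by rewrite qj0 mulr0 => /eqP; rewrite mulf_eq0 (negbTE (jkP z)) => /eqP.
  move=> /qN jN; apply: le_trans (metric_triangle _ (posY (jk z).2) _) _.
  by apply: lerD; [exact: (qN z _ _ (jkP z))|rewrite metric_sym].
move=> j /(frame_neq0 p1 fy)[k qk].
have : y (jk z).1 (q z (bvec y j)) != 0.
  apply: contra_neq qk => qj0; have := image_unit_rank1 k (bvec y j) (jkP z).
  by rewrite qj0 mul0r => /eqP; rewrite mulf_eq0 (negbTE (jkP z)) => /eqP.
by move=> /qN /le_trans; apply; rewrite lerDl N0.
Qed.

Context (f : X -> Y) (M : R).
Hypothesis fM : center_map f M.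

Lemma image_row_support z a h j : y j (Phi (munit x (base z) a) h) != 0 ->
  mdist (f z) (posY j) <= M.
Proof.
by rewrite -(munit_comp p1 fx _ (base z)) PhiM//; have [+ _] := fM z; apply.
Qed.

Lemma image_col_support z a j : Phi (munit x a (base z)) (bvec y j) != 0 ->
  mdist (f z) (posY j) <= M.
Proof.
rewrite -(munit_comp p1 fx _ (base z)) PhiM//= => h0.
have [_ + ] := fM z; apply; apply: contra_neq h0; rewrite -/(q z) => ->.
exact: lin0 (Bbd (PhiB (Amu _ _))).1.
Qed.

(** A nonzero entry [(j, k)] of $\Phi(e_{z_1z_2})$ has [j] near [f z1] and [k] near [f z2], while
    [uniform_propagation] bounds the distance from [j] to [k]. *)
Lemma center_map_expansive : uniformly_expansive f.
Proof.
move=> r r0.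
have [N qN] := uniform_propagation p1 fx fy hX Acontrolled Bcontrolled Arows iPhi r.
exists (`|M + N + M| + 1); first by rewrite ltr_wpDl.
move=> z1 z2 z12.
have [j [k jk]] := image_neq0 (Amu (base z1) (base z2))
  (@munit_neq0 _ _ p1 _ _ _ fx (base z1) (base z2)).
have jkN : mdist (posY j) (posY k) <= N.
  by apply: qN jk => //; rewrite posbase.
have z1j : mdist (f z1) (posY j) <= M by exact: image_row_support jk.
have z2k : mdist (f z2) (posY k) <= M.
  apply: (@image_col_support _ (base z1)); apply: contra_neq jk => ->.
  by have [yl _ _] := fy; rewrite lin0.
apply: le_trans (metric_triangle _ (posY k) _) _.
apply: (@le_trans _ _ (M + N + M)); last first.
  by apply: le_trans (ler_norm _) _; rewrite lerDl.
rewrite lerD//; last by rewrite metric_sym.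
by apply: le_trans (metric_triangle _ (posY j) _) _; rewrite lerD.
Qed.

End Centers.

Section Closeness.
Context {R : realType} (p : R) (p1 : 1 <= p) {X Y : metricType R}.
Context {H K : normedModType R[i]} {I J : choiceType}.
Context (x : I -> H -> R[i]^o) (y : J -> K -> R[i]^o).
Hypotheses (fx : frame p x) (fy : frame p y).
Context (posX : I -> X) (posY : J -> Y) (baseX : X -> I) (baseY : Y -> J).
Hypothesis posbaseX : cancel baseX posX.
Hypothesis posbaseY : cancel baseY posY.
Context (A : set (H -> H)) (B : set (K -> K)) (D : set I).
Hypothesis hX : bounded_geometry X.
Hypothesis Acontrolled : controlled_algebra x posX A.
Hypothesis Bcontrolled : controlled_algebra y posY B.
Hypothesis Arows : row_closed p x posX baseX D A.
Context (Phi : (H -> H) -> (K -> K)) (Psi : (K -> K) -> (H -> H)).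
Hypothesis iPhi : isometric_morphism A B Phi.
Hypothesis iPsi : isometric_morphism B A Psi.
Hypothesis PhiK : forall T, A T -> Psi (Phi T) = T.
Hypothesis PsiK : forall S, B S -> Phi (Psi S) = S.
Context (f : X -> Y) (g : Y -> X) (M N : R).
Hypothesis fM : center_map x y posY baseX Phi f M.
Hypothesis gN : center_map y x posX baseY Psi g N.
Hypothesis fexp : uniformly_expansive f.
Hypothesis Psi_detects : forall w,
  exists2 a, D a & Psi (munit y (baseY w) (baseY w)) (bvec x a) != 0.

(** Let [a] in [D] be a basis index on which $\Psi(e_{ww})$ is nonzero, so that [posX a] is near
    [g w]. Then $\Psi(e_{ww})E\ne 0$ for the unit [E] from the base vector over [posX a] to [a],
    hence $e_{ww}\Phi(E)\ne 0$. A nonzero entry of $\Phi(E)$ in row [w] has its column near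
    [f (posX a)], which is near [f (g w)], and by uniform propagation also near [w]. *)
Lemma center_maps_close : close_maps (f \o g) id.
Proof.
have [As _ Amu] := Acontrolled; have [Bs _ Bmu] := Bcontrolled.
have [PhiB _ PhiM _] := iPhi; have [PsiA _ PsiM _] := iPsi.
have [Bbd _ _ Bcomp] := Bs; have [Abd _ _ Acomp] := As.
have [L PhiL] := uniform_propagation p1 fx fy hX Acontrolled Bcontrolled Arows iPhi 0.
have [s s0 fs] := fexp (r := `|N| + 1) ltac:(by rewrite ltr_wpDl).
exists (s + `|M + L| + 1); first by rewrite ltr_wpDl// addr_ge0// ltW.
move=> w /=; have [a Da Pa] := Psi_detects w.
have ga : mdist (g w) (posX a) <= N by have [_ +] := gN w; apply.
set P := munit y (baseY w) (baseY w) in Pa.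
set E := munit x a (baseX (posX a)).
have AE : A E by exact: Amu.
have BP : B P by exact: Bmu.
have BPE : B (P \o Phi E) by apply: Bcomp => //; exact: PhiB.
have nz : P \o Phi E <> 0.
  move=> PE0; have : Psi P \o E = 0.
    by rewrite -[E]PhiK// -PsiM ?PE0 ?(morphism0 Bs iPsi)//; exact: PhiB.
  move=> /(congr1 (fun T => T (bvec x (baseX (posX a))))) /=.
  rewrite /E /munit (bvecii p1 fx) scale1r => /eqP.
  by rewrite -[_ == _]/(_ == 0) (negbTE Pa).
have [k] := frame_op_neq0 p1 fy (Bbd _ BPE) nz.
rewrite /= {1}/P /munit => ck.
have yk : y (baseY w) (Phi E (bvec y k)) != 0.
  by apply: contra_neq ck => ->; rewrite scale0r.
have wk : mdist w (posY k) <= L.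
  by rewrite -[w]posbaseY; apply: PhiL yk => //; rewrite mdistxx.
have fk : mdist (f (posX a)) (posY k) <= M.
  apply: (image_col_support p1 fx Acontrolled Bcontrolled iPhi fM (a := a)).
  by apply: contra_neq yk => ->; have [yl _ _] := fy; rewrite lin0.
have fgw : mdist (f (g w)) (f (posX a)) <= s.
  by apply: fs; apply: le_trans ga _; apply: le_trans (ler_norm _) _; rewrite lerDl.
apply: le_trans (metric_triangle _ (f (posX a)) _) _.
rewrite -addrA lerD//; apply: (@le_trans _ _ (M + L)); last first.
  by apply: le_trans (ler_norm _) _; rewrite lerDl.
apply: le_trans (metric_triangle _ (posY k) _) _.
by rewrite lerD// metric_sym.
Qed.

End Closeness.

(** * Matrix entries *)

Section EllpBasics.
Context {R : realType} (p : R) (p1 : 1 <= p) {X : choiceType}.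
Context {E : normedModType R[i]}.
Local Notation H := (ellp p1 X E).

Lemma ellp_lin (x : X) : linear (fun f : H => f x). Proof. by []. Qed.

Lemma ellp_coord_le (f : H) x : rnorm (f x) <= rnorm f.
Proof.
have := psum_term p (fun z => rnorm (f z)) x.
rewrite (psum_pnorm p1 (ellpP f)) lee_fin (powR_le p1) ?rnorm_ge0//.
exact: pnorm_ge0.
Qed.

Lemma ellp_eq (f g : H) : f =1 g -> f = g.
Proof. by move=> fg; apply/val_inj/funext. Qed.

Lemma ellp_sumE (J : Type) (r : seq J) (f : J -> H) x :
  (\sum_(j <- r) f j) x = \sum_(j <- r) f j x.
Proof. exact: (lin_sum r xpredT f (ellp_lin x)). Qed.

Lemma deltaE y (v : E) x : (delta y v : H) x = if x == y then v else 0.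
Proof. by []. Qed.

Lemma delta_lin y : linear (delta y : E -> H).
Proof.
move=> a u v; apply: ellp_eq => x.
rewrite -[RHS]/(a *: (delta y u : H) x + (delta y v : H) x) !deltaE.
by case: ifP => _; rewrite ?scaler0 ?addr0.
Qed.

Lemma delta_bounded y : bounded_op (delta y : E -> H).
Proof.
split; first exact: delta_lin.
exists 1 => v; rewrite mul1r; apply: pnorm_le => //; first exact: rnorm_ge0.
rewrite (@psum_supp1 _ _ p1 _ _ y) /= ?eqxx// => j /negbTE ->.
by rewrite rnorm0.
Qed.

Lemma ellp_finite_support (f : H) (F : seq X) : uniq F ->
  (forall x, x \notin F -> f x = 0) -> f = \sum_(z <- F) delta z (f z).
Proof.
move=> uF f0; apply: ellp_eq => x; rewrite ellp_sumE.
have [xF|xF] := boolP (x \in F); last first.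
  rewrite f0// big_seq big1// => z zF; rewrite deltaE ifN//.
  by apply: contraNneq xF => ->.
rewrite (bigD1_seq x)//= eqxx big1 ?addr0// => z zx.
by rewrite eq_sym (negbTE zx).
Qed.

End EllpBasics.

Section Entries.
Context {R : realType} (p : R) (p1 : 1 <= p) {X : metricType R}.
Context {E : normedModType R[i]}.
Local Notation H := (ellp p1 X E).
Implicit Types T : H -> H.

Lemma entry_bounded T x y : bounded_op T -> bounded_op (entry T x y).
Proof.
move=> bT; have bc : bounded_op (fun f : H => f x).
  by split => //; exists 1 => f; rewrite mul1r ellp_coord_le.
exact: (bounded_op_comp bc (bounded_op_comp bT (delta_bounded p1 y))).
Qed.

Lemma finite_propagationP T : finite_propagation T <->
  exists N : R, forall x y v, N < mdist x y -> T (delta y v) x = 0.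
Proof.
split=> [Toov|[N TN]].
  have [N TN] : exists N : R, (propagation T <= N%:E)%E.
    move: Toov; rewrite /finite_propagation; case: (propagation T) => // [N|] _.
      by exists N.
    by exists 0; rewrite leNye.
  exists N => x y v Nxy; have [|n0] := pselect (entry T x y <> 0).
    move=> e0; have : ((mdist x y)%:E <= propagation T)%E.
      by apply: ereal_sup_ubound; exists (x, y).
    by move=> /le_trans/(_ TN); rewrite lee_fin leNgt Nxy.
  by have /(congr1 (fun S => S v)) := contrapT n0.
apply: (@le_lt_trans _ _ N%:E); last by rewrite ltry.
apply: ge_ereal_sup => _ [[x y] /= e0 <-]; rewrite lee_fin leNgt.
by apply/negP => Nxy; apply: e0; apply/funext => v; exact: TN.
Qed.

(** Column [y] of [T] is supported in the finite set [F], so the matrix product is a finite sum and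
    no convergence is involved. *)
Lemma entry_comp S T N x y v (F : seq X) : bounded_op S ->
  (forall x y v, N < mdist x y -> T (delta y v) x = 0) ->
  uniq F -> (forall z, mdist z y <= N -> z \in F) ->
  entry (S \o T) x y v = \sum_(z <- F) entry S x z (entry T z y v).
Proof.
move=> bS TN uF yF; rewrite {1}/entry /=.
rewrite {1}[T _](ellp_finite_support (F := F))//; last first.
  by move=> z zF; apply: TN; rewrite ltNge; apply: contra zF => /yF.
by rewrite (lin_sum _ _ _ bS.1) ellp_sumE.
Qed.

Lemma ball_seq : bounded_geometry X -> forall y N, exists2 F : seq X, uniq F &
  forall z, (z \in F) = (mdist z y <= N).
Proof.
move=> hX y N; have fB := finite_ball hX y N.
exists (fset_set [set z | mdist y z <= N]); first exact: fset_uniq.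
move=> z; rewrite in_fset_set//; apply/idP/idP; rewrite inE /= metric_sym//.
Qed.

Lemma finite_propagation_comp S T : bounded_geometry X -> bounded_op S ->
  finite_propagation S -> finite_propagation T -> finite_propagation (S \o T).
Proof.
move=> hX bS /finite_propagationP[M SM] /finite_propagationP[N TN].
apply/finite_propagationP; exists (M + N) => x y v xy.
have [F uF FE] := ball_seq hX y N.
rewrite -/(entry _ _ _ _) (@entry_comp _ _ N _ _ _ F)//; last by move=> z; rewrite FE.
rewrite big_seq big1// => z; rewrite FE => zy; apply: SM.
by have := metric_triangle x z y; lra.
Qed.

Lemma finite_propagation_lincomb (a : R[i]) S T :
  finite_propagation S -> finite_propagation T -> finite_propagation (a *: S + T).
Proof.
move=> /finite_propagationP[M SM] /finite_propagationP[N TN].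
apply/finite_propagationP; exists (Num.max M N) => x y v.
rewrite gt_max => /andP[Mxy Nxy].
by rewrite -[LHS]/(a *: S (delta y v) x + T (delta y v) x) SM// TN// scaler0 addr0.
Qed.

Lemma finite_propagation0 : finite_propagation (0 : H -> H).
Proof. by apply/finite_propagationP; exists 0. Qed.

Section FramedEntries.
Context {S : choiceType} {xi : S -> E -> R[i]^o}.
Hypothesis fxi : frame p xi.
Local Notation I := (X * S)%type.

Definition ecoord (k : I) (f : H) : R[i]^o := xi k.2 (f k.1).

Lemma frame_ecoord : frame p ecoord.
Proof. exact: frame_ellp. Qed.

Lemma delta_bvec z s : delta z (bvec xi s) = bvec ecoord (z, s).
Proof.
have [xl _ _] := fxi; apply: (frame_inj p1 frame_ecoord) => -[w t].
rewrite (bvecE p1 frame_ecoord) /ecoord /= xpair_eqE; case: ifP => _.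
  by rewrite (bvecE p1 fxi).
exact: lin0.
Qed.

Lemma finite_propagation_propagates T : finite_propagation T ->
  exists N, propagates ecoord fst N T.
Proof.
move=> /finite_propagationP[N TN]; exists N => -[z s] [w t].
rewrite -delta_bvec /ecoord /= leNgt => zw; apply/negP => Nzw.
by move: zw; have [xl _ _] := fxi; rewrite TN// lin0// eqxx.
Qed.

Lemma entry_munit a b z w v : entry (munit ecoord a b) z w v =
  xi b.2 v *: (if (z == a.1) && (w == b.1) then bvec xi a.2 else 0).
Proof.
have [xl _ _] := fxi; case: a b => [a s] [b t]; rewrite /entry /munit /ecoord /=.
rewrite -delta_bvec -[LHS]/(_ *: delta a (bvec xi s) z) !deltaE (eq_sym b).
by case: (w == b); case: (z == a) => /=; rewrite ?scaler0// lin0// scale0r.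
Qed.

Lemma munit_finite_propagation a b : finite_propagation (munit ecoord a b).
Proof.
apply/finite_propagationP; exists (mdist a.1 b.1) => z w v zw.
rewrite -/(entry _ _ _ _) entry_munit; case: eqP => [za|_]; last by rewrite scaler0.
case: eqP => [wb|_]; last by rewrite scaler0.
by rewrite za wb ltxx in zw.
Qed.

Lemma psum_slice (c : I -> R[i]^o) z (P : S -> bool) :
  (psum p (fun a => rnorm (c a)) < +oo)%E ->
  (psum p (fun t => rnorm (if P t then c (z, t) else 0)%R) < +oo)%E.
Proof.
move=> coo; apply: le_lt_trans coo.
apply: (@le_trans _ _ (psum p (fun t => rnorm (c (z, t))))).
  by apply: psum_le => // u; case: ifP; rewrite ?rnorm0 ?rnorm_ge0 lexx.
have cE : (fun a => rnorm (c a)) = (fun k : X * S => rnorm (c (k.1, k.2))).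
  by apply/funext => -[].
rewrite cE (psum_pair p (fun z t => rnorm (c (z, t)))) (esumID [set z]); last first.
  by move=> *; exact: psum_ge0.
by rewrite setTI esum_set1 ?psum_ge0// leeDl// esum_ge0// => *; exact: psum_ge0.
Qed.

(** All columns used have second index [s0], so each entry is one functional times a vector, even
    when the rows run through all of [S]. This puts such operators into every Roe-type algebra. *)
Lemma entry_weighted_rows c (s : I -> X) s0 z w v :
  (psum p (fun a => rnorm (c a)) < +oo)%E ->
  entry (weighted_rows ecoord c ((fun x => (x, s0)) \o s)) z w v =
  xi s0 v *: synth xi (fun t => if w == s (z, t) then c (z, t) else 0).
Proof.
have [xl _ _] := fxi => coo; apply: (frame_inj p1 fxi) => t.
rewrite linZ// (synthE fxi); last exact: psum_slice.
have := weighted_rowsE p1 frame_ecoord ((fun x => (x, s0)) \o s) (delta w v) (z, t) coo.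
rewrite {1 3}/ecoord /= => ->; rewrite (eq_sym w); case: ifP => _; first exact: mulrC.
by rewrite lin0// mulr0 scaler0.
Qed.

Lemma weighted_rows_finite_propagation c (s : I -> X) s0 r :
  (psum p (fun a => rnorm (c a)) < +oo)%E ->
  (forall a, c a != 0 -> mdist a.1 (s a) <= r) ->
  finite_propagation (weighted_rows ecoord c ((fun x => (x, s0)) \o s)).
Proof.
move=> coo cr; apply/finite_propagationP; exists r => z w v rzw.
rewrite -/(entry _ _ _ _) entry_weighted_rows//.
rewrite (_ : synth _ _ = 0) ?scaler0//; apply: (frame_eq0 p1 fxi) => t.
have e0 : (fun t => if w == s (z, t) then c (z, t) else 0) = (fun=> 0).
  apply/funext => u; case: eqP => // wE; apply/eqP/negPn/negP => /cr /=.
  by rewrite -wE leNgt rzw.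
rewrite e0 (synthE fxi)// /psum esum1 ?ltry// => u _; rewrite rnorm0 powR0//.
by rewrite gt_eqF// (lt_le_trans _ p1).
Qed.

End FramedEntries.

End Entries.

Arguments ecoord {R p p1 X E S} xi k f.

(** * Finite-rank operators and local units *)

Definition glue {m n} {T : Type} (f : 'I_m -> T) (g : 'I_n -> T) (k : 'I_(m + n)) :=
  match fintype.split k with inl i => f i | inr j => g j end.

Lemma gluel m n T (f : 'I_m -> T) (g : 'I_n -> T) i : glue f g (lshift n i) = f i.
Proof. by rewrite /glue -/(unsplit (inl i)) unsplitK. Qed.

Lemma gluer m n T (f : 'I_m -> T) (g : 'I_n -> T) i : glue f g (rshift m i) = g i.
Proof. by rewrite /glue -/(unsplit (inr i)) unsplitK. Qed.

Section FiniteRank.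
Context {R : realType} {E : normedModType R[i]}.
Implicit Types T : E -> E.

(** The spanning vectors need not be independent, so sums and compositions are bounded without
    choosing bases; [subspace_dim] converts the bound to [has_dim]. *)
Definition spanned_by {T0 : Type} (T : T0 -> E) (N : nat) : Prop :=
  exists e : 'I_N -> E, forall v, exists c : 'I_N -> R[i],
    T v = \sum_(i < N) c i *: e i.

Lemma subspace_dim (V : set E) (N : nat) (e : 'I_N -> E) :
  (forall a u v, V u -> V v -> V (a *: u + v)) -> V 0 ->
  (forall v, V v -> exists c : 'I_N -> R[i], v = \sum_(i < N) c i *: e i) ->
  exists2 n, (n <= N)%N & has_dim V n.
Proof.
move=> Vl V0 Ve.
pose free m (u : 'I_m -> E) := forall c : 'I_m -> R[i],
  \sum_(i < m) c i *: u i = 0 -> forall i, c i = 0.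
pose P m := `[< exists u : 'I_m -> E, (forall i, V (u i)) /\ free m u >].
have Vsum m (c : 'I_m -> R[i]) (u : 'I_m -> E) :
    (forall i, V (u i)) -> V (\sum_(i < m) c i *: u i).
  by move=> Vu; apply: big_rec => // i v _; exact: Vl.
have P0 : P 0%N.
  by apply/asboolP; exists (fun=> 0); split => // c _ [].
have PN m : P m -> (m <= N)%N.
  move=> /asboolP[u [Vu fu]].
  have /choice[a aP] : forall i, exists c : 'I_N -> R[i], u i = \sum_(k < N) c k *: e k.
    by move=> i; exact: Ve.
  (* Independent vectors in the span of [N] vectors have a coefficient matrix with independent rows,
     so there are at most [N] of them. *)
  pose M := \matrix_(i < m, k < N) a i k.
  suff : row_free M by rewrite /row_free => /eqP <-; exact: rank_leq_col.
  apply: inj_row_free => v vM; apply/rowP => i; rewrite [RHS]mxE.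
  apply: (fu (fun i => v 0 i)).
  transitivity (\sum_(k < N) (v *m M) 0 k *: e k); last first.
    by rewrite vM big1// => k _; rewrite mxE scale0r.
  under eq_bigr do rewrite aP scaler_sumr; rewrite exchange_big /=.
  apply: eq_bigr => k _; rewrite mxE scaler_suml; apply: eq_bigr => j _.
  by rewrite scalerA mxE.
have [n Pn nmax] := ex_maxnP (ex_intro _ 0%N P0) PN.
exists n; first exact: PN.
have /asboolP[u [Vu fu]] := Pn; exists u; split => //.
apply/seteqP; split=> [v Vv|_ [c _ <-]]; last exact: Vsum.
(* Adjoining [v] to an independent family of maximal size creates a relation. The coefficient of [v]
   in it is nonzero, since [u] is independent, so the relation can be solved for [v]. *)
pose u' (i : 'I_n.+1) := if unlift ord_max i is Some j then u j else v.
have u'w j : u' (widen_ord (leqnSn n) j) = u j.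
  have -> : widen_ord (leqnSn n) j = lift ord_max j.
    by apply/val_inj; rewrite /= /bump leqNgt ltn_ord.
  by rewrite /u' liftK.
have u'm : u' ord_max = v by rewrite /u' unlift_none.
have nfree : ~ free n.+1 u'.
  move=> fu'; have : P n.+1.
    apply/asboolP; exists u'; split => // i; rewrite /u'.
    by case: unliftP => [j _|_].
  by move/nmax; rewrite ltnn.
have [c cE [i ci]] : exists2 c : 'I_n.+1 -> R[i],
    \sum_(i < n.+1) c i *: u' i = 0 & exists i, c i != 0.
  apply: contrapT => nc; apply: nfree => c cE i; apply/eqP/negPn/negP => ci.
  by apply: nc; exists c => //; exists i.
move: cE; rewrite big_ord_recr /= u'm; under eq_bigr do rewrite u'w.
move=> cE; have cm : c ord_max != 0.
  apply: contra_neq ci => cm; move: cE; rewrite cm scale0r addr0 => /fu cw.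
  have [->//|im] := eqVneq i ord_max.
  move: im; rewrite eq_sym => /unlift_some[j -> _].
  have -> : lift ord_max j = widen_ord (leqnSn n) j; last exact: cw.
  by apply/val_inj; rewrite /= /bump leqNgt ltn_ord.
exists (fun j => - (c ord_max)^-1 * c (widen_ord (leqnSn n) j)) => //.
under eq_bigr do rewrite -scalerA.
rewrite -scaler_sumr; move/eqP: cE; rewrite addr_eq0 => /eqP ->.
by rewrite scalerN scaleNr opprK scalerA mulVf// scale1r.
Qed.

Lemma spanned_rank_le T N M : linear T -> spanned_by T N -> (N <= M)%N -> rank_le T M.
Proof.
move=> lT [e Te] NM; have [| |v [w _ <-]|n nN dn] := @subspace_dim (range T) N e.
- by move=> a _ _ [u _ <-] [v _ <-]; exists (a *: u + v) => //; rewrite lT.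
- by exists 0 => //; exact: lin0.
- exact: Te.
- by exists n => //; exact: leq_trans NM.
Qed.

Lemma has_dim_spanned T n : has_dim (range T) n -> spanned_by T n.
Proof.
move=> [e [_ eT]]; exists e => v.
have : range T (T v) by exists v.
by rewrite eT => -[c _ <-]; exists c.
Qed.

Lemma rank_le_spanned T N : rank_le T N -> exists2 n, (n <= N)%N & spanned_by T n.
Proof. by move=> [n nN /has_dim_spanned]; exists n. Qed.

Lemma spanned_line (f : E -> R[i]) w : spanned_by (fun v => f v *: w) 1.
Proof. by exists (fun=> w) => v; exists (fun=> f v); rewrite big_ord1. Qed.

Lemma spanned_add (T0 : Type) (S T : T0 -> E) M N :
  spanned_by S M -> spanned_by T N -> spanned_by (fun v => S v + T v) (M + N).
Proof.
move=> [e eS] [f fT].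
exists (glue e f) => v.
have [c ->] := eS v; have [d ->] := fT v.
exists (glue c d); rewrite big_split_ord /=.
by congr (_ + _); apply: eq_bigr => i _; rewrite ?gluel ?gluer.
Qed.

Lemma spanned_sum (T0 J : Type) (r : seq J) (T : J -> T0 -> E) N :
  (forall j, exists2 n, (n <= N)%N & spanned_by (T j) n) ->
  exists2 n, (n <= size r * N)%N & spanned_by (fun v => \sum_(j <- r) T j v) n.
Proof.
move=> TN; elim: r => [|j r [n nr IH]].
  by exists 0%N => //; exists (fun=> 0) => v; exists (fun=> 0); rewrite big_nil big_ord0.
have [m mN Tm] := TN j; exists (m + n)%N; first by rewrite mulSn leq_add.
have [e eP] := spanned_add Tm IH.
by exists e => v; rewrite big_cons; exact: eP.
Qed.

Lemma spanned_comp {F : normedModType R[i]} (L : F -> E) (T : E -> F)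
    (e : nat) : linear L -> (exists e0 : 'I_e -> F, forall v, exists c : 'I_e -> R[i],
    T v = \sum_(i < e) c i *: e0 i) -> spanned_by (L \o T) e.
Proof.
move=> lL [e0 Te]; exists (L \o e0) => v; have [c cE] := Te v; exists c.
by rewrite /= cE (lin_sum _ _ _ lL); apply: eq_bigr => i _; rewrite linZ.
Qed.

Definition finite_rank_op T : Prop := bounded_op T /\ exists N, spanned_by T N.

Lemma finite_rank_has_dim T : finite_rank_op T -> exists n, has_dim (range T) n.
Proof. by move=> [[lT _] [N TN]]; have [n _ ?] := spanned_rank_le lT TN (leqnn N); exists n. Qed.

Lemma finite_rank_line (phi : E -> R[i]^o) w :
  bounded_op phi -> finite_rank_op (fun v => phi v *: w).
Proof. by move=> bphi; split; [exact: bounded_op_scale|exists 1%N; exact: spanned_line]. Qed.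

End FiniteRank.

(** The rank of the first [N] columns is at most [m], so it is maximal for some [N], and from there
    on the left kernel stops shrinking. Linear relations in infinitely many coordinates are thereby
    reduced to a finite matrix. *)
Lemma columns_stabilize (F : fieldType) m (a : 'I_m -> nat -> F) :
  exists N, forall c : 'I_m -> F, (forall n, (n < N)%N -> \sum_i c i * a i n = 0) ->
    forall n, \sum_i c i * a i n = 0.
Proof.
pose M N := \matrix_(i < m, n < N) a i n.
pose P (r : nat) := `[< exists N, \rank (M N) = r >].
have Pex : P (\rank (M 0%N)) by apply/asboolP; exists 0%N.
have Pm r : P r -> (r <= m)%N by move=> /asboolP[N <-]; exact: rank_leq_row.
have [r /asboolP[N Nr] rmax] := ex_maxnP (ex_intro P _ Pex) Pm.
exists N => c c0 n.
have kerP k (v : 'rV_m) : (v <= kermx (M k))%MS <->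
    forall j, (j < k)%N -> \sum_i v 0 i * a i j = 0.
  rewrite (sameP sub_kermxP eqP); split=> [/eqP vM j jk|vM].
    have := congr1 (fun A : 'rV_k => A 0 (Ordinal jk)) vM; rewrite mxE [RHS]mxE.
    by move=> vMj; rewrite -[RHS]vMj; apply: eq_bigr => i _; rewrite mxE.
  apply/eqP/rowP => j; rewrite !mxE -[RHS](vM j (ltn_ord j)).
  by apply: eq_bigr => i _; rewrite mxE.
pose N' := maxn N n.+1.
have sub : (kermx (M N') <= kermx (M N))%MS.
  apply/row_subP => i; apply/kerP => j jN; apply: (kerP N' _).1 (row_sub i _) _ _.
  by rewrite leq_max jN.
(* Maximality of the rank forbids a smaller kernel, so the inclusion [sub] is an equality. *)
have sub' : (kermx (M N) <= kermx (M N'))%MS.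
  rewrite -(geq_leqif (mxrank_leqif_sup sub)) !mxrank_ker leq_sub2l// Nr.
  by apply: rmax; apply/asboolP; exists N'.
pose v : 'rV_m := \row_i c i.
have vE j : \sum_i v 0 i * a i j = \sum_i c i * a i j.
  by apply: eq_bigr => i _; rewrite mxE.
have : (v <= kermx (M N))%MS by apply/kerP => j /c0; rewrite vE.
by move=> /submx_trans/(_ sub')/kerP/(_ n); rewrite vE; apply; rewrite leq_max leqnn orbT.
Qed.

Section LocalUnits.
Context {R : realType} (p : R) (p1 : 1 <= p).
Context {E : normedModType R[i]} (x : nat -> E -> R[i]^o).
Hypothesis fx : frame p x.
Let xl i : linear (x i). Proof. by have [+ _ _] := fx; apply. Qed.
Let bx i : bounded_op (x i). Proof. exact: (frame_bounded p1 fx). Qed.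



(** The [w a] may be dependent, so a dual basis need not exist. Their relations are visible on the
    first [N] coordinates, and a pseudoinverse $WPW=W$ of that finite matrix supplies the
    coefficients of the functionals. *)
Lemma dual_functionals m (w : 'I_m -> E) : exists psi : 'I_m -> E -> R[i]^o,
  (forall b, bounded_op (psi b)) /\
  forall a, \sum_b psi b (w a) *: w b = w a.
Proof.
have [N Nst] := @columns_stabilize _ m (fun i n => x n (w i) : R[i]).
pose W := \matrix_(i < m, n < N) (x n (w i) : R[i]).
pose P := pinvmx W; have WPW : W *m P *m W = W by exact: mulmxKpV.
exists (fun b v => \sum_(j < N) P j b *: x j v); split.
  move=> b; apply: bounded_op_sum => j _.
  by rewrite -[fun v => _]addr0; apply: bounded_op_lincomb => //; exact: bounded_op0.
move=> a; apply: (frame_inj p1 fx) => n; rewrite (lin_sum _ _ _ (xl n)).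
under eq_bigr do rewrite linZ//.
(* Row [a] of $WP-1$: by $WPW=W$ it is a relation on the first [N] coordinates, hence on all of
   them. *)
pose d b := (W *m P) a b - (b == a)%:R.
have dE k : \sum_b d b * x k (w b) =
    \sum_b (W *m P) a b * x k (w b) - x k (w a).
  under eq_bigr do rewrite mulrBl; rewrite sumrB; congr (_ - _).
  rewrite (bigD1 a)//= eqxx mul1r big1 ?addr0// => b /negbTE ->.
  by rewrite mul0r.
have /Nst/(_ n)/eqP : forall k, (k < N)%N -> \sum_b d b * x k (w b) = 0.
  move=> k kN; rewrite dE; apply/eqP; rewrite subr_eq0; apply/eqP.
  have /matrixP/(_ a (Ordinal kN)) := WPW.
  by rewrite mxE [RHS]mxE /= => <-; apply: eq_bigr => b _; rewrite [W b _]mxE.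
rewrite dE subr_eq0 => /eqP <-; apply: eq_bigr => b _; rewrite mxE; congr (_ * _).
by apply: eq_bigr => j _; rewrite [W a j]mxE; exact: mulrC.
Qed.

(** The transpose of [dual_functionals]: relations between functionals are visible on finitely many
    basis vectors, and density extends them to [E]. *)
Lemma dual_vectors l (phi : 'I_l -> E -> R[i]^o) : (forall a, bounded_op (phi a)) ->
  exists u : 'I_l -> E, forall c v, \sum_a phi a v *: phi c (u a) = phi c v.
Proof.
move=> bphi; have [N Nst] := @columns_stabilize _ l (fun i n => phi i (bvec x n) : R[i]).
pose W := \matrix_(i < l, n < N) (phi i (bvec x n) : R[i]).
pose P := pinvmx W; have WPW : W *m P *m W = W by exact: mulmxKpV.
exists (fun a => \sum_(j < N) P j a *: bvec x j) => c v.
have phiu a : phi c (\sum_(j < N) P j a *: bvec x j) = (W *m P) c a.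
  rewrite (lin_sum _ _ _ (bphi c).1) mxE; apply: eq_bigr => j _.
  by rewrite (linZ _ _ (bphi c).1) [W c j]mxE; exact: mulrC.
under eq_bigr do rewrite phiu.
pose d a : R[i]^o := (W *m P) c a - (a == c)%:R.
have dE g : \sum_a d a * phi a g =
    \sum_a phi a g *: ((W *m P) c a : R[i]^o) - phi c g.
  under eq_bigr do rewrite mulrBl; rewrite sumrB; congr (_ - _).
    by apply: eq_bigr => a _; exact: mulrC.
  rewrite (bigD1 c)//= eqxx mul1r big1 ?addr0// => b /negbTE ->.
  by rewrite mul0r.
apply/eqP; rewrite -subr_eq0 -dE; apply/eqP.
apply: (frame_dense0 p1 fx (T := fun g => \sum_a d a * phi a g)).
  apply: bounded_op_sum => a _.
  rewrite -[fun v => _]addr0; apply: (@bounded_op_lincomb _ _ R[i]^o (d a) (phi a)) => //.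
  exact: bounded_op0.
apply: Nst => k kN; rewrite dE; apply/eqP; rewrite subr_eq0; apply/eqP.
have /matrixP/(_ c (Ordinal kN)) := WPW.
rewrite mxE [RHS]mxE /= => <-; apply: eq_bigr => b _; rewrite [W b _]mxE.
exact: mulrC.
Qed.

Lemma finite_rank_expansion T : finite_rank_op T -> exists m (w : 'I_m -> E) phi,
  (forall b, bounded_op (phi b : E -> R[i]^o)) /\
  forall v, T v = \sum_b phi b v *: w b.
Proof.
move=> [bT [m [w wT]]]; have [psi [bpsi psiw]] := dual_functionals w.
exists m, w, (fun b => psi b \o T); split.
  by move=> b; exact: bounded_op_comp.
move=> v; have [c cE] := wT v; rewrite /= cE.
under [LHS]eq_bigr do rewrite -psiw scaler_sumr.
rewrite exchange_big /=; apply: eq_bigr => b _.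
rewrite (lin_sum _ _ _ (bpsi b).1) scaler_suml; apply: eq_bigr => a _.
by rewrite (linZ _ _ (bpsi b).1) scalerA.
Qed.

Definition finite_rank_idempotent (P : E -> E) : Prop :=
  finite_rank_op P /\ P \o P = P.

(** $Q_1$ projects onto the span of the [w b]. To preserve the functionals too, a second idempotent
    $Q_2$ with $Q_2Q_1=0$ is built from $\varphi'_a=\varphi_a(1-Q_1)$, and $P=Q_1+(1-Q_1)Q_2$. Then
    $Q_1P=Q_1$ and $Q_2P=Q_2$, whence $P^2=P$. *)
Lemma local_unit_system m (w : 'I_m -> E) l (phi : 'I_l -> E -> R[i]^o) :
  (forall a, bounded_op (phi a)) -> exists P, [/\ finite_rank_idempotent P,
    forall b, P (w b) = w b & forall a v, phi a (P v) = phi a v].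
Proof.
move=> bphi; have [psi [bpsi psiw]] := dual_functionals w.
pose Q1 v := \sum_b psi b v *: w b.
have bQ1 : bounded_op Q1 by apply: bounded_op_sum => b _; exact: bounded_op_scale.
have Q1K v : Q1 (Q1 v) = Q1 v.
  rewrite {2}/Q1 (lin_sum _ _ _ bQ1.1); apply: eq_bigr => b _.
  by rewrite (linZ _ _ bQ1.1) {1}/Q1 psiw.
pose phi' a v := phi a (v - Q1 v).
have bphi' a : bounded_op (phi' a).
  apply: (bounded_op_comp (bphi a) (T := fun v => v - Q1 v)).
  have -> : (fun v => v - Q1 v) = (-1) *: Q1 + id.
    by apply/funext => v; rewrite -[RHS]/(-1 *: Q1 v + v) scaleN1r addrC.
  by apply: bounded_op_lincomb => //; exact: bounded_op_id.
have [u phi'u] := dual_vectors bphi'.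
pose Q2 v := \sum_a phi' a v *: u a.
have bQ2 : bounded_op Q2 by apply: bounded_op_sum => b _; exact: bounded_op_scale.
have phi'Q2 a v : phi' a (Q2 v) = phi' a v.
  rewrite -[RHS]phi'u (lin_sum _ _ _ (bphi' a).1); apply: eq_bigr => b _.
  by rewrite (linZ _ _ (bphi' a).1).
have phi'Q1 a v : phi' a (Q1 v) = 0 by rewrite /phi' Q1K subrr (lin0 (bphi a).1).
have Q2Q1 v : Q2 (Q1 v) = 0 by rewrite /Q2 big1// => a _; rewrite phi'Q1 scale0r.
have Q2K v : Q2 (Q2 v) = Q2 v by apply: eq_bigr => a _; rewrite phi'Q2.
pose u' a := u a - Q1 (u a).
have Q2E v : \sum_a phi' a v *: u' a = Q2 v - Q1 (Q2 v).
  rewrite {2}/Q2 (lin_sum _ _ _ bQ1.1) -sumrB; apply: eq_bigr => a _.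
  by rewrite scalerBr (linZ _ _ bQ1.1).
pose P v := Q1 v + (Q2 v - Q1 (Q2 v)).
have PE : P = (fun v => \sum_b psi b v *: w b + \sum_a phi' a v *: u' a).
  by apply/funext => v; rewrite Q2E.
have bP : bounded_op P.
  rewrite PE -[fun v => _]/(Q1 + (fun v => \sum_a phi' a v *: u' a)) -[Q1]scale1r.
  apply: bounded_op_lincomb => //; apply: bounded_op_sum => b _.
  exact: bounded_op_scale.
have Q1P v : Q1 (P v) = Q1 v.
  by rewrite /P (linD _ _ bQ1.1) (linB _ _ bQ1.1) !Q1K subrr addr0.
have Q2P v : Q2 (P v) = Q2 v.
  by rewrite /P (linD _ _ bQ2.1) (linB _ _ bQ2.1) !Q2Q1 subr0 add0r Q2K.
exists P; split.
- split; last by apply/funext => v; rewrite /= {1}/P Q1P Q2P.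
  split=> //; exists (m + l)%N; rewrite PE; apply: spanned_add.
    by exists w => v; exists (psi^~ v).
  by exists u' => v; exists (phi'^~ v).
- move=> b; have Q1w : Q1 (w b) = w b by exact: psiw.
  by rewrite /P -{2 3}Q1w Q2Q1 (lin0 bQ1.1) subr0 addr0.
- move=> a v; rewrite /P (linD _ _ (bphi a).1) -/(phi' a (Q2 v)) phi'Q2 /phi'.
  by rewrite -(linD _ _ (bphi a).1) addrC subrK.
Qed.

Lemma local_unit2 S T : finite_rank_op S -> finite_rank_op T -> exists P,
  [/\ finite_rank_idempotent P, P \o S = S, S \o P = S, P \o T = T & T \o P = T].
Proof.
move=> /finite_rank_expansion[m [w [phi [bphi SE]]]].
move=> /finite_rank_expansion[n [z [psi [bpsi TE]]]].
have bglue k : bounded_op (glue phi psi k) by rewrite /glue; case: fintype.split.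
have [P [fP Pw Pphi]] := local_unit_system (glue w z) bglue.
have lP : linear P by case: fP => -[[]].
exists P; split=> //; apply/funext => v /=.
- rewrite SE (lin_sum _ _ _ lP); apply: eq_bigr => b _; rewrite linZ//.
  by congr (_ *: _); have := Pw (lshift n b); rewrite gluel.
- rewrite !SE; apply: eq_bigr => b _; congr (_ *: _).
  by have := Pphi (lshift n b) v; rewrite gluel.
- rewrite TE (lin_sum _ _ _ lP); apply: eq_bigr => b _; rewrite linZ//.
  by congr (_ *: _); have := Pw (rshift m b); rewrite gluer.
- rewrite !TE; apply: eq_bigr => b _; congr (_ *: _).
  by have := Pphi (rshift m b) v; rewrite gluer.
Qed.

Lemma local_unit_family (T : nat -> E -> E) k : (forall i, finite_rank_op (T i)) ->
  exists P, finite_rank_idempotent P /\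
    forall i, (i < k)%N -> P \o T i = T i /\ T i \o P = T i.
Proof.
move=> fT; elim: k => [|k [P [[fP PP] IH]]].
  by have [P [? _ _ _ _]] := local_unit2 (fT 0%N) (fT 0%N); exists P.
have [Q [fQ QP PQ QT TQ]] := local_unit2 fP (fT k).
exists Q; split=> // i; rewrite ltnS leq_eqVlt => /predU1P[->//|/IH[PT TP]].
by split; [rewrite -PT compA QP|rewrite -TP -compA PQ].
Qed.

End LocalUnits.

(** * Roe-type algebras *)

Lemma center_maps_exist {R : realType} (p : R) (p1 : 1 <= p) {X Y : metricType R}
    {H K : normedModType R[i]} {I J : choiceType}
    (x : I -> H -> R[i]^o) (y : J -> K -> R[i]^o)
    (posX : I -> X) (posY : J -> Y) (baseX : X -> I) (baseY : Y -> J)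
    (A : set (H -> H)) (B : set (K -> K)) (D : set I) (D' : set J)
    (Phi : (H -> H) -> (K -> K)) (Psi : (K -> K) -> (H -> H)) :
  frame p x -> frame p y -> cancel baseX posX -> cancel baseY posY ->
  bounded_geometry X -> bounded_geometry Y ->
  controlled_algebra x posX A -> controlled_algebra y posY B ->
  row_closed p x posX baseX D A -> row_closed p y posY baseY D' B ->
  (forall z, D (baseX z)) -> (forall w, D' (baseY w)) ->
  isometric_morphism A B Phi -> isometric_morphism B A Psi ->
  (forall T, A T -> Psi (Phi T) = T) -> (forall S, B S -> Phi (Psi S) = S) ->
  (forall w, exists2 a, D a & Psi (munit y (baseY w) (baseY w)) (bvec x a) != 0) ->
  (forall z, exists2 b, D' b & Phi (munit x (baseX z) (baseX z)) (bvec y b) != 0) ->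
  exists f g M N, [/\ center_map x y posY baseX Phi f M,
    center_map y x posX baseY Psi g N, uniformly_expansive f, uniformly_expansive g
    & close_maps (f \o g) id /\ close_maps (g \o f) id].
Proof.
move=> fx fy cX cY hX hY cA cB rA rB DX DY iPhi iPsi PhiK PsiK detA detB.
have [f [M fM]] := center_map_exists p1 fx fy cX hX cA cB rA DX iPhi iPsi PhiK PsiK.
have [g [N gN]] := center_map_exists p1 fy fx cY hY cB cA rB DY iPsi iPhi PsiK PhiK.
have fexp := center_map_expansive p1 fx fy cX hX cA cB rA DX iPhi iPsi PhiK fM.
have gexp := center_map_expansive p1 fy fx cY hY cB cA rB DY iPsi iPhi PsiK gN.
exists f, g, M, N; split=> //; split.
  exact: (center_maps_close p1 fx fy cY hX cA cB rA iPhi iPsi PhiK fM gN fexp detA).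
exact: (center_maps_close p1 fy fx cX hY cB cA rB iPsi iPhi PsiK gN fM gexp detB).
Qed.

Section Algebras.
Context {R : realType} {p : R} (p1 : 1 <= p) (X : metricType R).
Hypothesis hX : bounded_geometry X.
Local Notation C := (R[i]^o).
Local Notation ellpN := (ellp p1 nat C).

(** Scalars are the case of a one-point fibre, so the uniform algebra is indexed by [X * unit] and
    fits the scheme [X * S]. *)
Definition unit_coord (_ : unit) (c : C) : C := c.

Lemma frame_unit : frame p unit_coord. Proof. exact: frame_scalar. Qed.

Lemma uniform_roe_subalgebra : is_subalgebra (uniform_roe p1 X).
Proof.
split=> [T []//||a S T [bS fS] [bT fT]|S T [bS fS] [bT fT]].
- by split; [exact: bounded_op0|exact: finite_propagation0].
- by split; [exact: bounded_op_lincomb|exact: finite_propagation_lincomb].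
- by split; [exact: bounded_op_comp|exact: finite_propagation_comp].
Qed.

Lemma uniform_roe_controlled :
  controlled_algebra (ecoord (p1 := p1) unit_coord) fst (uniform_roe p1 X).
Proof.
split=> [|T [_]|a b]; first exact: uniform_roe_subalgebra.
  exact/finite_propagation_propagates/frame_unit.
split; first exact/(munit_bounded p1)/frame_ecoord/frame_unit.
exact/munit_finite_propagation/frame_unit.
Qed.

Lemma uniform_roe_rows : row_closed p (ecoord (p1 := p1) unit_coord) fst
  (fun z : X => (z, tt)) setT (uniform_roe p1 X).
Proof.
move=> c s r coo cr; split.
  exact/(weighted_rows_bounded p1 (frame_ecoord p1 frame_unit)).
by apply: (weighted_rows_finite_propagation p1 frame_unit) coo _ => a /cr[_]; exact.
Qed.

Section RoeType.
Context (s : option nat).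
Local Notation E := (ellp p1 (roe_index s) C).
Context (A : set (ellp p1 X E -> ellp p1 X E)).
Hypothesis hA : roe_type_algebra A.

Definition seq_coord {I : choiceType} (i : I) (f : ellp p1 I C) : C := f i.

Lemma frame_seq (I : choiceType) : frame p (@seq_coord I).
Proof. exact: frame_ellp_scalar. Qed.

Definition roe_index0 : roe_index s :=
  match s return roe_index s with Some n => ord0 | None => 0%N end.

Lemma rank1_roe_type (T : ellp p1 X E -> ellp p1 X E) :
  bounded_op T -> finite_propagation T ->
  (forall z w, exists f : E -> R[i], exists u, entry T z w = fun v => f v *: u) -> A T.
Proof.
have [_ _ sA] := hA => bT fT T1; apply: sA => //; exists 1%N => z w.
have [f [u Tfu]] := T1 z w; apply: (spanned_rank_le (N := 1)) => //.
  exact: (entry_bounded z w bT).1.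
by rewrite Tfu; exact: spanned_line.
Qed.

Lemma roe_type_controlled :
  controlled_algebra (ecoord (p1 := p1) (@seq_coord (roe_index s))) fst A.
Proof.
have [As Ap _] := hA; have fE := frame_seq (roe_index s).
split=> [//|T /Ap[_ /(finite_propagation_propagates fE)]//|a b].
apply: rank1_roe_type.
- exact/(munit_bounded p1)/frame_ecoord.
- exact: munit_finite_propagation.
- move=> z w; eexists _, _; apply/funext => v; exact: entry_munit.
Qed.

Lemma roe_type_rows :
  row_closed p (ecoord (p1 := p1) (@seq_coord (roe_index s))) fst
    (fun z : X => (z, roe_index0)) setT A.
Proof.
have fE := frame_seq (roe_index s) => c t r coo cr; apply: rank1_roe_type.
- exact/(weighted_rows_bounded p1 (frame_ecoord p1 fE)).
- by apply: (weighted_rows_finite_propagation p1 fE) coo _ => a /cr[_]; exact.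
- move=> z w; eexists _, _; apply/funext => v; exact: entry_weighted_rows.
Qed.

End RoeType.

Local Notation xi := (@seq_coord nat).

Lemma stable_roeP (T : ellp p1 X ellpN -> ellp p1 X ellpN) :
  stable_roe p1 X T <-> [/\ bounded_op T, finite_propagation T &
    exists P, finite_rank_idempotent P /\
      forall z w v, P (entry T z w (P v)) = entry T z w v].
Proof.
split=> [[bT fT [P [bP PP [n Pn] PT]]]|[bT fT [P [[fP PP] PT]]]]; split=> //; exists P.
  split; first by split=> //; split=> //; exists n; exact: has_dim_spanned.
  by move=> z w v; rewrite {2}PT.
split=> //; first exact: fP.1; first exact: finite_rank_has_dim.
by move=> z w; apply/funext => v; rewrite /= PT.
Qed.

(** Two operators come with different idempotents [P] and [Q]; a local unit [U] of both serves for
    their combinations and products. *)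
Lemma stable_roe_subalgebra : is_subalgebra (stable_roe p1 X).
Proof.
have fE := frame_seq nat.
have absorb (P Q : ellpN -> ellpN) (T : ellp p1 X ellpN -> ellp p1 X ellpN) :
    Q \o P = P -> P \o Q = P ->
    (forall z w v, P (entry T z w (P v)) = entry T z w v) ->
    forall (z w : X) v, entry T z w (Q v) = entry T z w v /\
      Q (entry T z w v) = entry T z w v.
  move=> QP PQ PT z w v; split; first by rewrite -PT -[P (Q v)]/((P \o Q) v) PQ PT.
  by rewrite -PT -[LHS]/((Q \o P) (entry T z w (P v))) QP.
split=> [T []//||a S T|S T].
- apply/stable_roeP; split; [exact: bounded_op0|exact: finite_propagation0|].
  (* For the zero operator any finite-rank idempotent will do; a local unit of a zero map provides
     one. *)
  have fr0 : finite_rank_op (fun v => xi 0%N v *: (0 : ellpN)).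
    exact/finite_rank_line/(frame_bounded p1 fE).
  have [P [fP _ _ _ _]] := local_unit2 p1 fE fr0 fr0; exists P; split=> // z w v.
  by case: fP => -[[lP _] _] _; rewrite [LHS](lin0 lP).
- move=> /stable_roeP[bS fS [P [[fP PP] PS]]] /stable_roeP[bT fT [Q [[fQ QQ] QT]]].
  have [U [fU UP PU UQ QU]] := local_unit2 p1 fE fP fQ.
  apply/stable_roeP; split; [exact: bounded_op_lincomb|exact: finite_propagation_lincomb|].
  exists U; split=> // z w v; have lU : linear U by case: fU => -[[]].
  rewrite -[entry _ z w _]/(a *: entry S z w (U v) + entry T z w (U v)) lU.
  have [-> ->] := absorb _ _ _ UP PU PS z w v.
  by have [-> ->] := absorb _ _ _ UQ QU QT z w v.
- move=> /stable_roeP[bS fS [P [[fP PP] PS]]] /stable_roeP[bT fT [Q [[fQ QQ] QT]]].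
  have [U [fU UP PU UQ QU]] := local_unit2 p1 fE fP fQ.
  apply/stable_roeP; split; [exact: bounded_op_comp|exact: finite_propagation_comp|].
  exists U; split=> // z w v; have lU : linear U by case: fU => -[[]].
  have /finite_propagationP[N TN] := fT; have [F uF FE] := ball_seq hX w N.
  have eE u : entry (S \o T) z w u = \sum_(t <- F) entry S z t (entry T t w u).
    by apply: entry_comp TN _ _ => // t; rewrite FE.
  rewrite !eE (lin_sum _ _ _ lU); apply: eq_bigr => t _.
  have [-> _] := absorb _ _ _ UQ QU QT t w v.
  by have [_ ->] := absorb _ _ _ UP PU PS z t (entry T t w v).
Qed.

(** One idempotent can fix the finitely many vectors [u] and preserve [phi], so it absorbs all
    entries at once. *)
Lemma rank1_stable_roe k (u : 'I_k -> ellpN) (phi : ellpN -> C)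
    (T : ellp p1 X ellpN -> ellp p1 X ellpN) :
  bounded_op T -> finite_propagation T -> bounded_op phi ->
  (forall z w, exists c : 'I_k -> R[i],
    forall v, entry T z w v = phi v *: \sum_i c i *: u i) ->
  stable_roe p1 X T.
Proof.
move=> bT fT bphi Tu; apply/stable_roeP; split=> //.
have [P [fP Pu Pphi]] := local_unit_system p1 (frame_seq nat) u (fun _ : 'I_1 => bphi).
exists P; split=> // z w v; have lP : linear P by case: fP => -[[]].
have [c cE] := Tu z w; rewrite !cE (Pphi ord0) linZ// (lin_sum _ _ _ lP).
by congr (_ *: _); apply: eq_bigr => i _; rewrite linZ// Pu.
Qed.

Lemma stable_roe_controlled :
  controlled_algebra (ecoord (p1 := p1) xi) fst (stable_roe p1 X).
Proof.
have fE := frame_seq nat.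
split=> [|T [_ /(finite_propagation_propagates fE)]//|a b].
  exact: stable_roe_subalgebra.
apply: (@rank1_stable_roe 1 (fun=> bvec xi a.2) (xi b.2)).
- exact/(munit_bounded p1)/frame_ecoord.
- exact: munit_finite_propagation.
- exact: (frame_bounded p1 fE).
- move=> z w; exists (fun=> if (z == a.1) && (w == b.1) then 1 else 0) => v.
  rewrite (entry_munit p1 fE) big_ord1; case: ifP => _; first by rewrite scale1r.
  by rewrite scale0r.
Qed.

Lemma stable_roe_rows k : row_closed p (ecoord (p1 := p1) xi) fst
  (fun z : X => (z, 0%N)) [set a | (a.2 < k)%N] (stable_roe p1 X).
Proof.
have fE := frame_seq nat => c t r coo cr.
apply: (@rank1_stable_roe k (fun i => bvec xi i) (xi 0%N)).
- exact/(weighted_rows_bounded p1 (frame_ecoord p1 fE)).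
- by apply: (weighted_rows_finite_propagation p1 fE) coo _ => a /cr[_]; exact.
- exact: (frame_bounded p1 fE).
- move=> z w; exists (fun i => if w == t (z, i : nat) then c (z, i : nat) else 0) => v.
  rewrite (entry_weighted_rows p1 fE)//; congr (_ *: _).
  apply: (frame_inj p1 fE) => j; have [xl _ _] := fE.
  rewrite (lin_sum _ _ _ (xl j)); under eq_bigr do rewrite linZ// (bvecE p1 fE).
  rewrite (synthE fE); last exact: (psum_slice p1 z (fun j => w == t (z, j)) coo).
  have [jk|kj] := ltnP j k.
    rewrite (bigD1 (Ordinal jk))//= eqxx big1 ?addr0 => [|i ij].
      by rewrite [RHS]mulr1.
    by rewrite (_ : j == i = false) ?scaler0//; apply: contra_neqF ij => /eqP ji; exact/val_inj.
  rewrite big1 => [|i _].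
    case: eqP => // _; apply/eqP/negPn/negP => /cr[/=].
    by rewrite ltnNge kj.
  by rewrite (_ : j == i = false) ?scaler0//; apply/eqP => ji; rewrite ji leqNgt ltn_ord in kj.
Qed.

End Algebras.

(** * Coarse rigidity *)

Section Rigidity.
Context {R : realType} {p : R} (p1 : 1 <= p) (X Y : metricType R).
Hypotheses (hX : bounded_geometry X) (hY : bounded_geometry Y).
Local Notation C := (R[i]^o).
Local Notation ellpN := (ellp p1 nat C).

Lemma image_unit_detected {H K : normedModType R[i]} {I J : choiceType}
    (x : I -> H -> C) (y : J -> K -> C) (A : set (H -> H)) (B : set (K -> K)) Phi Psi :
  frame p x -> frame p y -> is_subalgebra A -> is_subalgebra B ->
  isometric_morphism A B Phi -> isometric_morphism B A Psi ->
  (forall S, B S -> Phi (Psi S) = S) ->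
  forall b, B (munit y b b) -> exists a, Psi (munit y b b) (bvec x a) != 0.
Proof.
move=> fx fy sA sB iPhi iPsi PsiK b Bb; have [PsiA _ _ _] := iPsi.
apply: (frame_op_neq0 p1 fx); first by case: sA => + _ _ _; apply; exact: PsiA.
move=> P0; apply: (@munit_neq0 _ _ p1 _ _ _ fy b b).
by rewrite -[munit y b b]PsiK// P0 (morphism0 sA iPhi).
Qed.

Lemma roe_type_rigidity (sX sY : option nat)
     (A : set (ellp p1 X (ellp p1 (roe_index sX) C) ->
               ellp p1 X (ellp p1 (roe_index sX) C)))
     (B : set (ellp p1 Y (ellp p1 (roe_index sY) C) ->
               ellp p1 Y (ellp p1 (roe_index sY) C))) :
  roe_type_algebra A -> roe_type_algebra B ->
  isometrically_isomorphic A B -> coarsely_equivalent X Y.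
Proof.
move=> hA hB AB; have cA := roe_type_controlled hA; have cB := roe_type_controlled hB.
have [sA _ muA] := cA; have [sB _ muB] := cB.
have [Phi [Psi [iPhi iPsi PhiK PsiK]]] := isometric_inverse sA sB AB.
have fx := frame_ecoord p1 (frame_seq p1 (roe_index sX)) (X := X).
have fy := frame_ecoord p1 (frame_seq p1 (roe_index sY)) (X := Y).
have [//|//|//|//|w|z|f [g [M [N [_ _ fe ge [fg gf]]]]]] := center_maps_exist
  (baseX := fun z : X => (z, roe_index0 sX)) (baseY := fun z : Y => (z, roe_index0 sY))
  p1 fx fy _ _ hX hY cA cB (roe_type_rows hA) (roe_type_rows hB) _ _ iPhi iPsi PhiK PsiK _ _.
- have [a ?] := image_unit_detected fx fy sA sB iPhi iPsi PsiK (muB (w, roe_index0 sY) _).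
  by exists a.
- have [a ?] := image_unit_detected fy fx sB sA iPsi iPhi PhiK (muA (z, roe_index0 sX) _).
  by exists a.
by exists f; split=> //; exists g.
Qed.

Lemma diagonal_op {Z : metricType R} {E : normedModType R[i]} (k : E -> E) : bounded_op k ->
  exists T : ellp p1 Z E -> ellp p1 Z E, bounded_op T /\
    forall f z, T f z = k (f z).
Proof.
move=> bk; have [M M0 kM] := bounded_op_bound bk.
have psumk (f : ellp p1 Z E) : (psum p (fun z => rnorm (k (f z))) <=
    ((M * rnorm f)%R `^ p)%:E)%E.
  apply: (@le_trans _ _ (psum p (fun z => M * rnorm (f z))%R)).
    by apply: psum_le => // z; rewrite rnorm_ge0 kM.
  apply: le_trans (psum_scale _ _ _) _ => //; first by move=> z; exact: rnorm_ge0.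
  by rewrite (psum_pnorm p1 (ellpP f)) powRM// ?rnorm_ge0// EFinM.
have /choice[T TE] : forall f : ellp p1 Z E, exists g : ellp p1 Z E, forall z, g z = k (f z).
  move=> f; have kfP : (fun z => k (f z)) \in @ellp_pred R p Z E.
    by rewrite inE /=; apply: le_lt_trans (psumk f) _; rewrite ltry.
  by exists (Ellp p1 kfP).
exists T; split=> //; split.
  move=> a u v; apply: ellp_eq => z.
  by rewrite -[RHS]/(a *: T u z + T v z) !TE -bk.1.
exists M => f; apply: pnorm_le => //; first by rewrite mulr_ge0// rnorm_ge0.
have -> : (fun z => rnorm (T f z)) = fun z => rnorm (k (f z)) by apply/funext => z; rewrite TE.
exact: psumk.
Qed.

End Rigidity.

Section StableRigidity.
Context {R : realType} {p : R} (p1 : 1 <= p).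
Local Notation C := (R[i]^o).
Local Notation ellpN := (ellp p1 nat C).
Local Notation xi := (@seq_coord _ _ p1 nat).

(* The images of all the units [e_(w, 0)] lie under the image of the single
   element [1 (x) e_0], hence in [M (x) Q] for one finite-rank [Q]; they are
   therefore detected by finitely many basis vectors of l^p. *)
Lemma stable_unit_detected (X Y : metricType R) Phi Psi :
  bounded_geometry X -> bounded_geometry Y ->
  isometric_morphism (stable_roe p1 X) (stable_roe p1 Y) Phi ->
  isometric_morphism (stable_roe p1 Y) (stable_roe p1 X) Psi ->
  (forall S, stable_roe p1 Y S -> Phi (Psi S) = S) ->
  exists k, forall w : Y, exists2 a, [set a : X * nat | (a.2 < k.+1)%N] a &
    Psi (munit (ecoord xi) (w, 0%N) (w, 0%N)) (bvec (ecoord xi) a) != 0.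
Proof.
move=> hX hY iPhi iPsi PsiK; have fE : frame p xi := frame_seq p1 nat.
have fx : frame p (ecoord (X := X) xi) := frame_ecoord p1 fE.
have fy : frame p (ecoord (X := Y) xi) := frame_ecoord p1 fE.
have [sA _ muA] := stable_roe_controlled p1 hX.
have [sB _ muB] := stable_roe_controlled p1 hY.
have [PsiA _ PsiM _] := iPsi.
have [Abd _ _ _] := sA.
have bk : bounded_op (munit xi 0%N 0%N : ellpN -> ellpN) by exact: (munit_bounded p1 fE).
have [T [bT TE]] := @diagonal_op _ _ p1 Y _ _ bk.
have entryT z w v : entry T z w v = xi 0%N v *: (if z == w then bvec xi 0%N else 0).
  rewrite /entry TE deltaE; case: eqP => // _.
  by rewrite scaler0 /munit (lin0 (frame_bounded p1 fE _).1) scale0r.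
have BT : stable_roe p1 Y T.
  apply: (@rank1_stable_roe _ _ p1 _ 1 (fun=> bvec xi 0%N) (xi 0%N)) => //.
  - apply/finite_propagationP; exists 0 => z w v zw.
    rewrite -/(entry _ _ _ _) entryT; case: eqP => zwE; last by rewrite scaler0.
    by rewrite zwE mdistxx ltxx in zw.
  - exact: (frame_bounded p1 fE).
  - move=> z w; exists (fun=> if z == w then 1 else 0) => v.
    by rewrite entryT big_ord1; case: ifP; rewrite ?scale1r ?scale0r.
have /stable_roeP[bPT _ [Q [[fQ QQ] QT]]] := PsiA _ BT.
have [m [u [psi [bpsi QE]]]] := finite_rank_expansion p1 fE fQ.
(* A relation between the $\psi_b$ that holds on $e_n$ for [n < k] holds on every $e_n$. This [k]
   depends only on [Q], so it serves all [w]. *)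
have [k kst] := @columns_stabilize _ m (fun i n => psi i (bvec xi n) : R[i]).
exists k => w; set P := Psi _.
have AP : stable_roe p1 X P by apply: PsiA; exact: muB.
have bP := Abd _ AP.
(* $e_{(w,0)}(1\otimes e_0)=e_{(w,0)}$, so [P] absorbs [Psi T], whose entries in turn absorb [Q]. *)
have PTE : P \o Psi T = P.
  rewrite /P -PsiM//; congr Psi; apply/funext => f /=.
  rewrite /munit /ecoord /= TE /munit; have [xl _ _] := fE.
  by rewrite (linZ _ _ (xl _)) (bvecii p1 fE) [_ *: 1]mulr1.
have PQ z v : P (delta z (Q v)) = P (delta z v).
  rewrite -PTE /=; congr (P _); apply: ellp_eq => t.
  rewrite -/(entry _ _ _ _) -[RHS]/(entry (Psi T) t z v) -[LHS]QT -[RHS]QT.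
  by rewrite -[Q (Q v)]/((Q \o Q) v) QQ.
have [[z0 n0]] := image_unit_detected p1 fx fy sA sB iPhi iPsi PsiK (muB (w, 0%N) _).
rewrite -/P => Pa; apply: contrapT => nodet.
have zero z n : (n < k)%N -> P (delta z (bvec xi n)) = 0.
  move=> nk; apply/eqP/negPn/negP => Pn; apply: nodet; exists (z, n).
    by rewrite /= ltnW.
  by rewrite -(delta_bvec p1 fE).
have expand z v : P (delta z v) = \sum_b psi b v *: P (delta z (u b)).
  rewrite -PQ QE (lin_sum _ _ _ (delta_lin p1 z)) (lin_sum _ _ _ bP.1).
  by apply: eq_bigr => b _; rewrite (linZ _ _ (delta_lin p1 z)) (linZ _ _ bP.1).
have /negP := Pa; apply; apply/eqP; rewrite -(delta_bvec p1 fE).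
apply: (frame_eq0 p1 fx) => a; have [xl _ _] := fx.
have coordE n : ecoord xi a (P (delta z0 (bvec xi n))) =
    \sum_b ecoord xi a (P (delta z0 (u b))) * psi b (bvec xi n).
  rewrite expand (lin_sum _ _ _ (xl a)); apply: eq_bigr => b _.
  by rewrite (linZ _ _ (xl a)); exact: mulrC.
rewrite coordE; apply: kst => n nk.
by rewrite -coordE zero// (lin0 (xl a)).
Qed.

Lemma stable_rigidity (X Y : metricType R) :
  bounded_geometry X -> bounded_geometry Y ->
  isometrically_isomorphic (stable_roe p1 X) (stable_roe p1 Y) ->
  coarsely_equivalent X Y.
Proof.
move=> hX hY AB.
have cA := stable_roe_controlled p1 hX; have cB := stable_roe_controlled p1 hY.
have [sA _ muA] := cA; have [sB _ muB] := cB.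
have [Phi [Psi [iPhi iPsi PhiK PsiK]]] := isometric_inverse sA sB AB.
have [k detA] := stable_unit_detected hX hY iPhi iPsi PsiK.
have [l detB] := stable_unit_detected hY hX iPsi iPhi PhiK.
have fE : frame p xi := frame_seq p1 nat.
have fx : frame p (ecoord (X := X) xi) := frame_ecoord p1 fE.
have fy : frame p (ecoord (X := Y) xi) := frame_ecoord p1 fE.
(* With [k.+1] and [l.+1] the sets of rows contain the base points, whose second index is [0]. *)
have [//|//|//|//|f [g [M [N [_ _ fe ge [fg gf]]]]]] := center_maps_exist
  (baseX := fun z : X => (z, 0%N)) (baseY := fun z : Y => (z, 0%N))
  p1 fx fy _ _ hX hY cA cB (stable_roe_rows (k := k.+1) p1 (X := X))
  (stable_roe_rows (k := l.+1) p1 (X := Y)) _ _ iPhi iPsi PhiK PsiK detA detB.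
by exists f; split=> //; exists g.
Qed.

End StableRigidity.

(** * Bijective rigidity *)

Section Marriage.
Context {X Y : choiceType} (A : X -> {fset Y}).
Local Open Scope fset_scope.

Let nbr (D : set (X * Y)) (F : {fset X}) : {fset Y} :=
  \bigcup_(x <- F) [fset y in A x | ~~ `[< D (x, y) >]].

Let nbrP D F y : reflect (exists x, [/\ x \in F, y \in A x & ~ D (x, y)]) (y \in nbr D F).
Proof.
apply: (iffP (bigfcupP _ _ _ _)) => [[x]|[x [xF yA nD]]].
  rewrite andbT => xF; rewrite !inE => /andP[yA /asboolPn nD].
  by exists x.
by exists x; rewrite ?andbT// !inE /= yA; apply/asboolPn.
Qed.

Let nbr_mono D D' F : (forall x, x \in F -> forall y, y \in A x -> D' (x, y) -> D (x, y)) ->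
  nbr D F `<=` nbr D' F.
Proof.
move=> DD; apply/fsubsetP => y /nbrP[x [xF yA nD]].
by apply/nbrP; exists x; split=> // D'xy; apply: nD; exact: DD.
Qed.

Let hall (D : set (X * Y)) := forall F : {fset X}, (#|` F| <= #|` nbr D F|)%N.

(* Rado's argument: a maximal set [D] of deletable pairs leaves one choice per
   point, since deleting either of two choices would create two deficient
   sets, contradicting submodularity of [F |-> #|` nbr D F|]. *)
Lemma marriage :
  (forall F : {fset X}, (#|` F| <= #|` \bigcup_(x <- F) A x|)%N) ->
  exists2 g : X -> Y, injective g & forall x, g x \in A x.
Proof.
move=> hA; have hall0 : hall set0.
  move=> F; apply: leq_trans (hA F) _; apply: fsubset_leq_card.
  apply/fsubsetP => y /bigfcupP[x]; rewrite andbT => xF yA.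
  by apply/nbrP; exists x; split.
have [|D [hD Dmax]] := @Zorn_bigcup _ hall.
  move=> F FP totF G.
  (* Hall's condition at [G] involves only the finitely many pairs in [S]; some member of the chain
     contains all those that the union contains. *)
  pose S : seq (X * Y) := [seq k | x <- enum_fset G, k <- [seq (x, y) | y <- enum_fset (A x)]].
  have [D0 [D0P D0F]] : exists D0, hall D0 /\
      forall k, k \in S -> (\bigcup_(D in F) D)%classic k -> D0 k.
    have [[D0 FD0]|nF] := pselect (exists D, F D); last first.
      by exists set0; split=> // k _ [D FD _]; case: nF; exists D.
    suff [D1 FD1 D1P] : exists2 D1, F D1 &
        forall k, k \in S -> (\bigcup_(D in F) D)%classic k -> D1 k.
      by exists D1; split=> //; exact: FP.
    elim: S => [|k S [D1 FD1 IH]]; first by exists D0.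
    have [[D2 FD2 D2k]|nk] := pselect ((\bigcup_(D in F) D)%classic k); last first.
      by exists D1 => // l; rewrite inE => /predU1P[-> //|]; exact: IH.
    have [D12|D21] := totF _ _ FD1 FD2.
      by exists D2 => // l; rewrite inE => /predU1P[-> //|lS /(IH _ lS)]; exact: D12.
    exists D1 => // l; rewrite inE => /predU1P[-> _|]; [exact: D21|exact: IH].
  apply: leq_trans (D0P G) _; apply: fsubset_leq_card; apply: nbr_mono => x xG y yA.
  apply: D0F; apply/flattenP; exists [seq (x, y) | y <- enum_fset (A x)].
    by apply/mapP; exists x => //; rewrite map_id.
  by apply/mapP; exists y.
have hx x : exists y, y \in nbr D [fset x].
  by have := hD [fset x]; rewrite cardfs1 cardfs_gt0 => /fset0Pn.
(* By maximality of [D], deleting the pair of [x] and [y] as well violates Hall's condition at some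
   set, which must contain [x]; removing [x] from it gives [F]. *)
have deficient x y : y \in nbr D [fset x] -> exists2 F : {fset X}, x \notin F &
    (#|` nbr D F `|` (nbr D [fset x] `\ y)| <= #|` F|)%N.
  move=> /nbrP[x' [/fset1P -> yA nD]].
  have /Dmax nh : (D `<` D `|` [set (x, y)])%classic.
    split; first by move=> k Dk; left.
    by move=> /(_ (x, y)) /(_ (or_intror erefl)).
  have [F FD] : exists F : {fset X}, ~ (#|` F| <= #|` nbr (D `|` [set (x, y)])%classic F|)%N.
    by apply: contrapT => nF; apply: nh => F; apply: contrapT => FD; apply: nF; exists F.
  have xF : x \in F.
    apply/negPn/negP => xF; apply: FD; apply: leq_trans (hD F) _.
    apply: fsubset_leq_card; apply: nbr_mono => z zF w _ [//|[zx _]].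
    by rewrite zx (negbTE xF) in zF.
  exists (F `\ x); first by rewrite !inE eqxx.
  move/negP: FD; rewrite -ltnNge (cardfsD1 x F) xF ltnS; apply: leq_trans.
  apply: fsubset_leq_card; apply/fsubsetP => z; rewrite in_fsetU => /orP[].
    move=> /nbrP[w [+ zA nDz]]; rewrite !inE => /andP[wx wF].
    by apply/nbrP; exists w; split=> // -[//|[wx']]; rewrite wx' eqxx in wx.
  rewrite in_fsetD1 => /andP[zy /nbrP[w [/fset1P -> zA nDz]]].
  by apply/nbrP; exists x; split=> // -[//|[zy']]; rewrite zy' eqxx in zy.
have uniq1 x y1 y2 : y1 \in nbr D [fset x] -> y2 \in nbr D [fset x] -> y1 = y2.
  move=> y1x y2x; apply/eqP/negPn/negP => y12.
  have [F1 xF1 F1d] := deficient x y1 y1x; have [F2 xF2 F2d] := deficient x y2 y2x.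
  (* The union of the two sets contains every neighbour of $F_1\cup F_2\cup\{x\}$, since each
     neighbour of [x] survives on one side when [y1] and [y2] differ; the intersection contains the
     neighbours of $F_1\cap F_2$. Hall's condition then exceeds the two deficient bounds by one. *)
  have := leq_add F1d F2d; rewrite -cardfsUI -[leqRHS]cardfsUI.
  apply/negP; rewrite -ltnNge.
  have U : (#|` x |` (F1 `|` F2)| <= #|` (nbr D F1 `|` (nbr D [fset x] `\ y1)) `|`
      (nbr D F2 `|` (nbr D [fset x] `\ y2))|)%N.
    apply: leq_trans (hD _) _; apply: fsubset_leq_card; apply/fsubsetP => z.
    move=> /nbrP[w [wF zA nD]]; move: wF.
    rewrite in_fset1U in_fsetU => /orP[/eqP wx|/orP[wF|wF]].
    - have zx : z \in nbr D [fset x].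
        by apply/nbrP; exists w; split=> //; rewrite wx inE.
      rewrite !in_fsetU !in_fsetD1 zx !andbT.
      by have [->|_] := eqVneq z y1; rewrite ?y12 ?orbT.
    - by rewrite !in_fsetU; apply/orP; left; apply/orP; left; apply/nbrP; exists w.
    - by rewrite !in_fsetU; apply/orP; right; apply/orP; left; apply/nbrP; exists w.
  have V : (#|` F1 `&` F2| <= #|` (nbr D F1 `|` (nbr D [fset x] `\ y1)) `&`
      (nbr D F2 `|` (nbr D [fset x] `\ y2))|)%N.
    apply: leq_trans (hD _) _; apply: fsubset_leq_card; apply/fsubsetP => z.
    move=> /nbrP[w [+ zA nD]]; rewrite in_fsetI => /andP[w1 w2].
    rewrite in_fsetI !in_fsetU; apply/andP; split; apply/orP; left; apply/nbrP.
      by exists w.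
    by exists w.
  have := leq_add U V; apply: leq_trans.
  by rewrite cardfsU1 in_fsetU negb_or xF1 xF2 /= add1n addSn.
have /choice[g gP] := hx.
exists g => [x x' gx|x]; last by have /nbrP[w [/fset1P ->]] := gP x.
(* Two points with the same value under [g] would have a single neighbour between them. *)
apply/eqP/negPn/negP => xx'; have := hD [fset x; x'].
rewrite cardfs2 xx' leqNgt => /negP; apply.
have -> : nat_of_bool true = #|` [fset g x]| by rewrite cardfs1.
rewrite ltnS; apply: fsubset_leq_card; apply/fsubsetP => y.
move=> /nbrP[w [+ yA nD]]; rewrite in_fset2 => /orP[]/eqP wE.
  apply/fset1P; apply: (uniq1 x) => //; apply/nbrP; exists w; split=> //.
  by rewrite wE inE.
apply/fset1P; rewrite gx; apply: (uniq1 x') => //; apply/nbrP; exists w; split=> //.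
by rewrite wE inE.
Qed.

End Marriage.

(** The alternative in the conclusion is the point: the bijection inherits closeness to a map from
    [g] and from the partial inverse of [h]. *)
Lemma bernstein_bijection {X Y : Type} (g : X -> Y) (h : Y -> X) :
  injective g -> injective h ->
  exists2 b : X -> Y, bijective b & forall x, b x = g x \/ h (b x) = x.
Proof.
move=> ig ih.
(* The forward orbits under $h\circ g$ of the points outside the range of [h]. On [C] the bijection
   is [g], elsewhere the inverse of [h]. *)
pose C x := exists n x0, (forall y, h y <> x0) /\ x = iter n (h \o g) x0.
have CS x : C x -> C (h (g x)).
  by move=> [n [x0 [nx ->]]]; exists n.+1, x0.
have /choice[b bP] : forall x, exists y, (C x -> y = g x) /\ (~ C x -> h y = x).
  move=> x; have [Cx|nCx] := pselect (C x); first by exists (g x).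
  have [y hy] : exists y, h y = x; last by exists y.
  apply: contrapT => ny; apply: nCx; exists 0%N, x; split=> // y hy.
  by apply: ny; exists y.
have bij_inj : injective b.
  move=> x x' bx; have [[b1 b2] [b1' b2']] := (bP x, bP x').
  have [Cx|nCx] := pselect (C x); have [Cx'|nCx'] := pselect (C x').
  - by apply: ig; rewrite -b1// -b1'.
  - by case: (nCx'); rewrite -(b2' nCx') -bx b1//; exact: CS.
  - by case: (nCx); rewrite -(b2 nCx) bx b1'//; exact: CS.
  - by rewrite -(b2 nCx) -(b2' nCx') bx.
have /choice[c cP] : forall y, exists x, b x = y.
  move=> y; have [Cy|nCy] := pselect (C (h y)); last first.
    by exists (h y); apply: ih; exact: (bP (h y)).2.
  case: (Cy) => -[[x0 [nx E]]|n [x0 [nx /ih ->]]]; first by case: (nx y).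
  by exists (iter n (h \o g) x0); apply: (bP _).1; exists n, x0.
exists b; first by exists c => // x; exact/bij_inj/cP.
move=> x; have [b1 b2] := bP x.
by have [/b1|/b2] := pselect (C x); [left|right].
Qed.

Section UniformRigidity.
Context {R : realType} {p : R} (p1 : 1 <= p).
Local Notation x := (ecoord (@unit_coord R)).
Local Notation pt := (fun z => (z, tt)).

Lemma unit_images_independent (X Y : metricType R) Phi Psi (f : X -> Y) (M : R) :
  bounded_geometry X -> bounded_geometry Y ->
  isometric_morphism (uniform_roe p1 X) (uniform_roe p1 Y) Phi ->
  isometric_morphism (uniform_roe p1 Y) (uniform_roe p1 X) Psi ->
  (forall T, uniform_roe p1 X T -> Psi (Phi T) = T) ->
  center_map x x fst pt Phi f M ->
  forall (F : seq X) (G : seq Y), uniq F ->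
    (forall z w, z \in F -> mdist (f z) w <= M -> w \in G) -> (size F <= size G)%N.
Proof.
move=> hX hY iPhi iPsi PhiK fM F G uF FG.
have cA := uniform_roe_controlled p1 hX; have cB := uniform_roe_controlled p1 hY.
have [sA _ muA] := cA; have [sB _ _] := cB.
have fx : frame p (ecoord (X := X) (p1 := p1) (@unit_coord R)).
  exact/(frame_ecoord p1)/frame_unit.
have fy : frame p (ecoord (X := Y) (p1 := p1) (@unit_coord R)).
  exact/(frame_ecoord p1)/frame_unit.
have [PhiB lPhi PhiM _] := iPhi; have [Bbd _ _ _] := sB.
have [->//|F0] := eqVneq F [::].
have [z0 z0F] : exists z0, z0 \in F.
  by case: F F0 {uF FG} => // z F _; exists z; rewrite mem_head.
have [a qa] := image_unit_detected p1 fy fx sB sA iPsi iPhi PhiK (muA (pt z0) _).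
have linPhi T : uniform_roe p1 X T -> linear (Phi T) by move=> /PhiB/Bbd[].
pose e z w : ellp p1 X R[i]^o -> ellp p1 X R[i]^o := munit x (pt z) (pt w).
pose u z := Phi (e z z0) (bvec x a).
(* A dual system: $\Phi(e_{z_0w})$ sends $u_w$ to $u_{z_0}\ne 0$ and kills the other $u_z$, so the
   $u_z$ are independent. *)
have eu z w : Phi (e z0 w) (u z) = (w == z)%:R *: u z0.
  rewrite /u -[LHS]/((Phi (e z0 w) \o Phi (e z z0)) (bvec x a)) -PhiM; try exact: muA.
  have -> : e z0 w \o e z z0 = (w == z)%:R *: e z0 z0.
    apply/funext => h; have [xl _ _] := fx.
    rewrite /= fctE /e /munit linZ// (bvecE p1 fx) xpair_eqE andbT.
    by rewrite [_ *: (_ == _)%:R]mulrC -scalerA.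
  by rewrite (morphismZ sA iPhi)//; exact: muA.
(* The coordinates outside [G] vanish, so a relation between the rows of this matrix is a relation
   between the vectors. *)
pose A := \matrix_(i < size F, j < size G)
  (x (pt (tnth (in_tuple G) j)) (u (tnth (in_tuple F) i)) : R[i]).
suff : row_free A by rewrite /row_free => /eqP <-; exact: rank_leq_col.
apply: inj_row_free => v vA; apply/rowP => k; rewrite [RHS]mxE.
pose h := \sum_i v 0 i *: u (tnth (in_tuple F) i).
have h0 : h = 0.
  apply: (frame_eq0 p1 fy) => -[w []]; have [yl _ _] := fy.
  rewrite (lin_sum _ _ _ (yl _)).
  have [wG|wG] := boolP (w \in G); last first.
    rewrite big1// => i _; rewrite linZ//.
    have [->|yu] := eqVneq (x (w, tt) (u (tnth (in_tuple F) i))) 0.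
      by rewrite scaler0.
    have := image_row_support p1 fx cA iPhi fM yu.
    by move=> /FG; rewrite (negbTE wG) => /(_ (mem_tnth _ _)).
  have jG : (index w G < size G)%N by rewrite index_mem.
  have /rowP/(_ (Ordinal jG)) := vA; rewrite mxE [RHS]mxE => vAj.
  rewrite -[RHS]vAj; apply: eq_bigr => i _; rewrite linZ// mxE.
  by rewrite (tnth_nth w) /= nth_index.
have := congr1 (Phi (e z0 (tnth (in_tuple F) k))) h0.
have lk : linear (Phi (e z0 (tnth (in_tuple F) k))) by apply: linPhi; exact: muA.
rewrite [RHS](lin0 lk) (lin_sum _ _ _ lk).
rewrite (bigD1 k)//= big1 ?addr0 => [|i ik].
  rewrite linZ// eu eqxx scale1r => /eqP; rewrite scaler_eq0 => /orP[/eqP//|].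
  by rewrite /u -/(e z0 z0) (negbTE qa).
rewrite linZ// eu (_ : _ == _ = false) ?scale0r ?scaler0//.
apply: contra_neqF ik => /eqP; rewrite !(tnth_nth z0) /= => /eqP.
by rewrite nth_uniq// => /eqP ki; apply/val_inj.
Qed.

Lemma center_map_injection (X Y : metricType R) Phi Psi (f : X -> Y) (M : R) :
  bounded_geometry X -> bounded_geometry Y ->
  isometric_morphism (uniform_roe p1 X) (uniform_roe p1 Y) Phi ->
  isometric_morphism (uniform_roe p1 Y) (uniform_roe p1 X) Psi ->
  (forall T, uniform_roe p1 X T -> Psi (Phi T) = T) ->
  center_map x x fst pt Phi f M ->
  exists2 g : X -> Y, injective g & forall z, mdist (f z) (g z) <= M.
Proof.
move=> hX hY iPhi iPsi PhiK fM.
have fB z := finite_ball hY (f z) M.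
have [F|g ig gP] := @marriage X Y (fun z => fset_set [set w | mdist (f z) w <= M]).
  apply: (unit_images_independent hX hY iPhi iPsi PhiK fM); first exact: fset_uniq.
  move=> z w zF zw; apply/bigfcupP; exists z; first by rewrite andbT.
  by rewrite in_fset_set// inE.
by exists g => // z; have := gP z; rewrite in_fset_set// inE.
Qed.

Lemma close_coarse_equivalence (X Y : metricType R) (f b : X -> Y) (g : Y -> X) (c : R) :
  uniformly_expansive f -> uniformly_expansive g ->
  close_maps (f \o g) id -> close_maps (g \o f) id ->
  (forall z, mdist (f z) (b z) <= c) -> coarse_equivalence b.
Proof.
move=> fe ge [d d0 fg] [e e0 gf] fb; split.
  move=> r r0; have [s s0 fs] := fe r r0.
  exists (s + `|c| + `|c|); first by rewrite !ltr_wpDr.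
  move=> z1 z2 /fs z12; have := metric_triangle (b z1) (f z1) (b z2).
  have := metric_triangle (f z1) (f z2) (b z2); have := fb z1; have := fb z2.
  rewrite (metric_sym (f z1) (b z1)); have := ler_norm c; lra.
exists g; split=> //.
  exists (d + `|c|); first by rewrite ltr_wpDr.
  move=> w /=; have := metric_triangle (b (g w)) (f (g w)) w.
  have := fg w; have := fb (g w); rewrite (metric_sym (f (g w)) (b (g w))) /=.
  by have := ler_norm c; lra.
have [s s0 gs] := ge (`|c| + 1) ltac:(by rewrite ltr_wpDl).
exists (e + s); first by rewrite addr_gt0.
move=> z /=; have := metric_triangle (g (b z)) (g (f z)) z.
have := gs (f z) (b z) ltac:(by apply: le_trans (fb z) _; have := ler_norm c; lra).
by have := gf z; rewrite /= (metric_sym (g (f z)) (g (b z))); lra.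
Qed.

Lemma uniform_rigidity (X Y : metricType R) :
  bounded_geometry X -> bounded_geometry Y ->
  isometrically_isomorphic (uniform_roe p1 X) (uniform_roe p1 Y) ->
  bijectively_coarsely_equivalent X Y.
Proof.
move=> hX hY AB.
have cA := uniform_roe_controlled p1 hX; have cB := uniform_roe_controlled p1 hY.
have [sA _ muA] := cA; have [sB _ muB] := cB.
have [Phi [Psi [iPhi iPsi PhiK PsiK]]] := isometric_inverse sA sB AB.
have fx : frame p (ecoord (X := X) (p1 := p1) (@unit_coord R)).
  exact/(frame_ecoord p1)/frame_unit.
have fy : frame p (ecoord (X := Y) (p1 := p1) (@unit_coord R)).
  exact/(frame_ecoord p1)/frame_unit.
have [//|//|//|//|w|z|f [g [M [N [fM gN fe ge [fg gf]]]]]] := center_maps_exist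
  (baseX := pt) (baseY := pt) p1 fx fy _ _ hX hY cA cB
  (uniform_roe_rows p1 (X := X)) (uniform_roe_rows p1 (X := Y))
  _ _ iPhi iPsi PhiK PsiK _ _.
- have [a ?] := image_unit_detected p1 fx fy sA sB iPhi iPsi PsiK (muB (pt w) _).
  by exists a.
- have [a ?] := image_unit_detected p1 fy fx sB sA iPsi iPhi PhiK (muA (pt z) _).
  by exists a.
have [b ib fb] := center_map_injection hX hY iPhi iPsi PhiK fM.
have [c ic gc] := center_map_injection hY hX iPsi iPhi PsiK gN.
have [h bh hP] := bernstein_bijection ib ic.
exists h; split=> //; have [d d0 fgd] := fg.
have [s s0 fs] := fe (`|N| + 1) ltac:(by rewrite ltr_wpDl).
apply: (close_coarse_equivalence (c := `|M| + s + d) fe ge fg gf) => z.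
have [->|hz] := hP z.
  by apply: le_trans (fb z) _; have := ler_norm M; lra.
(* Here [z = c (h z)], and [c] is close to [g]; thus [f z] is close to [f (g (h z))], hence to
   [h z]. *)
rewrite -[in f z]hz; have := metric_triangle (f (c (h z))) (f (g (h z))) (h z).
have : mdist (f (c (h z))) (f (g (h z))) <= s.
  by apply: fs; rewrite metric_sym; apply: le_trans (gc _) _; have := ler_norm N; lra.
by have := fgd (h z); rewrite /=; have := normr_ge0 M; lra.
Qed.

End UniformRigidity.

(** * Conjugation by isometries *)

Section Conjugation.
Context {R : realType} {H K : normedModType R[i]}.
Context (U : H -> K) (V : K -> H).
Hypotheses (lU : linear U) (UK : cancel U V) (VK : cancel V U).
Hypothesis nU : forall h, rnorm (U h) = rnorm h.

Lemma conj_norm (T : H -> H) (M : R) : (forall h, rnorm (T h) <= M * rnorm h) ->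
  forall k, rnorm ((U \o T \o V) k) <= M * rnorm k.
Proof.
by move=> TM k; rewrite /= nU; apply: le_trans (TM _) _; rewrite -(nU (V k)) VK.
Qed.

Lemma inverse_linear : linear V.
Proof. by move=> a u v; rewrite -[LHS]UK -[RHS]UK; congr V; rewrite VK lU !VK. Qed.

Lemma inverse_norm k : rnorm (V k) = rnorm k.
Proof. by rewrite -nU VK. Qed.

Lemma conj_bounded (T : H -> H) : bounded_op T -> bounded_op (U \o T \o V).
Proof.
move=> [lT [M TM]]; split; last by exists M; exact: conj_norm.
by apply: lin_comp inverse_linear; exact: lin_comp.
Qed.

End Conjugation.

Lemma conj_isometric {R : realType} {H K : normedModType R[i]}
    (U : H -> K) (V : K -> H) (A : set (H -> H)) (B : set (K -> K)) :
  linear U -> cancel U V -> cancel V U -> (forall h, rnorm (U h) = rnorm h) ->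
  A `<=` bounded_op -> (forall T, A T -> B (U \o T \o V)) ->
  (forall S, B S -> A (V \o S \o U)) -> isometrically_isomorphic A B.
Proof.
move=> lU UK VK nU bA AB BA; exists (fun T => U \o T \o V).
have nV := inverse_norm VK nU.
split; first split.
- by move=> T /AB.
- move=> S T _ _ /(congr1 (fun Q => V \o Q \o U)) ST; apply/funext => h.
  by have := congr1 (fun Q => Q h) ST; rewrite /= !UK.
- move=> S BS; exists (V \o S \o U); first exact: BA.
  by apply/funext => k /=; rewrite !VK.
- by move=> a S T _ _; apply/funext => k; exact: lU.
- by move=> S T _ _; apply/funext => k /=; rewrite UK.
- move=> T AT; have bT := bA _ AT; have bT' := conj_bounded lU UK VK nU bT.
  apply/eqP; rewrite eq_le !opnorm_le ?opnorm_ge0// => h.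
    have -> : T h = (V \o (U \o T \o V) \o U) h by rewrite /= !UK.
    rewrite -[V]/(V) /= nV -[X in _ <= _ * X]nU; exact: (opnorm_bound (U h) bT').
  by apply: (conj_norm VK nU) => g; exact: opnorm_bound.
Qed.

Lemma reindex_isometry {R : realType} {p : R} (p1 : 1 <= p)
    {H K : normedModType R[i]} {I J : choiceType}
    (x : I -> H -> R[i]^o) (y : J -> K -> R[i]^o) (e : I -> J) (e' : J -> I) :
  frame p x -> frame p y -> cancel e e' -> cancel e' e ->
  exists U V, [/\ linear U, cancel U V, cancel V U, forall h, rnorm (U h) = rnorm h
    & (forall h j, y j (U h) = x (e' j) h) /\ (forall k i, x i (V k) = y (e i) k)].
Proof.
move=> fx fy ee' e'e; have [xl xn xs] := fx; have [yl yn ys] := fy.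
have [U UE] : exists U, forall h j, y j (U h) = x (e' j) h.
  have /choice[U UE] : forall h, exists k, forall j, y j k = x (e' j) h.
    move=> h; apply: (ys (fun j => x (e' j) h)).
    by rewrite (psum_bij p (fun i => rnorm (x i h)) e'e ee') xn ltry.
  by exists U.
have [V VE] : exists V, forall k i, x i (V k) = y (e i) k.
  have /choice[V VE] : forall k, exists h, forall i, x i h = y (e i) k.
    move=> k; apply: (xs (fun i => y (e i) k)).
    by rewrite (psum_bij p (fun i => rnorm (y i k)) ee' e'e) yn ltry.
  by exists V.
exists U, V; split=> //.
- by move=> a u v; apply: (frame_inj p1 fy) => j; rewrite yl !UE xl.
- by move=> h; apply: (frame_inj p1 fx) => i; rewrite VE UE ee'.
- by move=> h; apply: (frame_inj p1 fy) => i; rewrite UE VE e'e.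
- move=> h; apply: (powR_inj p1); rewrite ?rnorm_ge0//.
  have := yn (U h); under eq_fun do rewrite UE.
  by rewrite (psum_bij p (fun i => rnorm (x i h)) e'e ee') xn => -[].
Qed.

Section BijectiveEquivalence.
Context {R : realType} {p : R} (p1 : 1 <= p) (X Y : metricType R).

Lemma conj_uniform (b : X -> Y) (c : Y -> X)
    (U : ellp p1 X R[i]^o -> ellp p1 Y R[i]^o) (V : ellp p1 Y R[i]^o -> ellp p1 X R[i]^o) :
  cancel b c -> cancel c b -> uniformly_expansive b ->
  linear U -> cancel U V -> cancel V U -> (forall h, rnorm (U h) = rnorm h) ->
  (forall f y, U f y = f (c y)) -> (forall f z, V f z = f (b z)) ->
  forall T, uniform_roe p1 X T -> uniform_roe p1 Y (U \o T \o V).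
Proof.
move=> bc cb be lU UK VK nU UE VE T [bT /finite_propagationP[N TN]].
split; first exact: conj_bounded.
have [s s0 bs] := be (`|N| + 1) ltac:(by rewrite ltr_wpDl).
apply/finite_propagationP; exists s => y y' v yy'.
rewrite /= UE; have -> : V (delta y' v) = delta (c y') v.
  apply: ellp_eq => z; rewrite VE !deltaE.
  by rewrite (can2_eq bc cb).
apply: TN; rewrite ltNge; apply/negP => cN.
have : mdist (b (c y)) (b (c y')) <= s.
  by apply: bs; have := ler_norm N; lra.
by rewrite !cb leNgt yy'.
Qed.

End BijectiveEquivalence.

Lemma uniform_roe_isometric {R : realType} {p : R} (p1 : 1 <= p) (X Y : metricType R) :
  bijectively_coarsely_equivalent X Y ->
  isometrically_isomorphic (uniform_roe p1 X) (uniform_roe p1 Y).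
Proof.
move=> [b [[c bc cb] [be [g [ge _ [d d0 gb]]]]]].
(* [c] is the inverse of [b], [g] only a coarse inverse. As [g (b (c y)) = g y] is within [d] of
   [c y], expansiveness passes from [g] to [c]. *)
have ce : uniformly_expansive c.
  move=> r r0; have [s s0 gs] := ge r r0; exists (s + d + d); first by rewrite !ltr_wpDr// ltW.
  move=> y1 y2 /gs y12; have := metric_triangle (c y1) (g y1) (c y2).
  have := metric_triangle (g y1) (g y2) (c y2).
  have := gb (c y1); have := gb (c y2); rewrite /= !cb (metric_sym (g y1) (c y1)); lra.
have [U [V [lU UK VK nU [UE VE]]]] := reindex_isometry p1
  (frame_ellp_scalar p1 X) (frame_ellp_scalar p1 Y) bc cb.
apply: (conj_isometric lU UK VK nU).
- by move=> T [].
- exact: (conj_uniform bc cb be lU UK VK nU UE VE).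
- exact: (conj_uniform cb bc ce (inverse_linear lU UK VK) VK UK (inverse_norm VK nU) VE UE).
Qed.

(** * Corner operators and the closure of finite matrices *)

Section Blocks.
Context {R : realType} {p : R} (p1 : 1 <= p).
Local Notation C := (R[i]^o).
Local Notation ellpN := (ellp p1 nat C).
Local Notation xi := (@seq_coord _ _ p1 nat).
Local Notation e_ j := (delta (j : nat) (1 : C) : ellpN).

(** The operators of the upper left [n] by [n] corner, described by supports so that sums and
    products with shifts need no matrix computation. *)
Definition corner_op (F : ellpN -> ellpN) : Prop := exists n, [/\ linear F,
  forall (v : ellpN) k, (n <= k)%N -> F v k = 0
  & forall v : ellpN, (forall j, (j < n)%N -> v j = 0) -> F v = 0].

Lemma mx_op_corner n (A : 'M[R[i]]_n) : corner_op (mx_op (p1 := p1) A).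
Proof.
exists n; split.
- move=> a u v; rewrite /mx_op scaler_sumr -big_split /=; apply: eq_bigr => i _.
  rewrite -(delta_lin p1 (i : nat)); congr delta.
  rewrite scaler_sumr -big_split /=; apply: eq_bigr => j _.
  by rewrite mulrDr /GRing.scale /= mulrCA.
- move=> v k nk; rewrite /mx_op ellp_sumE big1// => i _; rewrite deltaE ifN//.
  by apply: contraTneq nk => ->; rewrite -ltnNge ltn_ord.
- move=> v v0; rewrite /mx_op big1// => i _; rewrite big1 ?(lin0 (delta_lin p1 _))//.
  by move=> j _; rewrite v0 ?mulr0// ltn_ord.
Qed.

Lemma corner_mx_op F : corner_op F -> exists n (A : 'M[R[i]]_n), F = mx_op A.
Proof.
move=> [n [lF Fn F0]]; exists n, (\matrix_(i, j) F (e_ j) i).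
apply/funext => v.
have -> : F v = \sum_(j < n) v j *: F (e_ j).
  rewrite -[v in LHS](subrK (\sum_(j < n) v j *: e_ j)).
  rewrite (linD _ _ lF) F0 ?add0r ?(lin_sum _ _ _ lF).
    by apply: eq_bigr => j _; rewrite linZ.
  move=> j jn; rewrite -[LHS]/(v j - (\sum_(j < n) v j *: e_ j : ellpN) j).
  rewrite ellp_sumE (bigD1 (Ordinal jn))// big1 ?addr0.
    rewrite -[X in _ - X]/(v j *: (if j == j then 1 else 0 : C) + 0) addr0 eqxx.
    by rewrite [_ *: 1]mulr1 subrr.
  move=> i ij; rewrite -[LHS]/(v i *: e_ i j) deltaE ifN ?scaler0//.
  by apply: contra_neqN ij => /eqP ji; apply/val_inj.
apply: ellp_eq => k; rewrite /mx_op !ellp_sumE.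
have [kn|nk] := ltnP k n; last first.
  rewrite !big1// => i _.
    by rewrite deltaE ifN//; apply: contraTneq nk => ->; rewrite -ltnNge ltn_ord.
  by rewrite -[LHS]/(v i *: F _ k) Fn// scaler0.
rewrite [RHS](bigD1 (Ordinal kn))//= eqxx [X in _ = _ + X]big1 ?addr0 => [|i ik].
  by apply: eq_bigr => j _; rewrite mxE mulrC.
rewrite ifN//; apply: contra_neqN ik => /eqP ki; exact/val_inj.
Qed.

Lemma corner_bounded F : corner_op F -> bounded_op F.
Proof.
move=> /corner_mx_op[n [A ->]].
apply: bounded_op_sum => i _.
apply: (@bounded_op_comp _ _ _ _ (delta (i : nat))
  (fun v : ellpN => (\sum_j A i j * v j : C)) (delta_bounded p1 (i : nat))).
apply: bounded_op_sum => j _.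
have bj : bounded_op (xi (j : nat)) by exact: (frame_bounded p1 (frame_seq p1 nat)).
have := bounded_op_lincomb (A i j) bj bounded_op0; rewrite addr0.
exact.
Qed.

Lemma M_inftyP (T : ellpN -> ellpN) : M_infty T <-> bounded_op T /\ forall e : R, 0 < e ->
  exists2 F, corner_op F & forall v, rnorm (T v - F v) <= e * rnorm v.
Proof.
have bTF T' F : bounded_op T' -> corner_op F -> bounded_op (T' - F).
  move=> bT' /corner_bounded bF; rewrite addrC -scaleN1r.
  exact: bounded_op_lincomb.
split=> -[bT TA]; split=> // e e0.
  have [n [A TAe]] := TA e e0; exists (mx_op A); first exact: mx_op_corner.
  move=> v; have := opnorm_bound v (bTF _ _ bT (mx_op_corner A)) => /le_trans; apply.
  by rewrite ler_wpM2r ?rnorm_ge0// ltW.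
(* Half of [e], because a bound on vectors gives only a weak inequality for [opnorm]. *)
have [F cF TF] := TA (e / 2) ltac:(by rewrite divr_gt0).
have [n [A FA]] := corner_mx_op cF; exists n, A; rewrite -FA.
apply: (@le_lt_trans _ _ (e / 2)); last by lra.
by apply: opnorm_le => //; rewrite divr_ge0// ltW.
Qed.

Lemma M_infty0 : M_infty (0 : ellpN -> ellpN).
Proof.
apply/M_inftyP; split=> [|e e0]; first exact: bounded_op0.
exists 0; first by exists 0%N; split=> // a u v; rewrite -[RHS]/(a *: 0 + 0 : ellpN) scaler0 addr0.
by move=> v; rewrite subrr rnorm0 mulr_ge0 ?rnorm_ge0// ltW.
Qed.

Lemma corner_add F G : corner_op F -> corner_op G -> corner_op (F + G).
Proof.
move=> [m [lF Fm F0]] [n [lG Gn G0]]; exists (maxn m n); split.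
- by move=> a u v; rewrite -[LHS]/(F _ + G _) lF lG addrACA -scalerDr.
- move=> v k; rewrite geq_max => /andP[mk nk].
  by rewrite -[LHS]/(F v k + G v k) Fm// Gn// addr0.
- move=> v v0; rewrite -[LHS]/(F v + G v) F0 ?G0 ?addr0// => j jn; apply: v0.
    by rewrite leq_max jn orbT.
  by rewrite leq_max jn.
Qed.

Lemma M_infty_add (S T : ellpN -> ellpN) : M_infty S -> M_infty T -> M_infty (S + T).
Proof.
move=> /M_inftyP[bS SF] /M_inftyP[bT TF]; apply/M_inftyP; split.
  by have := bounded_op_lincomb 1 bS bT; rewrite scale1r.
move=> e e0; have e20 : 0 < e / 2 by rewrite divr_gt0.
have [F cF SFe] := SF _ e20; have [G cG TGe] := TF _ e20.
exists (F + G); first exact: corner_add.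
move=> v; rewrite -[(F + G) v]/(F v + G v) -[(S + T) v]/(S v + T v) opprD addrACA.
apply: le_trans (rnormD _ _) _; apply: le_trans (lerD (SFe v) (TGe v)) _.
by rewrite -mulrDl -splitr.
Qed.

Lemma M_infty_sum (I : Type) (r : seq I) (T : I -> ellpN -> ellpN) :
  (forall i, M_infty (T i)) -> M_infty (\sum_(i <- r) T i).
Proof.
move=> MT; elim: r => [|i r IH]; first by rewrite big_nil; exact: M_infty0.
by rewrite big_cons; apply: (M_infty_add (MT i) IH).
Qed.

(** [B] copies coordinate [s m] to place [m]. By the last clause the first [n] coordinates are
    copied to finitely many places only, so [B] keeps the range of a corner operator inside a
    corner. *)
Definition shift_op (B : ellpN -> ellpN) : Prop := bounded_op B /\
  exists s : nat -> option nat,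
    (forall v m, B v m = if s m is Some j then v j else 0) /\
    (forall n, exists n', forall m j, s m = Some j -> (j < n)%N -> (m < n')%N).

Lemma M_infty_shift (B B' T : ellpN -> ellpN) : shift_op B -> shift_op B' -> M_infty T ->
  M_infty (B \o T \o B').
Proof.
move=> [bB [s [sB sf]]] [bB' [s' [sB' _]]] /M_inftyP[bT TF].
apply/M_inftyP; split; first exact: bounded_op_comp (bounded_op_comp bB bT) bB'.
move=> e e0; have [M M0 BM] := bounded_op_bound bB.
have [M' M0' BM'] := bounded_op_bound bB'.
have MM0 : 0 < M * M' + 1 by rewrite ltr_wpDl// mulr_ge0.
have [F cF TFe] := TF (e / (M * M' + 1)) ltac:(by rewrite divr_gt0).
have [n [lF Fn F0]] := cF.
exists (B \o F \o B').
  (* [n1] bounds the places that [B] fills from the first [n] coordinates, [n2] the coordinates from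
     which [B'] fills its first [n] places. *)
  have [n1 n1P] := sf n.
  pose n2 := (\max_(m < n) (if s' m is Some j then j.+1 else 0))%N.
  exists (maxn n1 n2); split.
  - by apply: lin_comp bB'.1; apply: lin_comp => //; exact: bB.1.
  - move=> v k; rewrite geq_max => /andP[nk _] /=; rewrite sB.
    case E : (s k) => [j|//]; apply: Fn; rewrite leqNgt; apply/negP => jn.
    by have := n1P _ _ E jn; rewrite ltnNge nk.
  - move=> v v0 /=; rewrite (F0 (B' v)) ?(lin0 bB.1)// => j jn; rewrite sB'.
    case E : (s' j) => [i|//]; apply: v0; rewrite leq_max; apply/orP; right.
    have := leq_bigmax (F := fun m : 'I_n => (if s' m is Some j then j.+1 else 0)%N) (Ordinal jn).
    by rewrite /= E.
move=> v /=; rewrite -(linB _ _ bB.1); apply: le_trans (BM _) _.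
apply: le_trans (ler_wpM2l M0 (TFe _)) _.
apply: le_trans (ler_wpM2l M0 (ler_wpM2l _ (BM' v))) _; first by rewrite divr_ge0 ?ltW.
have -> : M * (e / (M * M' + 1) * (M' * rnorm v)) =
  e * rnorm v * (M * M' / (M * M' + 1)) by field; rewrite gt_eqF.
rewrite ler_piMr ?mulr_ge0 ?rnorm_ge0 ?(ltW e0)//.
by rewrite ler_pdivrMr// mul1r lerDl.
Qed.

End Blocks.

(** * Conjugation along a coupling of X * nat and Y * nat *)

Section ShiftBlocks.
Context {R : realType} {p : R} {p1 : 1 <= p} {A B : choiceType}.
Local Notation C := (R[i]^o).
Local Notation ellpN := (ellp p1 nat C).
Context (k : B * nat -> A * nat) (k' : A * nat -> B * nat).
Hypotheses (kK : cancel k k') (k'K : cancel k' k).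
Context (W : ellp p1 A ellpN -> ellp p1 B ellpN).
Hypothesis bW : bounded_op W.
Hypothesis WE : forall f b m, W f b m = f (k (b, m)).1 (k (b, m)).2.

Definition block (b : B) (a : A) : ellpN -> ellpN := fun v => W (delta a v) b.

(** The combinatorial pattern of a block. It determines the block, so finitely many patterns mean
    finitely many operators. *)
Definition block_shift (b : B) (a : A) : nat -> option nat := fun m =>
  if (k (b, m)).1 == a then Some (k (b, m)).2 else None.

Lemma blockE b a v m : block b a v m = if block_shift b a m is Some j then v j else 0.
Proof.
by rewrite /block WE deltaE /block_shift; case: eqP.
Qed.

Lemma block_bounded b a : bounded_op (block b a).
Proof.
have bc : bounded_op (fun f : ellp p1 B ellpN => f b).
  by split => //; exists 1 => f; rewrite mul1r ellp_coord_le.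
exact: (bounded_op_comp bc (bounded_op_comp bW (delta_bounded p1 a))).
Qed.

Lemma block_shift_op b a : shift_op (block b a).
Proof.
split; first exact: block_bounded.
exists (block_shift b a); split=> [v m|n]; first exact: blockE.
(* By injectivity of [k], each of the [n] pairs over [a] is copied to one place only, which [k']
   computes. *)
exists (\max_(j < n) (k' (a, j : nat)).2.+1)%N => m j.
rewrite /block_shift; case: eqP => // ka [kj] jn.
have kbm : k' (a, j) = (b, m) by rewrite -ka -kj -surjective_pairing kK.
have := leq_bigmax (F := fun j : 'I_n => (k' (a, j : nat)).2.+1) (Ordinal jn).
by rewrite /= kbm.
Qed.

Lemma block_row (F : seq A) b f : uniq F -> (forall m, (k (b, m)).1 \in F) ->
  W f b = \sum_(a <- F) block b a (f a).
Proof.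
move=> uF kF; apply: ellp_eq => m; rewrite WE ellp_sumE.
rewrite (bigD1_seq (k (b, m)).1)//= blockE /block_shift eqxx big1 ?addr0// => a ak.
by rewrite blockE /block_shift eq_sym (negbTE ak).
Qed.

Lemma block_column (G : seq B) a v : uniq G -> (forall n, (k' (a, n)).1 \in G) ->
  W (delta a v) = \sum_(b <- G) delta b (block b a v).
Proof.
move=> uG kG; apply: ellp_finite_support => // b bG.
apply: ellp_eq => m; rewrite WE deltaE; case: eqP => // ka.
have := kG (k (b, m)).2; rewrite -ka -surjective_pairing kK /=.
by rewrite (negbTE bG).
Qed.

Lemma finitely_many_blocks :
  finite_set (range (fun ba : B * A => block_shift ba.1 ba.2)) ->
  exists n (T : nat -> ellpN -> ellpN), (forall i, bounded_op (T i)) /\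
    forall b a, exists2 i, (i < n)%N & block b a = T i.
Proof.
move=> /finite_seqP[s sE]; exists (size s).
have /choice[T TP] : forall i, exists T : ellpN -> ellpN, bounded_op T /\
    forall b a, (i < size s)%N -> block_shift b a = nth (fun=> None) s i -> block b a = T.
  move=> i; have [[b [a [si ba]]]|none] := pselect (exists b a, (i < size s)%N /\
      block_shift b a = nth (fun=> None) s i); last first.
    exists 0; split=> [|b a si ba]; first exact: bounded_op0.
    by case: none; exists b, a.
  exists (block b a); split=> [|c d _ cd]; first exact: block_bounded.
  apply/funext => v; apply: ellp_eq => m.
  by rewrite !blockE ba cd.
exists T; split=> [i|b a]; first by have [] := TP i.
have : block_shift b a \in s.
  suff : [set` s]%classic (block_shift b a) by [].
  by rewrite -sE; exists (b, a).
move=> bs; exists (index (block_shift b a) s); first by rewrite index_mem.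
by have [_] := TP (index (block_shift b a) s); apply; rewrite ?index_mem// nth_index.
Qed.

End ShiftBlocks.

Definition fiberwise_expansive {R : realType} {X Y : metricType R}
    (h : X * nat -> Y * nat) : Prop :=
  forall r, exists s : R, forall a b, mdist a.1 b.1 <= r -> mdist (h a).1 (h b).1 <= s.

Section Coupling.
Context {R : realType} {p : R} (p1 : 1 <= p) (X Y : metricType R).
Local Notation C := (R[i]^o).
Local Notation ellpN := (ellp p1 nat C).
Hypotheses (hX : bounded_geometry X).
Context (h : X * nat -> Y * nat) (h' : Y * nat -> X * nat).
Hypotheses (hK : cancel h h') (h'K : cancel h' h).
Hypotheses (hexp : fiberwise_expansive h) (h'exp : fiberwise_expansive h').
Context (U : ellp p1 X ellpN -> ellp p1 Y ellpN) (V : ellp p1 Y ellpN -> ellp p1 X ellpN).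
Hypotheses (lU : linear U) (UK : cancel U V) (VK : cancel V U).
Hypothesis nU : forall f, rnorm (U f) = rnorm f.
Hypothesis UE : forall f y m, U f y m = f (h' (y, m)).1 (h' (y, m)).2.
Hypothesis VE : forall f z m, V f z m = f (h (z, m)).1 (h (z, m)).2.
Implicit Type T : ellp p1 X ellpN -> ellp p1 X ellpN.

Let bU : bounded_op U.
Proof. by split=> //; exists 1 => f; rewrite mul1r nU. Qed.
Let bV : bounded_op V.
Proof.
split; first exact: inverse_linear lU UK VK.
by exists 1 => f; rewrite mul1r (inverse_norm VK nU).
Qed.

(** Expansiveness of [h'] at distance [0]: the fibre over [y] is sent over one ball of fixed radius,
    hence over at most [N] points. *)
Lemma fiber_seq : exists (N : nat) (s : R) (F : Y -> seq X), forall y,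
  [/\ uniq (F y), (size (F y) <= N)%N, forall m, (h' (y, m)).1 \in F y
    & forall z, z \in F y -> mdist (h' (y, 0%N)).1 z <= s].
Proof.
have [s hs] := h'exp 0.
have [N NP] := hX (normr_ge0 s).
pose B y := [set z | mdist (h' (y, 0%N)).1 z <= `|s|].
have fB y : finite_set (B y) by exact: finite_ball.
exists N, `|s|, (fun y => fset_set (B y)) => y; split.
- exact: fset_uniq.
- by apply: geq_card_fset_set; exact: NP.
- move=> m; rewrite in_fset_set// inE /B /=; apply: le_trans (ler_norm s).
  by apply: hs; rewrite mdistxx.
- by move=> z; rewrite in_fset_set// inE.
Qed.

Lemma entry_conj (F : Y -> seq X) T y y' v : bounded_op T ->
  (forall y, uniq (F y)) -> (forall y m, (h' (y, m)).1 \in F y) ->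
  entry (U \o T \o V) y y' v =
  \sum_(z <- F y) \sum_(z' <- F y') block U y z (entry T z z' (block V z' y' v)).
Proof.
move=> bT uF hF; rewrite {1}/entry /=.
rewrite (block_row UE _ (uF y) (hF y)); apply: eq_bigr => z _.
rewrite (block_column hK VE v (uF y') (hF y')) (lin_sum _ _ _ bT.1).
rewrite ellp_sumE (lin_sum _ _ _ (block_bounded bU y z).1).
by [].
Qed.

Lemma conj_finite_propagation T : bounded_op T -> finite_propagation T ->
  finite_propagation (U \o T \o V).
Proof.
move=> bT /finite_propagationP[N TN]; have [N0 [s [F FP]]] := fiber_seq.
have [r hr] := hexp (s + N + s).
apply/finite_propagationP; exists r => y y' v ryy'.
rewrite -/(entry _ _ _ _) (entry_conj (F := F))//; try by move=> w; have [] := FP w.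
rewrite big_seq big1// => z zF; rewrite big_seq big1// => z' zF'.
rewrite /entry TN ?(lin0 (block_bounded bU y z).1)//.
rewrite ltNge; apply/negP => zz'.
have := hr (h' (y, 0%N)) (h' (y', 0%N)); rewrite !h'K /= => yy'.
move: ryy'; rewrite ltNge => /negP; apply; apply: yy'.
have [_ _ _ /(_ _ zF) yz] := FP y; have [_ _ _ /(_ _ zF') yz'] := FP y'.
have := metric_triangle (h' (y, 0%N)).1 z (h' (y', 0%N)).1.
have := metric_triangle z z' (h' (y', 0%N)).1.
by rewrite (metric_sym z' (h' (y', 0%N)).1); lra.
Qed.

Lemma conj_U_roe T : U_roe p1 X T -> U_roe p1 Y (U \o T \o V).
Proof.
move=> [bT fT [N TN]]; have bUTV := conj_bounded lU UK VK nU bT.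
split=> //; first exact: conj_finite_propagation.
(* At most [M] points of [X] correspond to each of [y] and [y'], and each of the resulting terms has
   rank at most [N]. *)
have [M [s [F FP]]] := fiber_seq; exists (M * (M * N))%N => y y'.
have [n nN span] : exists2 n, (n <= size (F y) * (M * N))%N &
    spanned_by (entry (U \o T \o V) y y') n.
  have [|n nN [e eP]] := @spanned_sum _ _ ellpN X (F y) (fun z v =>
    \sum_(z' <- F y') block U y z (entry T z z' (block V z' y' v))) (M * N)%N.
    move=> z; have [|m mN mP] := @spanned_sum _ _ ellpN X (F y') (fun z' v =>
      block U y z (entry T z z' (block V z' y' v))) N.
      move=> z'; have [m mN [e eP]] := rank_le_spanned (TN z z').
      exists m => //; apply: spanned_comp (block_bounded bU y z).1 _.
      by exists e => v; exact: eP.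
    exists m => //; apply: leq_trans mN _; rewrite leq_mul2r.
    by have [_ -> _ _] := FP y'; rewrite orbT.
  exists n => //; exists e => v; rewrite (entry_conj (F := F))//; first exact: eP.
    by move=> w; have [] := FP w.
  by move=> w; have [] := FP w.
apply: (spanned_rank_le _ span); first exact: (entry_bounded y y' bUTV).1.
apply: leq_trans nN _; rewrite leq_mul2r.
by have [_ -> _ _] := FP y; rewrite orbT.
Qed.

Lemma conj_roe T : roe p1 X T -> roe p1 Y (U \o T \o V).
Proof.
move=> [bT fT MT]; have bUTV := conj_bounded lU UK VK nU bT.
split=> //; first exact: conj_finite_propagation.
have [M [s [F FP]]] := fiber_seq => y y'.
have -> : entry (U \o T \o V) y y' = \sum_(z <- F y) \sum_(z' <- F y')
    (block U y z \o entry T z z' \o block V z' y').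
  apply/funext => v; rewrite (entry_conj (F := F))//; try by move=> w; have [] := FP w.
  by rewrite fct_sumE; apply: eq_bigr => z _; rewrite fct_sumE.
apply: M_infty_sum => z; apply: M_infty_sum => z'.
apply: (M_infty_shift _ _ (MT z z')).
  exact: (block_shift_op h'K bU UE).
exact: (block_shift_op hK bV VE).
Qed.

Hypothesis finU : finite_set (range (fun yz : Y * X => block_shift h' yz.1 yz.2)).
Hypothesis finV : finite_set (range (fun zy : X * Y => block_shift h zy.1 zy.2)).

Lemma conj_stable_roe T : stable_roe p1 X T -> stable_roe p1 Y (U \o T \o V).
Proof.
move=> /stable_roeP[bT fT [P [[fP PP] PT]]]; apply/stable_roeP.
split; [exact: conj_bounded|exact: conj_finite_propagation|].
have [n [S [bS SP]]] := finitely_many_blocks bU UE finU.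
have [n' [S' [bS' SP']]] := finitely_many_blocks bV VE finV.
have fE := frame_seq p1 nat.
(* Each summand of an entry is $(S_iP)\,t\,(PS'_j)$ with $t$ an entry of [T]. A local unit for these
   finitely many outer factors absorbs all summands. *)
have fSP i : finite_rank_op (S i \o P).
  case: fP => bP [N NP]; split; first exact: (bounded_op_comp (bS i) bP).
  by exists N; exact: spanned_comp (bS i).1 NP.
have fPS i : finite_rank_op (P \o S' i).
  case: fP => bP [N [e NP]]; split; first exact: (bounded_op_comp bP (bS' i)).
  by exists N, e => v; exact: NP.
have [Q1 [fQ1 Q1P]] := local_unit_family p1 fE n fSP.
have [Q2 [fQ2 Q2P]] := local_unit_family p1 fE n' fPS.
have [Q [fQ QQ1 Q1Q QQ2 Q2Q]] := local_unit2 p1 fE fQ1.1 fQ2.1.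
have lQ : linear Q by case: fQ => -[[]].
exists Q; split=> // y y' v.
have [M [s [F FP]]] := fiber_seq.
have eE u : entry (U \o T \o V) y y' u =
  \sum_(z <- F y) \sum_(z' <- F y') block U y z (entry T z z' (block V z' y' u)).
  by apply: entry_conj => // w; have [] := FP w.
rewrite !eE (lin_sum _ _ _ lQ); apply: eq_bigr => z _.
rewrite (lin_sum _ _ _ lQ); apply: eq_bigr => z' _.
have [i ilt ->] := SP y z; have [j jlt ->] := SP' z' y'.
rewrite -[in RHS]PT -[in LHS]PT.
have -> : P (S' j (Q v)) = P (S' j v).
  have [_ PQ2] := Q2P j jlt.
  rewrite -[LHS]/((P \o S' j) (Q v)) -PQ2 -[LHS]/((P \o S' j) ((Q2 \o Q) v)) Q2Q.
  by rewrite -[LHS]/((P \o S' j \o Q2) v) PQ2.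
set w := entry _ _ _ _.
have [Q1S _] := Q1P i ilt.
rewrite -[RHS]/((S i \o P) w) -Q1S -QQ1.
by rewrite -[RHS]/(Q ((Q1 \o (S i \o P)) w)) Q1S.
Qed.

End Coupling.

(** * Couplings from coarse equivalences *)

Section FiberExchange.
Context {A B Z : choiceType} (phi : A -> Z) (psi : B -> Z).
Context (FA : Z -> seq A) (FB : Z -> seq B) (dA : B -> A) (dB : A -> B).
Hypotheses (uFA : forall z, uniq (FA z)) (uFB : forall z, uniq (FB z)).
Hypotheses (FAP : forall z a, (a \in FA z) = (phi a == z)).
Hypotheses (FBP : forall z b, (b \in FB z) = (psi b == z)).

(* The fiber [FA z] has size [s], so [FA z * nat] is enumerated by [nat] via
   [(a, n) |-> n * s + index a]; composing with the inverse of the enumeration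
   of [FB z * nat] exchanges the two. The value [dB a] is never used when
   [FB (phi a)] is nonempty. *)
Definition exchange (k : A * nat) : B * nat :=
  let z := phi k.1 in
  let q := (k.2 * size (FA z) + index k.1 (FA z))%N in
  (nth (dB k.1) (FB z) (q %% size (FB z)), (q %/ size (FB z))%N).

Hypothesis FB0 : forall a, FB (phi a) != [::].

Let FB_gt0 a : (0 < size (FB (phi a)))%N.
Proof. by rewrite lt0n size_eq0. Qed.

Lemma exchange_fiber k : psi (exchange k).1 = phi k.1.
Proof. by apply/eqP; rewrite -FBP mem_nth// ltn_mod. Qed.

(** The pattern depends on [a] and [b] only through a Boolean, two fibre sizes and two indices;
    bounded fibres therefore leave finitely many patterns. *)
Lemma block_shift_exchange a b : block_shift exchange a b = fun m =>
  let q := (m * size (FA (phi a)) + index a (FA (phi a)))%N in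
  if (psi b == phi a) && (q %% size (FB (phi a)) == index b (FB (phi a)))%N
  then Some (q %/ size (FB (phi a)))%N else None.
Proof.
apply/funext => m; rewrite /block_shift /=.
set q := (m * _ + _)%N; set n := size _.
have qn : (q %% n < n)%N by rewrite ltn_mod; exact: FB_gt0.
congr (if _ then _ else _); apply/eqP/andP => [<-|[/eqP ba /eqP ->]].
  by rewrite -FBP mem_nth// index_uniq.
by rewrite nth_index// FBP ba.
Qed.

Lemma exchange_blocks_finite N : (forall z, (size (FA z) <= N)%N) ->
  (forall z, (size (FB z) <= N)%N) ->
  finite_set (range (fun ab : A * B => block_shift exchange ab.1 ab.2)).
Proof.
move=> FAN FBN.
pose G (t : bool * ('I_N.+1 * 'I_N.+1) * ('I_N.+1 * 'I_N.+1)) (m : nat) : option nat :=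
  let q := (m * t.1.2.1 + t.1.2.2)%N in
  if t.1.1 && (q %% t.2.1 == t.2.2)%N then Some (q %/ t.2.1)%N else None.
apply: (@sub_finite_set _ _ (range G)); last exact/finite_image/finite_finset.
move=> _ [[a b] _ <-]; rewrite block_shift_exchange.
have ia : (index a (FA (phi a)) <= N)%N.
  by apply: leq_trans (FAN (phi a)); exact: index_size.
have ib : (index b (FB (phi a)) <= N)%N.
  by apply: leq_trans (FBN (phi a)); exact: index_size.
exists ((psi b == phi a, (inord (size (FA (phi a))), inord (index a (FA (phi a))))),
  (inord (size (FB (phi a))), inord (index b (FB (phi a))))) => //.
by apply/funext => m; rewrite /G /= !inordK// ltnS.
Qed.

End FiberExchange.

Lemma exchangeK {A B Z : choiceType} (phi : A -> Z) (psi : B -> Z)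
    (FA : Z -> seq A) (FB : Z -> seq B) (dA : B -> A) (dB : A -> B) :
  (forall z, uniq (FB z)) ->
  (forall z a, (a \in FA z) = (phi a == z)) ->
  (forall z b, (b \in FB z) = (psi b == z)) ->
  (forall a, FB (phi a) != [::]) ->
  cancel (exchange phi FA FB dB) (exchange psi FB FA dA).
Proof.
move=> uFB FAP FBP FB0 [a n].
have FB_gt0 : (0 < size (FB (phi a)))%N by rewrite lt0n size_eq0.
have ka := exchange_fiber FA dB FBP FB0 (a, n).
rewrite /exchange -/(exchange phi FA FB dB (a, n)) ka /=.
set q := (n * _ + _)%N; rewrite index_uniq ?ltn_mod// -divn_eq.
have aF : (index a (FA (phi a)) < size (FA (phi a)))%N.
  by rewrite index_mem FAP.
have -> : (q %% size (FA (phi a)))%N = index a (FA (phi a)).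
  by rewrite /q modnMDl modn_small.
have -> : (q %/ size (FA (phi a)))%N = n.
  by rewrite /q divnMDl ?divn_small ?addn0//; exact: leq_ltn_trans aF.
by rewrite nth_index ?FAP.
Qed.

Section CoarseEquivalence.
Context {R : realType}.

Lemma bounded_fibers {A : metricType R} {Z : choiceType} (phi : A -> Z) (c : R) :
  bounded_geometry A -> (forall a a', phi a = phi a' -> mdist a a' <= c) ->
  exists N (F : Z -> seq A), [/\ forall z, uniq (F z), forall z, (size (F z) <= N)%N
    & forall z a, (a \in F z) = (phi a == z)].
Proof.
move=> hA phic; have [N NP] := hA `|c| (normr_ge0 c).
pose F z := [set a | phi a = z].
have Fsub a : F (phi a) `<=` [set a' | mdist a a' <= `|c|].
  by move=> a' /= aa'; apply: le_trans (phic _ _ (esym aa')) (ler_norm c).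
have [FN fF] : (forall z, (F z #<= `I_N)%card) /\ (forall z, finite_set (F z)).
  suff FN z : (F z #<= `I_N)%card.
    by split=> // z; apply: card_le_finite (FN z) _; exact: finite_II.
  have [[a <-]|nz] := pselect (exists a, phi a = z).
    by apply: card_le_trans (NP a); apply: subset_card_le; exact: Fsub.
  have -> : F z = set0 by apply/seteqP; split=> // a /= az; apply: nz; exists a.
  exact: card_ge0.
exists N, (fun z => fset_set (F z)); split.
- by move=> z; exact: fset_uniq.
- by move=> z; apply: geq_card_fset_set; exact: FN.
- move=> z a; rewrite in_fset_set//; apply/idP/eqP; rewrite inE//.
Qed.

(* [X * nat] and [Y * nat] are both identified with [range f * nat]. *)
Lemma coarse_coupling (X Y : metricType R) :
  bounded_geometry X -> bounded_geometry Y -> coarsely_equivalent X Y ->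
  exists (h : X * nat -> Y * nat) (h' : Y * nat -> X * nat),
  [/\ cancel h h', cancel h' h, fiberwise_expansive h, fiberwise_expansive h' &
    finite_set (range (fun zy : X * Y => block_shift h zy.1 zy.2)) /\
    finite_set (range (fun yz : Y * X => block_shift h' yz.1 yz.2))].
Proof.
move=> hX hY [f [fe [g [ge [c c0 fg] [d d0 gf]]]]].
(* A retraction of [Y] onto [range f], close to the identity. Since it fixes [range f], its fibre
   over [f x] contains [f x]; the fibres of [f \o g] over such points may be empty. *)
pose r y := if `[< range f y >] then y else f (g y).
have rc y : mdist (r y) y <= c.
  by rewrite /r; case: asboolP => _; [ rewrite mdistxx ltW|exact: fg].
have rf y : exists x, f x = r y.
  by rewrite /r; case: asboolP => [[x _ fx]|_]; [exists x|exists (g y)].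
have rfK x : r (f x) = f x.
  by rewrite /r; case: asboolP => // nf; case: nf; exists x.
have [|N [FA [uFA FAN FAP]]] := @bounded_fibers X Y f (d + d) hX.
  move=> x x' xx'; have := metric_triangle x (g (f x)) x'.
  by have := gf x; have := gf x'; rewrite /= -xx' (metric_sym x (g (f x))); lra.
have [|M [FB [uFB FBM FBP]]] := @bounded_fibers Y Y r (c + c) hY.
  move=> y y' yy'; have := metric_triangle y (r y) y'.
  by have := rc y; have := rc y'; rewrite -yy' (metric_sym y (r y)); lra.
have FA0 y : FA (r y) != [::].
  have [x fx] := rf y; have : x \in FA (r y) by rewrite FAP fx.
  by case: (FA _).
have FB0 x : FB (f x) != [::].
  have : f x \in FB (f x) by rewrite FBP rfK.
  by case: (FB _).
have L z : (size (FA z) <= N + M)%N by apply: leq_trans (FAN z) (leq_addr _ _).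
have L' z : (size (FB z) <= N + M)%N by apply: leq_trans (FBM z) (leq_addl _ _).
pose h := exchange f FA FB f; pose h' := exchange r FB FA g.
have hfib k : r (h k).1 = f k.1 by exact: (exchange_fiber FA f FBP FB0 k).
have h'fib k : f (h' k).1 = r k.1 by exact: (exchange_fiber FB g FAP FA0 k).
exists h, h'; split.
- exact: exchangeK.
- exact: exchangeK.
- move=> t; have [s s0 fs] := fe (`|t| + 1) ltac:(by rewrite ltr_wpDl).
  exists (c + s + c) => k l kl.
  have := fs k.1 l.1 ltac:(by have := ler_norm t; lra).
  have := rc (h k).1; have := rc (h l).1; rewrite !hfib.
  have := metric_triangle (h k).1 (f k.1) (h l).1.
  have := metric_triangle (f k.1) (f l.1) (h l).1.
  by rewrite (metric_sym (h k).1 (f k.1)); lra.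
- move=> t; have [s s0 gs] := ge (c + `|t| + c + 1) ltac:(by have := normr_ge0 t; lra).
  exists (d + s + d) => k l kl.
  have : mdist (f (h' k).1) (f (h' l).1) <= c + `|t| + c + 1.
    rewrite !h'fib; have := rc k.1; have := rc l.1.
    have := metric_triangle (r k.1) k.1 (r l.1); have := metric_triangle k.1 l.1 (r l.1).
    by rewrite (metric_sym l.1 (r l.1)); have := ler_norm t; lra.
  move=> /gs; have := gf (h' k).1; have := gf (h' l).1; rewrite /=.
  have := metric_triangle (h' k).1 (g (f (h' k).1)) (h' l).1.
  have := metric_triangle (g (f (h' k).1)) (g (f (h' l).1)) (h' l).1.
  by rewrite (metric_sym (h' k).1 (g (f (h' k).1))); lra.
- by split; [exact: (exchange_blocks_finite f uFB FBP FB0 L L')|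
             exact: (exchange_blocks_finite g uFA FAP FA0 L' L)].
Qed.

Lemma roe_isometric {p : R} (p1 : 1 <= p) (X Y : metricType R) :
  bounded_geometry X -> bounded_geometry Y -> coarsely_equivalent X Y ->
  [/\ isometrically_isomorphic (U_roe p1 X) (U_roe p1 Y),
      isometrically_isomorphic (roe p1 X) (roe p1 Y)
    & isometrically_isomorphic (stable_roe p1 X) (stable_roe p1 Y)].
Proof.
move=> hX hY /(coarse_coupling hX hY)[h [h' [hK h'K he h'e [fin fin']]]].
have fE := frame_seq p1 nat.
have fx := frame_ecoord p1 fE (X := X); have fy := frame_ecoord p1 fE (X := Y).
have [U [V [lU UK VK nU [UE VE]]]] := reindex_isometry p1 fx fy hK h'K.
have lV := inverse_linear lU UK VK; have nV := inverse_norm VK nU.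
have UE' f y m : U f y m = f (h' (y, m)).1 (h' (y, m)).2 by exact: (UE f (y, m)).
have VE' f z m : V f z m = f (h (z, m)).1 (h (z, m)).2 by exact: (VE f (z, m)).
split; apply: (conj_isometric lU UK VK nU).
- by move=> T [].
- exact: (conj_U_roe hX hK h'K he h'e lU UK VK nU UE' VE').
- exact: (conj_U_roe hY h'K hK h'e he lV VK UK nV VE' UE').
- by move=> T [].
- exact: (conj_roe hX hK h'K he h'e lU UK VK nU UE' VE').
- exact: (conj_roe hY h'K hK h'e he lV VK UK nV VE' UE').
- by move=> T [].
- exact: (conj_stable_roe hX hK h'K he h'e lU UK VK nU UE' VE' fin' fin).
- exact: (conj_stable_roe hY h'K hK h'e he lV VK UK nV VE' UE' fin fin').
Qed.

End CoarseEquivalence.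

Theorem corollary1p8 (R : realType) (p : R) (p1 : 1 <= p)
    (X Y : metricType R)
    (hX : bounded_geometry X) (hY : bounded_geometry Y) :
  (bijectively_coarsely_equivalent X Y <->
     isometrically_isomorphic (uniform_roe p1 X) (uniform_roe p1 Y)) /\
  (forall (sX sY : option nat)
     (A : set (ellp p1 X (ellp p1 (roe_index sX) R[i]^o) ->
               ellp p1 X (ellp p1 (roe_index sX) R[i]^o)))
     (B : set (ellp p1 Y (ellp p1 (roe_index sY) R[i]^o) ->
               ellp p1 Y (ellp p1 (roe_index sY) R[i]^o))),
     roe_type_algebra A -> roe_type_algebra B ->
     isometrically_isomorphic A B -> coarsely_equivalent X Y) /\
  (isometrically_isomorphic (stable_roe p1 X) (stable_roe p1 Y) ->
     coarsely_equivalent X Y) /\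
  (coarsely_equivalent X Y ->
     [/\ isometrically_isomorphic (U_roe p1 X) (U_roe p1 Y),
         isometrically_isomorphic (roe p1 X) (roe p1 Y)
       & isometrically_isomorphic (stable_roe p1 X) (stable_roe p1 Y)]).
Proof.
split; [split; [exact: uniform_roe_isometric|exact: uniform_rigidity]|split; [|split]].
- by move=> sX sY A B; exact: roe_type_rigidity.
- exact: stable_rigidity.
- exact: roe_isometric.
Qed.
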